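(* Let $\{a_{lm}\}$ be the spherical harmonic coefficients of a zero-mean isotropic Gaussian field on the sphere with angular power spectrum $C_l>0$, as described in the context. Let $l_1\le l_2\le l_3$ be positive integers satisfying the triangle rule ($l_i\le l_j+l_k$ for all permutations $(i,j,k)$ of $(1,2,3)$) with $l_1+l_2+l_3$ even, and let $$I_{l_1l_2l_3}=(-1)^{(l_1+l_2+l_3)/2}\,\frac{1}{\sqrt{C_{l_1}C_{l_2}C_{l_3}}}\sum_{m_1=-l_1}^{l_1}\sum_{m_2=-l_2}^{l_2}\sum_{m_3=-l_3}^{l_3}\begin{pmatrix} l_1 & l_2 & l_3\\ m_1 & m_2 & m_3\end{pmatrix} a_{l_1m_1}a_{l_2m_2}a_{l_3m_3}.$$ Then $E I_{l_1l_2l_3}^2=\Delta_{l_1l_2l_3}$. Moreover, for each $p\in\{2,3,4\}$ there is a constant $c_p$ (independent of $l_1,l_2,l_3$) such that for all such triples $$\left|E I_{l_1l_2l_3}^{2p}-(2p-1)!!\,\Delta_{l_1l_2l_3}^p\right|\le \frac{c_p}{l_1}.$$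
   Context: The coefficients: for each integer $l\ge1$, $a_{l0}$ is real $N(0,C_l)$; for $1\le m\le l$, $a_{lm}$ is complex Gaussian with independent real and imaginary parts each $N(0,C_l/2)$; the family $\{a_{lm}: l\ge1, 0\le m\le l\}$ is independent; and $a_{l,-m}=(-1)^m\overline{a_{lm}}$. Thus $E|a_{lm}|^2=C_l$ and $E a_{lm}a_{l'm'}=(-1)^m C_l\delta_l^{l'}\delta_m^{-m'}$. The symbol $\begin{pmatrix} l_1 & l_2 & l_3\\ m_1 & m_2 & m_3\end{pmatrix}$ is the Wigner $3j$ symbol. For $l_1\le l_2\le l_3$, $\Delta_{l_1l_2l_3}=1$ if $l_1<l_2<l_3$, $=2$ if exactly two of the $l_i$ are equal, and $=6$ if $l_1=l_2=l_3$. $(2p-1)!!=(2p-1)(2p-3)\cdots1$. *)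

(* Defs.v *)
From HB Require Import structures.
From mathcomp Require Import all_boot all_order all_algebra.
From mathcomp Require Import all_classical all_reals all_analysis.
From mathcomp Require Import complex.
Set Implicit Arguments. Unset Strict Implicit. Unset Printing Implicit Defensive.
Import Order.TTheory GRing.Theory Num.Theory.
Local Open Scope classical_set_scope.
Local Open Scope ring_scope.

Definition ifact {R : realType} (z : int) : R := ((`|z|%N)`!)%:R.

Definition sgnpow {R : realType} (z : int) : R := (-1) ^+ (`|z|%N).

(* The Wigner 3j symbol ( l1 l2 l3 ; m1 m2 m3 ), given by the Racah
   formula; it is 0 unless m1+m2+m3 = 0, |m_i| <= l_i and the triangle
   rule holds. *)
Definition wigner3j {R : realType} (l1 l2 l3 : nat) (m1 m2 m3 : int) : R :=
  let j1 : int := l1%:Z in let j2 : int := l2%:Z in let j3 : int := l3%:Z in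
  if [&& m1 + m2 + m3 == 0, `|m1| <= j1, `|m2| <= j2, `|m3| <= j3,
         (l1 <= l2 + l3)%N, (l2 <= l1 + l3)%N & (l3 <= l1 + l2)%N]
  then
    sgnpow (j1 - j2 - m3) *
    Num.sqrt (ifact (j1 + j2 - j3) * ifact (j1 - j2 + j3) * ifact (- j1 + j2 + j3)
              / ifact (j1 + j2 + j3 + 1)) *
    Num.sqrt (ifact (j1 + m1) * ifact (j1 - m1) * ifact (j2 + m2) * ifact (j2 - m2)
              * ifact (j3 + m3) * ifact (j3 - m3)) *
    \sum_(0 <= k < (l1 + l2 + l3).+1 |
           [&& 0 <= j3 - j2 + k%:Z + m1, 0 <= j3 - j1 + k%:Z - m2,
               0 <= j1 + j2 - j3 - k%:Z, 0 <= j1 - k%:Z - m1 &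
               0 <= j2 - k%:Z + m2])
      (sgnpow k%:Z /
        (ifact k%:Z * ifact (j3 - j2 + k%:Z + m1) * ifact (j3 - j1 + k%:Z - m2)
         * ifact (j1 + j2 - j3 - k%:Z) * ifact (j1 - k%:Z - m1)
         * ifact (j2 - k%:Z + m2)))
  else 0.

(* The real building blocks are X l m b : T -> R, where
   X l 0 false            = a_{l0}                     (l >= 1)
   X l m false, X l m true = Re a_{lm}, Im a_{lm}     (1 <= m <= l).
   The index set of genuinely used variables: *)
Definition coeff_index : set (nat * nat * bool) :=
  [set i | let: (l, m, b) := i in
           [|| [&& (0 < l)%N, m == 0%N & ~~ b] | (0 < m <= l)%N]].

Definition mutually_independent {d} {T : measurableType d} {R : realType}
    (P : probability T R) {I : eqType} (S : set I) (Y : I -> T -> R) : Prop :=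
  forall (J : seq I) (B : I -> set R),
    (forall i, i \in J -> S i) -> uniq J ->
    (forall i, i \in J -> measurable (B i)) ->
    P (\bigcap_(i in [set i | i \in J]) (Y i @^-1` B i)) =
    (\prod_(i <- J) P (Y i @^-1` B i))%E.

Definition centered_gaussian {d} {T : measurableType d} {R : realType}
    (P : probability T R) (v : R) (Y : T -> R) : Prop :=
  measurable_fun setT Y /\
  forall B : set R, measurable B -> P (Y @^-1` B) = normal_prob 0 (Num.sqrt v) B.

Definition isotropic_gaussian_coeffs {d} {T : measurableType d} {R : realType}
    (P : probability T R) (C : nat -> R) (X : nat -> nat -> bool -> T -> R) : Prop :=
  [/\ forall l, (0 < l)%N -> 0 < C l,
      forall l, (0 < l)%N -> centered_gaussian P (C l) (X l 0%N false),
      forall l m b, (0 < m <= l)%N -> centered_gaussian P (C l / 2) (X l m b) &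
      mutually_independent P coeff_index (fun i => X i.1.1 i.1.2 i.2)].

Definition alm {T : Type} {R : realType} (X : nat -> nat -> bool -> T -> R)
    (l : nat) (m : int) (w : T) : R[i] :=
  let n := `|m|%N in
  let a : R[i] := if n == 0%N then Complex (X l 0%N false w) 0
                  else Complex (X l n false w) (X l n true w) in
  if 0 <= m then a else (-1) ^+ n * conjc a.

(* The cubic statistic I_{l1 l2 l3}.  The complex sum is real (its
   imaginary part vanishes identically), so I is its real part. *)
Definition Istat {T : Type} {R : realType} (C : nat -> R)
    (X : nat -> nat -> bool -> T -> R) (l1 l2 l3 : nat) (w : T) : R :=
  (-1) ^+ ((l1 + l2 + l3) %/ 2) / Num.sqrt (C l1 * C l2 * C l3) *
  complex.Re (\sum_(m1 <- [seq (k%:Z - l1%:Z) | k <- iota 0 (l1.*2.+1)])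
              \sum_(m2 <- [seq (k%:Z - l2%:Z) | k <- iota 0 (l2.*2.+1)])
              \sum_(m3 <- [seq (k%:Z - l3%:Z) | k <- iota 0 (l3.*2.+1)])
                ((wigner3j l1 l2 l3 m1 m2 m3)%:C * alm X l1 m1 w * alm X l2 m2 w
                 * alm X l3 m3 w))%C.

(* Delta_{l1 l2 l3} for l1 <= l2 <= l3. *)
Definition Delta3 {R : realType} (l1 l2 l3 : nat) : R :=
  if (l1 < l2 < l3)%N then 1
  else if (l1 == l2) && (l2 == l3) then 6 else 2.

Definition odd_dfact (p : nat) : nat := \prod_(i < p) (i.*2.+1).

Definition admissible (l1 l2 l3 : nat) : bool :=
  [&& (0 < l1)%N, (l1 <= l2 <= l3)%N,
      (l1 <= l2 + l3)%N, (l2 <= l1 + l3)%N, (l3 <= l1 + l2)%N &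
      ~~ odd (l1 + l2 + l3)].

(* Main.v *)
Require Import Defs.
From HB Require Import structures.
From mathcomp Require Import all_boot all_order all_algebra.
From mathcomp Require Import ring lra zify.
From mathcomp Require mpoly.
Set Implicit Arguments. Unset Strict Implicit. Unset Printing Implicit Defensive.
Import Order.TTheory GRing.Theory Num.Theory.
Local Open Scope ring_scope.

(** In independent standard normal coordinates [y], the statistic is a cubic form
    [I = 6^-1 * sum S i j k y_i y_j y_k] with [S] symmetric and traceless.  Gaussian
    integration by parts gives [E I^(k+2) = (k+1) (|S|^2/6) E I^k + error], where the
    error pairs [S] with lower contractions of [S] against the tensors of expected
    derivatives of [I^k].  Each such contraction costs the squared operator norm of a
    flattening of [S], which the orthogonality of the 3j symbols bounds by a multiple
    of [1/(2 l1 + 1)], while [|S|^2/6 = Delta].  The moments follow by induction.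

    Orthogonality itself comes from the ladder relations, read off Racah's formula:
    they make [sum_(m1, m2) w(m1, m2, m3)^2] independent of [m3], and for [m3 = l3]
    Racah's sum has one term and a binomial convolution evaluates the norm. *)

(** * Moments of traceless Gaussian cubic forms *)

(** The coefficients are complex and tied by $a_{l,-m}=(-1)^m\overline{a_{lm}}$, while integration
    by parts wants independent real coordinates. A unitary matrix takes the normalized real and
    imaginary parts to $a_{lm}/\sqrt{C_l}$, so orthogonality of the 3j symbols survives the change
    of coordinates; the tensor becomes real because $l_1+l_2+l_3$ is even. Its traces vanish because
    contracting two indices of an invariant tensor leaves an invariant vector of positive degree;
    the cubic form is then a third Hermite polynomial and integration by parts leaves no lower-order
    terms. The moments alone do not satisfy a closed recursion, so expected derivatives of $I^k$ of
    every order are bounded simultaneously. That argument is pure algebra: derivations and a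
    functional obeying Stein's identity, realized on polynomials. Probability enters only through
    the expectations of monomials. The tensor actually used is $S/6$, of squared norm
    $\Delta/6\le1$. This explains the powers of 6 and 36 at the end, and why the constants depend on
    $p$ alone. *)

Section ListSums.
Variables (R : realFieldType) (J : finType).

(** Expected derivatives are tensors whose order changes along the induction. Indexing them by
    sequences keeps all orders in one type, and one more derivative is one more cons. *)
Fixpoint list_sum (n : nat) (f : seq J -> R) : R :=
  if n is n'.+1 then \sum_j list_sum n' (fun s => f (j :: s)) else f [::].

Lemma eq_list_sum n f g : f =1 g -> list_sum n f = list_sum n g.
Proof.
elim: n f g => [|n IH] f g fg /=; first exact: fg.
by apply: eq_bigr => j _; apply: IH => s; apply: fg.
Qed.

Lemma ler_list_sum n f g : (forall s, f s <= g s) -> list_sum n f <= list_sum n g.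
Proof.
elim: n f g => [|n IH] f g fg /=; first exact: fg.
by apply: ler_sum => j _; apply: IH => s; apply: fg.
Qed.

Lemma list_sumD n f g : list_sum n (fun s => f s + g s) = list_sum n f + list_sum n g.
Proof.
elim: n f g => [|n IH] f g //=.
by rewrite -big_split /=; apply: eq_bigr => j _; rewrite IH.
Qed.

Lemma list_sumZ n c f : list_sum n (fun s => c * f s) = c * list_sum n f.
Proof.
elim: n f => [|n IH] f //=.
by rewrite mulr_sumr; apply: eq_bigr => j _; rewrite IH.
Qed.

Lemma list_sum0 n : list_sum n (fun _ => 0) = 0.
Proof. by elim: n => //= n IH; rewrite big1. Qed.

Lemma list_sum_ge0 n f : (forall s, 0 <= f s) -> 0 <= list_sum n f.
Proof. by move=> f0; rewrite -(list_sum0 n); apply: ler_list_sum. Qed.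

Lemma exchange_list_sum n (f : J -> seq J -> R) :
  \sum_j list_sum n (f j) = list_sum n (fun s => \sum_j f j s).
Proof.
elim: n f => [|n IH] f //=.
by rewrite exchange_big /=; apply: eq_bigr => i _; rewrite IH.
Qed.

End ListSums.

Lemma scale_in_alg (R : fieldType) (A : comAlgType R) (a : R) (u : A) :
  a *: u = GRing.in_alg A a * u.
Proof. by rewrite mulr_algl. Qed.

Section Constants.
Variable R : realFieldType.

(** [a] counts derivatives not yet distributed by the Leibniz rule, [b] those on $I$, [c] those on
    $I^k$. The factors 2 come from $(y+z)^2\le 2y^2+2z^2$. The final 0 reflects that fourth
    derivatives of a cubic vanish; at [b = 0] it is a mere default, the bound being applied only for
    positive [b]. *)
Fixpoint cPhi (K : R) (q : nat -> R) (a b c : nat) : R :=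
  if a is a'.+1 then 2 * cPhi K q a' b.+1 c + 2 * cPhi K q a' b c.+1
  else match b with
       | 1 => q c.+2
       | 2 => q c.+1
       | 3 => K * q c
       | _ => 0
       end.

(** Bounds the order-[r] expected derivatives of $I^k$ up to the weight [wt]. Order 0 costs one
    Cauchy-Schwarz against $S$, which has three indices. A positive order spends one derivative on
    the chain rule: hence the square of the exponent, and one derivative already on $I$. *)
Fixpoint cQ (K : R) (k r : nat) : R :=
  match k, r with
  | 0, _ => 1
  | k'.+1, 0 => K * cQ K k' 3
  | k'.+1, r'.+1 => k'.+1%:R ^+ 2 * cPhi K (cQ K k') r' 1 0
  end.

Lemma cPhi_ge0 K q a b c : 0 <= K -> (forall r, 0 <= q r) -> 0 <= cPhi K q a b c.
Proof.
move=> K0 q0; elim: a b c => [|a IH] b c /=.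
  by case: b => [|[|[|[|b]]]] //; rewrite mulr_ge0.
by rewrite addr_ge0 ?mulr_ge0.
Qed.

Lemma cQ_ge0 K k r : 0 <= K -> 0 <= cQ K k r.
Proof.
move=> K0; elim: k r => [|k IH] [|r] //=; first by rewrite mulr_ge0.
by rewrite mulr_ge0 ?sqr_ge0 ?cPhi_ge0.
Qed.

(** The recursion of the error at exponent $2p$: three cross terms, each at most half of [K] plus
    the relevant [cQ], and the previous error times [K / 6], which dominates the variance. *)
Fixpoint cM (K : R) (p : nat) : R :=
  if p is p'.+1 then p'.*2.+1%:R *
    (2^-1 * (3 * K + cQ K p'.*2 2 + cQ K p'.*2 2 + cQ K p'.*2 4) / 6 + K / 6 * cM K p')
  else 0.

End Constants.

(** * Integration by parts for a traceless cubic form, in an abstract algebra with derivations *)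

Section GaussianCubic.
Variables (R : realFieldType) (J : finType) (A : comAlgType R).
Variables (x : J -> A) (D : J -> {linear A -> A}) (L : {scalar A}).
Hypothesis D_mul : forall j p q, D j (p * q) = D j p * q + p * D j q.
Hypothesis D_comm : forall i j p, D i (D j p) = D j (D i p).
Hypothesis D_x : forall i j, D i (x j) = (i == j)%:R.
Hypothesis L1 : L 1 = 1.
Hypothesis L_stein : forall i p, L (x i * p) = L (D i p).

Variable S : J -> J -> J -> R.
Hypothesis S12 : forall i j k, S i j k = S j i k.
Hypothesis S23 : forall i j k, S i j k = S i k j.
Hypothesis S_trace : forall k, \sum_i S i i k = 0.
Variables (K eps : R).
Hypothesis eps_gt0 : 0 < eps.
Hypothesis eps_le1 : eps <= 1.
Hypothesis S_norm : \sum_i \sum_j \sum_k S i j k ^+ 2 <= K.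
Hypothesis S_op : forall y : J -> R,
  \sum_j \sum_k (\sum_i y i * S i j k) ^+ 2 <= eps * \sum_i y i ^+ 2.

Definition cubic : A := 6^-1 *: \sum_i \sum_j \sum_k S i j k *: (x i * x j * x k).

Lemma D1 j : D j 1 = 0.
Proof.
have /eqP := D_mul j 1 1; rewrite !mulr1 mul1r -[X in X == _]addr0.
by rewrite (inj_eq (addrI _)) eq_sym => /eqP.
Qed.

Lemma sum_delta a (f : J -> A) : \sum_i (a == i)%:R * f i = f a.
Proof.
rewrite (bigD1 a) //= eqxx mul1r big1 ?addr0 // => i /negPf.
by rewrite eq_sym => ->; rewrite mul0r.
Qed.

Lemma D_xx a i j : D a (x i * x j) = (a == i)%:R * x j + (a == j)%:R * x i.
Proof. by rewrite D_mul !D_x [x i * _]mulrC. Qed.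

Lemma D_cubic a : D a cubic = 2^-1 *: \sum_j \sum_k S a j k *: (x j * x k).
Proof.
rewrite /cubic linearZ /= linear_sum /=.
under eq_bigr => i _.
  rewrite linear_sum /=.
  under eq_bigr => j _.
    rewrite linear_sum /=.
    under eq_bigr => k _.
      rewrite linearZ /= D_mul D_xx D_x.
      have -> : S i j k *: (((a == i)%:R * x j + (a == j)%:R * x i) * x k
                  + x i * x j * (a == k)%:R)
        = (a == i)%:R * (S i j k *: (x j * x k)) +
          (a == j)%:R * (S i j k *: (x i * x k)) +
          (a == k)%:R * (S i j k *: (x i * x j)).
        by rewrite !scale_in_alg; ring.
      over.
    rewrite 2!big_split /= sum_delta -!mulr_sumr.
    over.
  rewrite 2!big_split /= sum_delta -!mulr_sumr.
  over.
rewrite 2!big_split /= sum_delta.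
under [X in _ + X + _]eq_bigr => i _ do under eq_bigr => k _ do rewrite S12.
under [X in _ + _ + X]eq_bigr => i _ do under eq_bigr => k _ do rewrite S23 S12.
set T := (X in X + _ + _).
have -> : 6^-1 = 2^-1 * 3^-1 :> R by lra.
rewrite -scalerA; congr (_ *: _).
have -> : T + T + T = 3 *: T by rewrite !scale_in_alg; ring.
by rewrite scalerA mulVf ?scale1r // pnatr_eq0.
Qed.

Lemma DD_cubic a b : D b (D a cubic) = \sum_k S a b k *: x k.
Proof.
rewrite D_cubic linearZ /= linear_sum /=.
under eq_bigr => j _.
  rewrite linear_sum /=.
  under eq_bigr => k _.
    rewrite linearZ /= D_xx.
    have -> : S a j k *: ((b == j)%:R * x k + (b == k)%:R * x j)
      = (b == j)%:R * (S a j k *: x k) + (b == k)%:R * (S a j k *: x j).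
      by rewrite !scale_in_alg; ring.
    over.
  rewrite big_split /= sum_delta -!mulr_sumr.
  over.
rewrite big_split /= sum_delta.
under [X in _ + X]eq_bigr => j _ do rewrite S23.
set T := (X in X + _).
have -> : T + T = 2 *: T by rewrite !scale_in_alg; ring.
by rewrite scalerA mulVf ?scale1r // pnatr_eq0.
Qed.

Lemma DDD_cubic a b c : D c (D b (D a cubic)) = (S a b c)%:A.
Proof.
rewrite DD_cubic linear_sum /=.
rewrite -[RHS](sum_delta c (fun k => (S a b k)%:A)).
by apply: eq_bigr => k _; rewrite linearZ /= D_x !scale_in_alg; ring.
Qed.

Lemma DDDD_cubic a b c d : D d (D c (D b (D a cubic))) = 0.
Proof. by rewrite DDD_cubic linearZ /= D1 scaler0. Qed.

Fixpoint deriv_seq (s : seq J) (p : A) : A :=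
  if s is j :: s' then deriv_seq s' (D j p) else p.

Lemma deriv_seqP s : linear (deriv_seq s).
Proof. by elim: s => [|j s IH] a p q //=; rewrite linearP IH. Qed.

Lemma deriv_seq_comm s j p : deriv_seq s (D j p) = D j (deriv_seq s p).
Proof. by elim: s p => //= i s IH p; rewrite D_comm IH. Qed.

Lemma deriv_seqD s p q : deriv_seq s (p + q) = deriv_seq s p + deriv_seq s q.
Proof. by have := deriv_seqP s 1 p q; rewrite !scale1r. Qed.

Lemma deriv_seq0 s : deriv_seq s 0 = 0.
Proof. by elim: s => //= j s; rewrite linear0. Qed.

Lemma deriv_seqZ s a p : deriv_seq s (a *: p) = a *: deriv_seq s p.
Proof. by have := deriv_seqP s a p 0; rewrite deriv_seq0 !addr0. Qed.

Definition dmoment k s : R := L (deriv_seq s (cubic ^+ k)).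
(** An intermediate stage of the Leibniz rule for a derivative of $I\cdot I^k$: [u] has fallen on
    $I$, [t] on $I^k$, and [s] is still outside. *)
Definition dmoment2 k s u t : R := L (deriv_seq s (deriv_seq u cubic * deriv_seq t (cubic ^+ k))).

Lemma dmoment2_cons k j s u t :
  dmoment2 k (j :: s) u t = dmoment2 k s (j :: u) t + dmoment2 k s u (j :: t).
Proof. by rewrite /dmoment2 /= D_mul deriv_seqD linearD /= !deriv_seq_comm. Qed.

Lemma D_exp j p k : D j (p ^+ k.+1) = k.+1%:R *: (D j p * p ^+ k).
Proof.
elim: k => [|k IH]; first by rewrite expr1 expr0 mulr1 scale1r.
rewrite exprS D_mul IH !scale_in_alg !exprS -[k.+2%:R]natr1; ring.
Qed.

Lemma dmoment_cons k j s : dmoment k.+1 (j :: s) = k.+1%:R * dmoment2 k s [:: j] [::].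
Proof. by rewrite /dmoment /dmoment2 /= D_exp deriv_seqZ linearZ. Qed.

(** Stein's identity is used twice. The first use also differentiates the second variable, which
    produces $\sum_i T_{ii}L(Z)$; the trace condition kills exactly this term, so the quadratic form
    acts as a second-order differential operator. *)
Lemma L_quadratic (Z : A) (T : J -> J -> R) : \sum_i T i i = 0 ->
  L ((\sum_i \sum_j T i j *: (x i * x j)) * Z) = \sum_i \sum_j T i j * L (D j (D i Z)).
Proof.
move=> T0; rewrite mulr_suml linear_sum /=.
transitivity (\sum_i (T i i * L Z + \sum_j T i j * L (D j (D i Z)))); last first.
  by rewrite big_split /= -mulr_suml T0 mul0r add0r.
apply: eq_bigr => i _; rewrite mulr_suml linear_sum /=.
transitivity (\sum_j (T i j * (i == j)%:R * L Z + T i j * L (D j (D i Z)))); last first.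
  rewrite big_split /= (bigD1 i) //= eqxx mulr1 big1 ?addr0 // => j /negPf.
  by rewrite eq_sym => ->; rewrite mulr0 mul0r.
apply: eq_bigr => j _.
rewrite -scalerAl linearZ /= -[x i * x j * Z]mulrA L_stein D_mul D_x linearD /= L_stein mulrDr -mulrA.
by congr (_ * _ + _); rewrite mulr_natl linearMn /= mulr_natl.
Qed.

(** The first derivative of $I$ is a traceless quadratic form, so one derivative on $I$ is traded
    for two on $I^k$, contracted with $S$. The next three lemmas treat the linear, constant and zero
    derivatives of $I$ in the same way. *)
Lemma dmoment2_1 k j t :
  dmoment2 k [::] [:: j] t = 2^-1 * \sum_a \sum_b S j a b * dmoment k (b :: a :: t).
Proof.
rewrite /dmoment2 /dmoment /= D_cubic -scalerAl linearZ /= L_quadratic; last first.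
  by rewrite -[RHS](S_trace j); apply: eq_bigr => i _; rewrite S12 S23.
congr (_ * _); apply: eq_bigr => a _; apply: eq_bigr => b _.
by rewrite !deriv_seq_comm D_comm.
Qed.

Lemma dmoment2_2 k i j t :
  dmoment2 k [::] [:: i; j] t = \sum_a S i j a * dmoment k (a :: t).
Proof.
rewrite /dmoment2 /dmoment /= DD_cubic mulr_suml linear_sum /=.
by apply: eq_bigr => a _; rewrite -scalerAl linearZ /= L_stein deriv_seq_comm.
Qed.

Lemma dmoment2_3 k a b c t : dmoment2 k [::] [:: a; b; c] t = S a b c * dmoment k t.
Proof. by rewrite /dmoment2 /dmoment /= DDD_cubic mulr_algl linearZ. Qed.

Lemma dmoment2_4 k a b c d u t : dmoment2 k [::] [:: a, b, c, d & u] t = 0.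
Proof. by rewrite /dmoment2 /= DDDD_cubic deriv_seq0 mul0r linear0. Qed.

(** After Stein's identity in the first variable, the derivative either hits the remaining quadratic
    factor, giving contractions of $S$ that sum to traces and vanish, or hits [p], where
    [L_quadratic] finishes. *)
Lemma L_cubic_mul p :
  L (cubic * p) = 6^-1 * \sum_i \sum_j \sum_k S i j k * L (D k (D j (D i p))).
Proof.
rewrite /cubic -scalerAl linearZ /=; congr (_ * _).
have S31 j : \sum_i S i j i = 0 by rewrite -[RHS](S_trace j); apply: eq_bigr => i _; rewrite S23.
rewrite mulr_suml linear_sum /=.
transitivity (\sum_i L (x i * ((\sum_j \sum_k S i j k *: (x j * x k)) * p))).
  apply: eq_bigr => i _; rewrite [x i * _]mulrA; congr (L (_ * p)).
  rewrite mulr_sumr; apply: eq_bigr => j _; rewrite mulr_sumr; apply: eq_bigr => k _.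
  by rewrite -scalerAr mulrA.
under [LHS]eq_bigr => i _.
  rewrite L_stein D_mul linearD /=.
  have -> : D i (\sum_j \sum_k S i j k *: (x j * x k))
     = \sum_j S i j i *: x j + \sum_k S i i k *: x k.
    rewrite linear_sum /=.
    under eq_bigr => j _.
      rewrite linear_sum /=.
      under eq_bigr => k _.
        rewrite linearZ /= D_xx.
        have -> : S i j k *: ((i == j)%:R * x k + (i == k)%:R * x j)
          = (i == j)%:R * (S i j k *: x k) + (i == k)%:R * (S i j k *: x j).
          by rewrite !scale_in_alg; ring.
        over.
      rewrite big_split /= sum_delta -!mulr_sumr.
      over.
    by rewrite big_split /= sum_delta addrC.
  rewrite L_quadratic; last by rewrite -[RHS](S_trace i); apply: eq_bigr => j _; rewrite S12 S23.
  over.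
rewrite big_split /= -[RHS]add0r; congr (_ + _).
rewrite -linear_sum /= -mulr_suml big_split /= exchange_big /= [X in _ + X]exchange_big /=.
under eq_bigr => i _ do rewrite -scaler_suml S31 scale0r.
under [X in _ + X]eq_bigr => i _ do rewrite -scaler_suml S_trace scale0r.
by rewrite !big1_eq addr0 mul0r linear0.
Qed.

Lemma L_cubic_exp k :
  L (cubic ^+ k.+1) = 6^-1 * \sum_a \sum_b \sum_c S a b c * dmoment k [:: a; b; c].
Proof. by rewrite exprS L_cubic_mul. Qed.

Let K_ge0 : 0 <= K.
Proof.
apply: le_trans S_norm; apply: sumr_ge0 => i _; apply: sumr_ge0 => j _.
by apply: sumr_ge0 => k _; apply: sqr_ge0.
Qed.

(* The operator bound for the transposed flattening of [S], by duality and
   AM-GM: [|z|^2 = <z S, M> <= (|z S|^2 / eps + eps |M|^2) / 2]. *)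
Lemma S_op_tr (M : J -> J -> R) :
  \sum_i (\sum_j \sum_k S i j k * M j k) ^+ 2 <= eps * \sum_j \sum_k M j k ^+ 2.
Proof.
set z := fun i => \sum_j \sum_k S i j k * M j k.
have zE : \sum_i z i ^+ 2 = \sum_j \sum_k (\sum_i z i * S i j k) * M j k.
  transitivity (\sum_i \sum_j \sum_k z i * S i j k * M j k).
    apply: eq_bigr => i _; rewrite expr2 -[X in _ * X]/(\sum_j \sum_k S i j k * M j k) mulr_sumr; apply: eq_bigr => j _.
    by rewrite mulr_sumr; apply: eq_bigr => k _; rewrite mulrA.
  rewrite exchange_big; apply: eq_bigr => j _; rewrite exchange_big; apply: eq_bigr => k _.
  by rewrite mulr_suml.
have /(_ z) := S_op; set w := fun j k => \sum_i z i * S i j k => hw.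
have : \sum_i z i ^+ 2 <= 2^-1 * (eps^-1 * \sum_j \sum_k w j k ^+ 2 + eps * \sum_j \sum_k M j k ^+ 2).
  rewrite zE 2!mulr_sumr -big_split /= mulr_sumr; apply: ler_sum => j _.
  rewrite !mulr_sumr -big_split /= mulr_sumr; apply: ler_sum => k _.
  rewrite -/(w j k).
  have e2 : eps * eps^-1 = 1 by rewrite divff ?gt_eqF.
  have := sqr_ge0 (w j k - eps * M j k).
  rewrite -(pmulr_rge0 _ (_ : 0 < eps^-1)) ?invr_gt0 // => h.
  have -> : 2^-1 * (eps^-1 * w j k ^+ 2 + eps * M j k ^+ 2) =
    w j k * M j k + 2^-1 * (eps^-1 * (w j k - eps * M j k) ^+ 2) by field; rewrite gt_eqF.
  by rewrite lerDl mulr_ge0 // invr_ge0.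
have : eps^-1 * \sum_j \sum_k w j k ^+ 2 <= \sum_i z i ^+ 2.
  by rewrite ler_pdivrMl.
rewrite -/z; lra.
Qed.

Definition Q k r : R := list_sum r (fun s => dmoment k s ^+ 2).
Definition Phi k a b c : R :=
  list_sum a (fun s => list_sum b (fun u => list_sum c (fun t => dmoment2 k s u t ^+ 2))).

(* Expected derivatives of [I^k] of order not divisible by 3 are of size [eps] in
   squared norm, the others are only bounded: contracting with [S] changes the
   order by [-3], or by [1] or [-1] at the cost of a factor [eps]. *)
Definition wt r : R := if (3 %| r)%N then 1 else eps.

Lemma wt_ge0 r : 0 <= wt r. Proof. by rewrite /wt; case: ifP => // _; apply: ltW. Qed.
Lemma eps_wt r r' : eps * wt r <= wt r'.
Proof.
have e2 : eps * eps <= 1 * eps by rewrite ler_wpM2r // ltW.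
by rewrite /wt; do 2 case: ifP => _; move: e2 eps_gt0 eps_le1; lra.
Qed.

Lemma Q_ge0 k r : 0 <= Q k r.
Proof. by apply: list_sum_ge0 => s; apply: sqr_ge0. Qed.

Lemma Phi_cons k a b c : Phi k a.+1 b c <= 2 * Phi k a b.+1 c + 2 * Phi k a b c.+1.
Proof.
have -> : Phi k a b.+1 c = \sum_j list_sum a (fun s => list_sum b (fun u =>
   list_sum c (fun t => dmoment2 k s (j :: u) t ^+ 2))).
  by rewrite /Phi exchange_list_sum.
have -> : Phi k a b c.+1 = \sum_j list_sum a (fun s => list_sum b (fun u =>
   list_sum c (fun t => dmoment2 k s u (j :: t) ^+ 2))).
  rewrite /Phi exchange_list_sum; apply: eq_list_sum => s.
  by rewrite exchange_list_sum.
rewrite 2!mulr_sumr -big_split /= /Phi /=; apply: ler_sum => j _.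
rewrite -!list_sumZ -list_sumD; apply: ler_list_sum => s.
rewrite -!list_sumZ -list_sumD; apply: ler_list_sum => u.
rewrite -!list_sumZ -list_sumD; apply: ler_list_sum => t.
rewrite dmoment2_cons; set y := dmoment2 _ _ _ _; set z := dmoment2 _ _ _ _.
have := sqr_ge0 (y - z); lra.
Qed.

(** Here $S$ is applied to a pair of indices, so the transposed bound [S_op_tr] is the relevant one.
    The factor $1/4$ left by [dmoment2_1] is discarded. *)
Lemma Phi_1 k c : Phi k 0 1 c <= eps * Q k c.+2.
Proof.
rewrite /Phi /= /Q /=.
under [X in _ <= _ * X]eq_bigr => i _ do rewrite exchange_list_sum.
rewrite !exchange_list_sum -list_sumZ.
apply: ler_list_sum => t.
have := S_op_tr (fun a b => dmoment k (b :: a :: t)).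
rewrite [X in _ <= _ * X -> _]exchange_big /=; apply: le_trans.
apply: ler_sum => j _; rewrite dmoment2_1 exprMn.
set z := (\sum_a _) ^+ 2; have : 0 <= z by apply: sqr_ge0.
lra.
Qed.

(** Here $S$ is applied to a single index, so [S_op] applies for each fixed value [t] of the other
    indices. *)
Lemma Phi_2 k c : Phi k 0 2 c <= eps * Q k c.+1.
Proof.
rewrite /Phi /= /Q /=.
under [X in X <= _]eq_bigr => i _ do rewrite exchange_list_sum.
rewrite !exchange_list_sum -list_sumZ.
apply: ler_list_sum => t.
have := S_op (fun a => dmoment k (a :: t)); apply: le_trans.
rewrite le_eqVlt; apply/orP; left; apply/eqP.
apply: eq_bigr => i _; apply: eq_bigr => j _; rewrite dmoment2_2; congr (_ ^+ 2).
by apply: eq_bigr => a _; rewrite mulrC S23 S12 S23.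
Qed.

(** Third derivatives of $I$ are the entries of $S$, for which only the full norm is available and
    no [eps] is gained. The order drops by exactly 3, so the weight does not ask for one. *)
Lemma Phi_3 k c : Phi k 0 3 c <= K * Q k c.
Proof.
rewrite /Phi /= /Q.
apply: (@le_trans _ _ ((\sum_i \sum_j \sum_k S i j k ^+ 2) * list_sum c (fun s => dmoment k s ^+ 2))); last first.
  by rewrite ler_wpM2r // Q_ge0.
rewrite mulr_suml; apply: ler_sum => i _; rewrite mulr_suml; apply: ler_sum => j _.
rewrite mulr_suml; apply: ler_sum => l _; rewrite -list_sumZ; apply: ler_list_sum => t.
by rewrite dmoment2_3 exprMn.
Qed.

Lemma Phi_4 k b c : Phi k 0 b.+4 c = 0.
Proof.
rewrite /Phi /=; do 4 (rewrite big1 // => ? _).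
rewrite -[RHS](list_sum0 R J b); apply: eq_list_sum => u.
rewrite -[RHS](list_sum0 R J c); apply: eq_list_sum => t.
by rewrite dmoment2_4 expr0n.
Qed.

(** A factor [eps] converts any weight into any other ([eps_wt]), which settles [b = 1] and [b = 2].
    Only [b = 3] comes without this factor, and there the order modulo 3 is unchanged. *)
Lemma Phi_le k q : (forall r, 0 <= q r) -> (forall r, Q k r <= q r * wt r) ->
  forall a b c, (0 < b)%N -> Phi k a b c <= cPhi K q a b c * wt (a + b + c).
Proof.
move=> q0 Qq; elim=> [|a IH] b c b0; last first.
  apply: le_trans (Phi_cons _ _ _ _) _ => /=.
  have := IH b.+1 c isT; have := IH b c.+1 b0.
  by rewrite !addnS !addSn -!addnS; lra.
have small r r' : eps * Q k r <= q r * wt r'.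
  apply: (@le_trans _ _ (eps * (q r * wt r))); first by rewrite ler_wpM2l // ltW.
  by rewrite mulrCA ler_wpM2l // eps_wt.
case: b b0 => [|[|[|[|b]]]] //= _.
- exact: le_trans (Phi_1 _ _) (small _ _).
- exact: le_trans (Phi_2 _ _) (small _ _).
- apply: le_trans (Phi_3 _ _) _; rewrite -mulrA ler_wpM2l //.
  by have := Qq c; rewrite /wt add0n dvdn_addr.
- by rewrite Phi_4 mul0r.
Qed.

Lemma dmoment0 s : dmoment 0 s = (s == [::])%:R.
Proof. by case: s => [|j s]; rewrite /dmoment /= expr0 ?L1 // D1 deriv_seq0 linear0. Qed.

Lemma Q_S k r : Q k.+1 r.+1 = k.+1%:R ^+ 2 * Phi k r 1 0.
Proof.
rewrite /Q /Phi /= -exchange_list_sum mulr_sumr; apply: eq_bigr => j _.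
by rewrite -list_sumZ; apply: eq_list_sum => s; rewrite dmoment_cons exprMn.
Qed.

(** Cauchy-Schwarz against $S$, obtained from the inequality $2tg\le Kt^2+F$ for every $t$. *)
Lemma ler_sqr_sum3 (f : J -> J -> J -> R) :
  (\sum_a \sum_b \sum_c S a b c * f a b c) ^+ 2 <= K * \sum_a \sum_b \sum_c f a b c ^+ 2.
Proof.
set g := \sum_a _; set F := (X in _ <= K * X).
have F0 : 0 <= F.
  by do 3 (apply: sumr_ge0 => ? _); apply: sqr_ge0.
have amgm t : 2 * t * g <= K * t ^+ 2 + F.
  apply: (@le_trans _ _ ((\sum_i \sum_j \sum_k S i j k ^+ 2) * t ^+ 2 + F)); last first.
    by rewrite lerD2r ler_wpM2r // sqr_ge0.
  rewrite /g /F mulr_sumr mulr_suml -big_split; apply: ler_sum => a _ /=.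
  rewrite mulr_sumr mulr_suml -big_split; apply: ler_sum => b _ /=.
  rewrite mulr_sumr mulr_suml -big_split; apply: ler_sum => c _ /=.
  by have := sqr_ge0 (S a b c * t - f a b c); lra.
(* The optimal choice is $t=g/K$. For $K=0$ and $g\neq0$, $t=(F+1)/g$ would give $2(F+1)\le F$ with
   $F\ge0$. *)
have [K0|K0] := eqVneq K 0.
  have [-> | g0] := eqVneq g 0; first by rewrite K0 expr0n mul0r.
  have := amgm ((F + 1) / g); rewrite K0 mul0r add0r -mulrA divfK //; lra.
have Kp : 0 < K by rewrite lt_def K0.
have := amgm (g / K); rewrite -(ler_pM2l Kp) => h.
have -> : g ^+ 2 = K * (2 * (g / K) * g) - K * (K * (g / K) ^+ 2) by field.
by rewrite lerBlDr -mulrDr addrC.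
Qed.

(** Induction on the exponent. Order 0 is compared with order 3 through [L_cubic_exp], both having
    weight 1; positive orders go through [Q_S] and [Phi_le]. *)
Lemma Q_le k r : Q k r <= cQ K k r * wt r.
Proof.
elim: k r => [|k IH] [|r].
- by rewrite /Q /= dmoment0 /wt dvdn0 expr1n mulr1.
- rewrite /Q /= (eq_bigr (fun=> 0)); last first.
    by move=> j _; rewrite -[RHS](list_sum0 R J r); apply: eq_list_sum => s; rewrite dmoment0 expr0n.
  by rewrite big1_eq mul1r wt_ge0.
- rewrite /Q /= /wt dvdn0 mulr1 /dmoment /= L_cubic_exp exprMn.
  apply: (@le_trans _ _ (K * Q k 3)).
    have h := ler_sqr_sum3 (fun a b c => dmoment k [:: a; b; c]).
    have := sqr_ge0 (\sum_a \sum_b \sum_c S a b c * dmoment k [:: a; b; c]).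
    by move: h; rewrite /Q /=; lra.
  by rewrite ler_wpM2l //; have := IH 3; rewrite /wt dvdnn mulr1.
- rewrite Q_S /= -mulrA ler_wpM2l ?sqr_ge0 //.
  have := @Phi_le k (cQ K k) (fun r => cQ_ge0 k r K_ge0) IH r 1 0 isT.
  by rewrite addn0 addn1.
Qed.

(** The chain rule puts [a] on one copy of $I$; the four terms say which of [b], [c] join it. When
    both do, the entry of $S$ appears: this is the main term, and the others are errors. *)
Lemma dmoment_3 k a b c : dmoment k.+1 [:: a; b; c] = k.+1%:R *
  (S a b c * L (cubic ^+ k) + dmoment2 k [::] [:: b; a] [:: c] +
   dmoment2 k [::] [:: c; a] [:: b] + dmoment2 k [::] [:: a] [:: c; b]).
Proof.
rewrite dmoment_cons !dmoment2_cons dmoment2_3 addrA /dmoment /=.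
by rewrite S12 S23 S12 S23 S12.
Qed.

Definition Snorm2 : R := \sum_i \sum_j \sum_k S i j k ^+ 2.

(** The weights [eps] on $S^2$ and its inverse on $f^2$ balance a bounded tensor against one of
    squared norm of order [eps ^+ 2], making both halves of order [eps]. *)
Lemma amgm_sum3 (f : J -> J -> J -> R) c :
  \sum_a \sum_b \sum_c f a b c ^+ 2 <= c * eps ^+ 2 ->
  `| \sum_a \sum_b \sum_c S a b c * f a b c | <= 2^-1 * (K + c) * eps.
Proof.
move=> fc.
have h : \sum_a \sum_b \sum_c (eps * S a b c ^+ 2 + eps^-1 * f a b c ^+ 2) <= (K + c) * eps.
  rewrite (eq_bigr (fun a => eps * (\sum_b \sum_c S a b c ^+ 2) + eps^-1 * (\sum_b \sum_c f a b c ^+ 2))).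
    rewrite big_split /= -!mulr_sumr mulrDl; apply: lerD.
      by rewrite mulrC ler_wpM2r // ltW.
    by rewrite ler_pdivrMl // mulrCA -expr2.
  move=> a _; rewrite !mulr_sumr -big_split; apply: eq_bigr => b _ /=.
  by rewrite !mulr_sumr -big_split.
rewrite -mulrA; apply: (@le_trans _ _ (2^-1 * \sum_a \sum_b \sum_c (eps * S a b c ^+ 2 + eps^-1 * f a b c ^+ 2))); last first.
  by rewrite ler_wpM2l // invr_ge0.
rewrite mulr_sumr; apply: le_trans (ler_norm_sum _ _ _) _; apply: ler_sum => a _.
rewrite mulr_sumr; apply: le_trans (ler_norm_sum _ _ _) _; apply: ler_sum => b _.
rewrite mulr_sumr; apply: le_trans (ler_norm_sum _ _ _) _; apply: ler_sum => d _.
have p : eps^-1 * (eps * S a b d - f a b d) ^+ 2 >= 0 by rewrite mulr_ge0 ?sqr_ge0 // invr_ge0 ltW.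
have m : eps^-1 * (eps * S a b d + f a b d) ^+ 2 >= 0 by rewrite mulr_ge0 ?sqr_ge0 // invr_ge0 ltW.
have pE : eps^-1 * (eps * S a b d - f a b d) ^+ 2 = (eps * S a b d ^+ 2 + eps^-1 * f a b d ^+ 2) - 2 * (S a b d * f a b d).
  by field; rewrite gt_eqF.
have mE : eps^-1 * (eps * S a b d + f a b d) ^+ 2 = (eps * S a b d ^+ 2 + eps^-1 * f a b d ^+ 2) + 2 * (S a b d * f a b d).
  by field; rewrite gt_eqF.
by rewrite pE in p; rewrite mE in m; rewrite ler_norml; apply/andP; split; lra.
Qed.

Lemma moment_step k : `| L (cubic ^+ k.+2) - k.+1%:R * (Snorm2 / 6 * L (cubic ^+ k)) |
  <= k.+1%:R * (2^-1 * (3 * K + cQ K k 2 + cQ K k 2 + cQ K k 4) / 6) * eps.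
Proof.
rewrite L_cubic_exp.
pose f1 a b c := dmoment2 k [::] [:: b; a] [:: c].
pose f2 a b c := dmoment2 k [::] [:: c; a] [:: b].
pose f3 a b c := dmoment2 k [::] [:: a] [:: c; b].
pose T f := \sum_a \sum_b \sum_c S a b c * f a b c.
have -> : \sum_a \sum_b \sum_c S a b c * dmoment k.+1 [:: a; b; c] =
   k.+1%:R * (Snorm2 * L (cubic ^+ k) + T f1 + T f2 + T f3).
  rewrite /Snorm2 /T mulr_suml -!big_split /= mulr_sumr; apply: eq_bigr => a _.
  rewrite mulr_suml -!big_split /= mulr_sumr; apply: eq_bigr => b _.
  rewrite mulr_suml -!big_split /= mulr_sumr; apply: eq_bigr => c _.
  by rewrite dmoment_3 -/(f1 a b c) -/(f2 a b c) -/(f3 a b c); ring.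
(* One [eps] comes from contracting with $S$ in [Phi_1] or [Phi_2]. The second comes from the
   weight: the cross terms involve derivatives of orders 2, 2 and 4, none divisible by 3. *)
have small r : ~~ (3 %| r)%N -> eps * Q k r <= cQ K k r * eps ^+ 2.
  move=> r3; have := Q_le k r; rewrite /wt (negPf r3) => h.
  by rewrite mulrC expr2 mulrA ler_wpM2r // ltW.
have h1 : `|T f1| <= 2^-1 * (K + cQ K k 2) * eps.
  apply: amgm_sum3; apply: le_trans (small 2 isT); apply: le_trans (Phi_2 k 1).
  by rewrite /Phi /= exchange_big.
have h2 : `|T f2| <= 2^-1 * (K + cQ K k 2) * eps.
  apply: amgm_sum3; apply: le_trans (small 2 isT); apply: le_trans (Phi_2 k 1).
  rewrite /Phi /=.
  rewrite [leRHS]exchange_big /=; apply: ler_sum => a _.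
  by rewrite exchange_big.
have h3 : `|T f3| <= 2^-1 * (K + cQ K k 4) * eps.
  apply: amgm_sum3; apply: le_trans (small 4 isT); apply: le_trans (Phi_1 k 2).
  rewrite /Phi /=; apply: ler_sum => a _.
  by rewrite exchange_big.
have -> : 6^-1 * (k.+1%:R * (Snorm2 * L (cubic ^+ k) + T f1 + T f2 + T f3))
   - k.+1%:R * (Snorm2 / 6 * L (cubic ^+ k)) = k.+1%:R * (6^-1 * (T f1 + T f2 + T f3)) by field.
rewrite normrM normr_nat -mulrA ler_wpM2l //.
move: h1 h2 h3; rewrite !ler_norml => /andP[a1 a2] /andP[b1 b2] /andP[c1 c2].
by apply/andP; split; lra.
Qed.

(** Exact, because every cross term contains a derivative of $I^0=1$. *)
Lemma moment2 : L (cubic ^+ 2) = Snorm2 / 6.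
Proof.
rewrite L_cubic_exp mulrC; congr (_ * _); rewrite /Snorm2.
apply: eq_bigr => a _; apply: eq_bigr => b _; apply: eq_bigr => c _.
have E1 i t : dmoment2 0 [::] [:: i] t = 0.
  rewrite dmoment2_1 big1 ?mulr0 // => e _.
  by rewrite big1 // => f _; rewrite dmoment0 mulr0.
have E2 i j t : dmoment2 0 [::] [:: i; j] t = 0.
  by rewrite dmoment2_2 big1 // => e _; rewrite dmoment0 mulr0.
by rewrite dmoment_3 expr0 L1 mulr1 E1 !E2 !addr0 mul1r expr2.
Qed.

(** [moment_step] at exponent [p.*2] supplies the next factor [p.*2.+1] of the double factorial and
    multiplies the old error by at most that factor times [K / 6]. *)
Lemma even_moments p :
  `| L (cubic ^+ p.*2) - (\prod_(i < p) i.*2.+1)%N%:R * (Snorm2 / 6) ^+ p | <= cM K p * eps.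
Proof.
elim: p => [|p IH]; first by rewrite big_ord0 !expr0 L1 mulr1 subrr normr0 mul0r.
have S0 : 0 <= Snorm2 by do 3 (apply: sumr_ge0 => ? _); apply: sqr_ge0.
rewrite doubleS big_ord_recr /= natrM.
have -> : L (cubic ^+ p.*2.+2) - (\prod_(i < p) i.*2.+1)%N%:R * p.*2.+1%:R * (Snorm2 / 6) ^+ p.+1 =
  (L (cubic ^+ p.*2.+2) - p.*2.+1%:R * (Snorm2 / 6 * L (cubic ^+ p.*2))) +
  p.*2.+1%:R * (Snorm2 / 6 * (L (cubic ^+ p.*2) - (\prod_(i < p) i.*2.+1)%N%:R * (Snorm2 / 6) ^+ p)).
  rewrite [_ ^+ p.+1]exprS; set u := L _; set v := L _; move: (_ ^+ p) => z.
  by move: (\prod_(i < p) _)%N p.*2.+1 => n m; ring.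
apply: le_trans (ler_normD _ _) _.
rewrite [X in _ <= X * _]mulrDr [leRHS]mulrDl; apply: lerD; first exact: moment_step.
rewrite normrM normr_nat -!mulrA ler_wpM2l // !normrM (ger0_norm S0) ger0_norm ?invr_ge0 //.
apply: ler_pM => //; first by rewrite mulr_ge0 // invr_ge0.
by rewrite ler_wpM2l // invr_ge0.
Qed.

End GaussianCubic.

(** * The Gaussian expectation as a functional on polynomials *)

Section GaussianFunctional.
Import ssrcomplements mpoly.
Variables (R : realFieldType) (n : nat) (mu : nat -> R).
Hypothesis mu0 : mu 0 = 1.
Hypothesis mu1 : mu 1 = 0.
Hypothesis muSS : forall k, mu k.+2 = k.+1%:R * mu k.

Definition mono_moment (m : 'X_{1..n}) : R := \prod_i mu (m i).
Definition gaussL (p : {mpoly R[n]}) : R := \sum_(m <- msupp p) p@_m * mono_moment m.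

(** The support of a polynomial varies with it; a common degree bound gives a fixed index set, from
    which linearity can be read off. *)
Lemma gaussLE p i : (msize p <= i)%N -> gaussL p = \sum_(m : 'X_{1..n < i}) p@_m * mono_moment m.
Proof.
move=> le_pi; set I : subFinType _ := 'X_{1..n < i}.
rewrite /gaussL (big_mksub I) ?msupp_uniq //=; first last.
  by move=> x /msize_mdeg_lt /leq_trans; apply.
by rewrite big_rmcond //= => j /memN_msupp_eq0 ->; rewrite mul0r.
Qed.

Lemma gaussL_is_scalar : scalar gaussL.
Proof.
move=> a p q; pose k := maxn (msize (a *: p + q)) (maxn (msize p) (msize q)).
rewrite !(@gaussLE _ k) /k ?leq_max ?leqnn ?orbT //.
rewrite mulr_sumr -big_split /=; apply: eq_bigr => m _.
by rewrite mcoeffD mcoeffZ mulrDl mulrA.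
Qed.
HB.instance Definition _ := GRing.isLinear.Build R {mpoly R[n]} R *%R gaussL gaussL_is_scalar.

Lemma gaussLX m : gaussL 'X_[m] = mono_moment m.
Proof. by rewrite /gaussL msuppX big_seq1 mcoeffX eqxx mul1r. Qed.

(** On a monomial only the exponent of the [i]-th variable matters, and the claim is the moment
    recursion there; exponent 0 is the case [mu1]. *)
Lemma gaussL_stein i p : gaussL ('X_i * p) = gaussL p^`M(i).
Proof.
elim/mpolyind: p => [|c m p _ _ IH]; first by rewrite mulr0 linear0 mderiv0 linear0.
rewrite mulrDr mderivD !linearD /= IH; congr (_ + _).
rewrite -scalerAr mderivZ !linearZ /=; congr (_ * _).
rewrite -mpolyXD mderivX linearZ /= !gaussLX /mono_moment (bigD1 i) //= [in RHS](bigD1 i) //=.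
have E : \prod_(j < n | j != i) mu ((U_(i) + m)%MM j) = \prod_(j < n | j != i) mu (m j).
  by apply: eq_bigr => j /negPf ji; rewrite mnmDE mnm1E eq_sym ji.
have E' : \prod_(j < n | j != i) mu ((m - U_(i))%MM j) = \prod_(j < n | j != i) mu (m j).
  by apply: eq_bigr => j /negPf ji; rewrite mnmBE mnm1E eq_sym ji subn0.
rewrite E E' mnmDE mnmBE mnm1E eqxx mulrA; congr (_ * _).
by case: (m i) => [|k] //=; rewrite ?mul0r ?mu1 // add1n muSS subn1.
Qed.

Lemma gaussL1 : gaussL 1 = 1.
Proof. by rewrite -mpolyX0 gaussLX /mono_moment big1 // => i _; rewrite mnm0E. Qed.

End GaussianFunctional.

Section CubicMoments.
Import ssrcomplements mpoly.
Variables (R : realFieldType) (J : finType) (mu : nat -> R).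
Hypothesis mu0 : mu 0 = 1.
Hypothesis mu1 : mu 1 = 0.
Hypothesis muSS : forall k, mu k.+2 = k.+1%:R * mu k.

Definition mvar (j : J) : {mpoly R[#|J|]} := 'X_(enum_rank j).
Definition mder (j : J) : {linear {mpoly R[#|J|]} -> {mpoly R[#|J|]}} := mderiv (enum_rank j).

Definition cubic_moment (S : J -> J -> J -> R) (k : nat) : R := gaussL mu (cubic mvar S ^+ k).

Lemma mder_var i j : mder i (mvar j) = (i == j)%:R.
Proof.
rewrite /mder /mvar /= mderivX mnm1E (inj_eq enum_rank_inj) eq_sym.
case: eqVneq => [->|_]; last by rewrite scale0r.
rewrite scale1r -mpolyX0; congr mpolyX.
by apply/mnmP => k; rewrite mnmBE subnn mnm0E.
Qed.

(* The expectation functional is passed as values on monomials, so that the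
   statement does not mention multivariate polynomials. *)
Lemma cubic_moments_expand (S : J -> J -> J -> R) k :
  exists s : seq (R * {ffun J -> nat}),
    (forall y : J -> R, (6^-1 * \sum_i \sum_j \sum_k S i j k * (y i * y j * y k)) ^+ k =
       \sum_(m <- s) m.1 * \prod_j y j ^+ m.2 j) /\
    cubic_moment S k = \sum_(m <- s) m.1 * \prod_j mu (m.2 j).
Proof.
set p := cubic mvar S ^+ k.
exists [seq (p@_m, [ffun j => m (enum_rank j)]) | m <- msupp p]; split=> [y|]; last first.
  rewrite big_map /gaussL; apply: eq_bigr => m _; congr (_ * _).
  rewrite /mono_moment (reindex (@enum_rank J)) /=; last by apply: onW_bij; apply: enum_rank_bij.
  by apply: eq_bigr => j _; rewrite ffunE.
pose v (i : 'I_#|J|) := y (enum_val i).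
transitivity (meval v p).
  rewrite /p rmorphXn /=; congr (_ ^+ k).
  rewrite /cubic mevalZ; congr (_ * _).
  rewrite raddf_sum; apply: eq_bigr => a _; rewrite raddf_sum; apply: eq_bigr => b _.
  rewrite raddf_sum; apply: eq_bigr => c _; rewrite /= mevalZ !mevalM !mevalXU.
  by rewrite /v !enum_rankK.
rewrite mevalE [RHS]big_map; apply: eq_bigr => m _; congr (_ * _).
rewrite (reindex (@enum_rank J)) /=; last by apply: onW_bij; apply: enum_rank_bij.
by apply: eq_bigr => j _; rewrite ffunE /v enum_rankK.
Qed.

(** The abstract estimates specialized to polynomials. Passing [N] with an equation lets the
    variance be supplied in closed form. *)
Lemma cubic_moments (S : J -> J -> J -> R) (K eps : R) :
  (forall i j k, S i j k = S j i k) -> (forall i j k, S i j k = S i k j) ->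
  (forall k, \sum_i S i i k = 0) -> 0 < eps -> eps <= 1 ->
  \sum_i \sum_j \sum_k S i j k ^+ 2 <= K ->
  (forall y : J -> R, \sum_j \sum_k (\sum_i y i * S i j k) ^+ 2 <= eps * \sum_i y i ^+ 2) ->
  forall N : R, N = (\sum_i \sum_j \sum_k S i j k ^+ 2) / 6 ->
  cubic_moment S 2 = N /\
  forall p, `|cubic_moment S p.*2 - (\prod_(i < p) i.*2.+1)%N%:R * N ^+ p| <= cM K p * eps.
Proof.
move=> S12 S23 tr e0 e1 SK Sop N ->.
have Dm j p q : mder j (p * q) = mder j p * q + p * mder j q by apply: mderivM.
have Dc i j p : mder i (mder j p) = mder j (mder i p) by apply: mderiv_comm.
have st i p : gaussL mu (mvar i * p) = gaussL mu (mder i p) by apply: gaussL_stein.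
have l1 : gaussL (n := #|J|) mu 1 = 1 by apply: gaussL1.
split; first exact: (moment2 (D := mder) Dm Dc mder_var l1 st S12 S23 tr).
by move=> p; apply: (even_moments (D := mder) Dm Dc mder_var l1 st S12 S23 tr e0 e1 SK Sop).
Qed.

Lemma cubic_momentZ (a : R) (S : J -> J -> J -> R) k :
  cubic_moment (fun i j l => a * S i j l) k = a ^+ k * cubic_moment S k.
Proof.
rewrite /cubic_moment.
have -> : cubic mvar (fun i j l => a * S i j l) = a *: cubic mvar S.
  rewrite /cubic scalerA mulrC -scalerA; congr (_ *: _).
  rewrite scaler_sumr; apply: eq_bigr => i _; rewrite scaler_sumr; apply: eq_bigr => j _.
  by rewrite scaler_sumr; apply: eq_bigr => l _; rewrite scalerA.
by rewrite exprZn linearZ.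
Qed.

End CubicMoments.

(** * Symmetrization of a three-index tensor *)

Section Symmetrization.
Variables (R : realFieldType) (J : finType) (V : J -> J -> J -> R).

Definition symmetrize (i j k : J) : R :=
  6^-1 * (V i j k + V j i k + V i k j + V k i j + V j k i + V k j i).

Lemma symmetrizeC12 i j k : symmetrize i j k = symmetrize j i k.
Proof. by rewrite /symmetrize; congr (_ * _); ring. Qed.

Lemma symmetrizeC23 i j k : symmetrize i j k = symmetrize i k j.
Proof. by rewrite /symmetrize; congr (_ * _); ring. Qed.

Lemma symmetrize_trace :
  (forall k, \sum_i V i i k = 0) -> (forall k, \sum_i V i k i = 0) ->
  (forall k, \sum_i V k i i = 0) -> forall k, \sum_i symmetrize i i k = 0.
Proof.
move=> t12 t13 t23 k; rewrite -mulr_sumr !big_split /= t12 t13 t23.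
by rewrite !addr0 mulr0.
Qed.

Lemma exchange_sum3 (F : J -> J -> J -> R) :
  [/\ \sum_i \sum_j \sum_k F j i k = \sum_i \sum_j \sum_k F i j k,
      \sum_i \sum_j \sum_k F i k j = \sum_i \sum_j \sum_k F i j k,
      \sum_i \sum_j \sum_k F k i j = \sum_i \sum_j \sum_k F i j k,
      \sum_i \sum_j \sum_k F j k i = \sum_i \sum_j \sum_k F i j k &
      \sum_i \sum_j \sum_k F k j i = \sum_i \sum_j \sum_k F i j k].
Proof.
have s12 (G : J -> J -> J -> R) : \sum_i \sum_j \sum_k G j i k = \sum_i \sum_j \sum_k G i j k.
  by rewrite exchange_big.
have s23 (G : J -> J -> J -> R) : \sum_i \sum_j \sum_k G i k j = \sum_i \sum_j \sum_k G i j k.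
  by apply: eq_bigr => i _; rewrite exchange_big.
split=> //.
- by rewrite (s23 (fun i j k => F j i k)) s12.
- by rewrite (s12 (fun i j k => F i k j)) s23.
- by rewrite (s23 (fun i j k => F j k i)) (s12 (fun i j k => F i k j)) s23.
Qed.

Lemma sum_symmetrize (F : J -> J -> J -> R) :
  (forall i j k, F i j k = F j i k) -> (forall i j k, F i j k = F i k j) ->
  \sum_i \sum_j \sum_k symmetrize i j k * F i j k = \sum_i \sum_j \sum_k V i j k * F i j k.
Proof.
move=> F12 F23.
have [e1 e2 e3 e4 e5] := exchange_sum3 (fun i j k => V i j k * F i j k).
transitivity (6^-1 * (\sum_i \sum_j \sum_k V i j k * F i j k
  + \sum_i \sum_j \sum_k V j i k * F j i k + \sum_i \sum_j \sum_k V i k j * F i k j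
  + \sum_i \sum_j \sum_k V k i j * F k i j + \sum_i \sum_j \sum_k V j k i * F j k i
  + \sum_i \sum_j \sum_k V k j i * F k j i)).
  rewrite -!big_split /= mulr_sumr; apply: eq_bigr => i _.
  rewrite -!big_split /= mulr_sumr; apply: eq_bigr => j _.
  rewrite -!big_split /= mulr_sumr; apply: eq_bigr => k _.
  have f1 : F j i k = F i j k by rewrite F12.
  have f2 : F i k j = F i j k by rewrite F23.
  have f3 : F k i j = F i j k by rewrite F12.
  have f4 : F j k i = F i j k by rewrite F23.
  have f5 : F k j i = F i j k by rewrite F12.
  by rewrite f1 f2 f3 f4 f5 /symmetrize; ring.
by rewrite e1 e2 e3 e4 e5; field.
Qed.

(** Symmetrization is an orthogonal projection, so only one of the two factors has to be expanded:
    six inner products instead of thirty-six. *)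
Lemma symmetrize_norm2 : \sum_i \sum_j \sum_k symmetrize i j k ^+ 2 =
  6^-1 * (\sum_i \sum_j \sum_k V i j k * V i j k + \sum_i \sum_j \sum_k V i j k * V j i k +
   \sum_i \sum_j \sum_k V i j k * V i k j + \sum_i \sum_j \sum_k V i j k * V k i j +
   \sum_i \sum_j \sum_k V i j k * V j k i + \sum_i \sum_j \sum_k V i j k * V k j i).
Proof.
have -> : \sum_i \sum_j \sum_k symmetrize i j k ^+ 2 = \sum_i \sum_j \sum_k symmetrize i j k * symmetrize i j k.
  by apply: eq_bigr => i _; apply: eq_bigr => j _; apply: eq_bigr => k _; rewrite expr2.
rewrite (sum_symmetrize symmetrizeC12 symmetrizeC23).
rewrite -!big_split /= mulr_sumr; apply: eq_bigr => i _.
rewrite -!big_split /= mulr_sumr; apply: eq_bigr => j _.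
rewrite -!big_split /= mulr_sumr; apply: eq_bigr => k _.
rewrite /symmetrize; ring.
Qed.

(** The square of an average of six terms is at most the average of the squares. Three hypotheses
    cover the six permutations, since exchanging the two free indices does not change the double
    sum. *)
Lemma symmetrize_op (e : R) :
  (forall y : J -> R, \sum_j \sum_k (\sum_i y i * V i j k) ^+ 2 <= e * \sum_i y i ^+ 2) ->
  (forall y : J -> R, \sum_j \sum_k (\sum_i y i * V j i k) ^+ 2 <= e * \sum_i y i ^+ 2) ->
  (forall y : J -> R, \sum_j \sum_k (\sum_i y i * V j k i) ^+ 2 <= e * \sum_i y i ^+ 2) ->
  forall y : J -> R, \sum_j \sum_k (\sum_i y i * symmetrize i j k) ^+ 2 <= e * \sum_i y i ^+ 2.
Proof.
move=> o1 o2 o3 y.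
have := o1 y; have := o2 y; have := o3 y; set B := e * _.
pose a1 j k := \sum_i y i * V i j k; pose a2 j k := \sum_i y i * V j i k.
pose a3 j k := \sum_i y i * V j k i.
rewrite -/(\sum_j \sum_k a1 j k ^+ 2) => h3 h2 h1.
have h1' : \sum_j \sum_k a1 k j ^+ 2 <= B by rewrite exchange_big.
have h2' : \sum_j \sum_k a2 k j ^+ 2 <= B by rewrite exchange_big.
have h3' : \sum_j \sum_k a3 k j ^+ 2 <= B by rewrite exchange_big.
apply: (@le_trans _ _ (6^-1 * (\sum_j \sum_k a1 j k ^+ 2 + \sum_j \sum_k a1 k j ^+ 2 +
  \sum_j \sum_k a2 j k ^+ 2 + \sum_j \sum_k a2 k j ^+ 2 +
  \sum_j \sum_k a3 j k ^+ 2 + \sum_j \sum_k a3 k j ^+ 2))); last first.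
  by move: h1 h2 h3 h1' h2' h3'; rewrite /a1 /a2 /a3; lra.
rewrite -!big_split /= mulr_sumr; apply: ler_sum => j _.
rewrite -!big_split /= mulr_sumr; apply: ler_sum => k _.
have -> : \sum_i y i * symmetrize i j k =
   6^-1 * (a1 j k + a1 k j + a2 j k + a2 k j + a3 j k + a3 k j).
  rewrite /a1 /a2 /a3 -!big_split /= mulr_sumr; apply: eq_bigr => i _.
  by rewrite /symmetrize; ring.
move: (a1 j k) (a1 k j) (a2 j k) (a2 k j) (a3 j k) (a3 k j) => x1 x2 x3 x4 x5 x6.
have q (x z : R) : 2 * (x * z) <= x ^+ 2 + z ^+ 2 by have := sqr_ge0 (x - z); lra.
have := (q x1 x2, q x1 x3, q x1 x4, q x1 x5, q x1 x6).
have := (q x2 x3, q x2 x4, q x2 x5, q x2 x6).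
have := (q x3 x4, q x3 x5, q x3 x6, q x4 x5, q x4 x6, q x5 x6).
move=> [[[[[? ?] ?] ?] ?] ?] [[[? ?] ?] ?] [[[[? ?] ?] ?] ?]; lra.
Qed.

End Symmetrization.

From mathcomp Require Import all_classical all_reals all_analysis measurable_realfun.
From mathcomp Require Import complex.

(** * Wigner 3j symbols *)

Section Racah.
Variable R : realType.

(* [1/z!], extended by [0] to negative integers as for [1/Gamma(z+1)]. *)
Definition rfact (z : int) : R := if z is Posz n then (n`!%:R)^-1 else 0.

Lemma rfact_lt0 z : z < 0 -> rfact z = 0. Proof. by case: z. Qed.

Lemma rfactE z : 0 <= z -> rfact z = (ifact z)^-1.
Proof. by case: z. Qed.

(** With $1/z!=0$ for negative $z$ this also holds at the boundary, so identities between Racah sums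
    can be checked term by term without ranges. *)
Lemma rfact_pred z : z%:~R * rfact z = rfact (z - 1).
Proof.
case: z => [[|n]|n].
- by rewrite mul0r.
- rewrite (_ : n.+1%:Z - 1 = n%:Z) /=; last lia.
  by rewrite factS natrM invfM mulrA divff ?mul1r // pnatr_eq0.
- by rewrite (_ : Negz n - 1 = Negz n.+1) /= ?mulr0 //; lia.
Qed.

Lemma rfact_mul0 y z : y + z < 0 -> rfact y * rfact z = 0.
Proof.
move=> yz; have [y0|y0] := ltP y 0; first by rewrite (rfact_lt0 y0) mul0r.
by rewrite (@rfact_lt0 z) ?mulr0 //; lia.
Qed.

Arguments rfact : simpl never.

Lemma sgnpowE z : sgnpow z = (-1) ^ z :> R.
Proof.
case: z => n; first by [].
by rewrite /sgnpow /= NegzE -exprnN -exprVn invrN1.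
Qed.

Lemma sgnpowD y z : sgnpow (y + z) = sgnpow y * sgnpow z :> R.
Proof. by rewrite !sgnpowE expfzDr // oppr_eq0 oner_eq0. Qed.

Lemma sgnpowN z : sgnpow (- z) = sgnpow z :> R.
Proof. by rewrite /sgnpow abszN. Qed.

Lemma sgnpow_sqr z : sgnpow z * sgnpow z = 1 :> R.
Proof. by rewrite -expr2 /sgnpow -exprM mulnC exprM sqrrN expr1n expr1n. Qed.

Lemma sgnpow_even z : ~~ odd `|z|%N -> sgnpow z = 1 :> R.
Proof. by move=> h; rewrite /sgnpow -signr_odd (negPf h). Qed.

Lemma sgnpow_eq y z : ~~ odd `|y - z|%N -> sgnpow y = sgnpow z :> R.
Proof. by move=> h; rewrite -[y](subrK z) sgnpowD sgnpow_even ?mul1r. Qed.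

(** Racah's alternating sum with its range conditions absorbed by [rfact]. The terms vanish beyond
    [k = c], so the value is independent of the cutoff once [c < N]. *)
Definition racah (N : nat) (a b c d e : int) : R :=
  \sum_(0 <= k < N) (-1) ^+ k *
    (rfact k%:Z * rfact (a + k%:Z) * rfact (b + k%:Z) *
     rfact (c - k%:Z) * rfact (d - k%:Z) * rfact (e - k%:Z)).

Lemma racah_swap_ab N a b c d e : racah N a b c d e = racah N b a c d e.
Proof. by apply: eq_bigr => k _; ring. Qed.

Lemma racah_swap_de N a b c d e : racah N a b c d e = racah N a b c e d.
Proof. by apply: eq_bigr => k _; ring. Qed.

Lemma racah_swap_cd N a b c d e : racah N a b c d e = racah N a b d c e.
Proof. by apply: eq_bigr => k _; ring. Qed.

Lemma racah_ad0 N a b c d e : a + d < 0 -> racah N a b c d e = 0.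
Proof.
move=> h; rewrite /racah big1 // => k _.
have /eqP := @rfact_mul0 (a + k%:Z) (d - k%:Z) ltac:(lia).
by rewrite mulf_eq0 => /orP[] /eqP ->; rewrite !(mul0r, mulr0).
Qed.

Lemma racah_d0 N a b c d e : d < 0 -> racah N a b c d e = 0.
Proof.
move=> h; rewrite /racah big1 // => k _.
by rewrite (@rfact_lt0 (d - k%:Z)) ?(mul0r, mulr0) //; lia.
Qed.

(** A contiguity relation, proved by telescoping in [k]. *)
Lemma racah_ladder N a b c d e : c < N%:Z ->
  (a + c + 1)%:~R * racah N (a + 1) b c (d - 1) e
  + (e + 1)%:~R * racah N a (b - 1) c d (e + 1)
  - (d + b)%:~R * racah N a b c d e = 0.
Proof.
move=> cN; rewrite /racah !mulr_sumr -sumrN -!big_split /=.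
(* [rfact_pred] turns the combined [k]-th term into [g k + h k], where [h k.+1 = - g k]. The end
   terms vanish: [h 0] contains $1/(-1)!$, and the last [g] has a negative argument because
   [c < N]. *)
pose g k := (-1) ^+ k * (rfact k%:Z * rfact (a + k%:Z + 1) * rfact (b + k%:Z) *
     rfact (c - k%:Z - 1) * rfact (d - k%:Z - 1) * rfact (e - k%:Z)).
pose h k := (-1) ^+ k * (rfact (k%:Z - 1) * rfact (a + k%:Z) * rfact (b + k%:Z - 1) *
     rfact (c - k%:Z) * rfact (d - k%:Z) * rfact (e - k%:Z + 1)).
transitivity (\sum_(0 <= k < N) (g k + h k)).
  apply: eq_bigr => k _; rewrite /g /h.
  have -> : a + 1 + k%:Z = a + k%:Z + 1 by ring.
  have -> : b - 1 + k%:Z = b + k%:Z - 1 by ring.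
  have -> : d - 1 - k%:Z = d - k%:Z - 1 by ring.
  have -> : e + 1 - k%:Z = e - k%:Z + 1 by ring.
  have ha := rfact_pred (a + k%:Z + 1); rewrite addrK in ha.
  have hb := rfact_pred (b + k%:Z).
  have hc := rfact_pred (c - k%:Z).
  have hd := rfact_pred (d - k%:Z).
  have he := rfact_pred (e - k%:Z + 1); rewrite addrK in he.
  have hk := rfact_pred k%:Z.
  rewrite -ha -hb -hc -hd -he -hk.
  rewrite !(rmorphD, rmorphN, rmorphB) /=; ring.
have hS k : h k.+1 = - g k.
  rewrite /h /g exprS mulN1r mulNr; congr (- (_ * _)).
  have -> : k.+1%:Z - 1 = k%:Z by lia.
  have -> : a + k.+1%:Z = a + k%:Z + 1 by lia.
  have -> : b + k.+1%:Z - 1 = b + k%:Z by lia.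
  have -> : c - k.+1%:Z = c - k%:Z - 1 by lia.
  have -> : d - k.+1%:Z = d - k%:Z - 1 by lia.
  by have -> : e - k.+1%:Z + 1 = e - k%:Z by lia.
have h0 : h 0%N = 0 by rewrite /h (@rfact_lt0 (0%:Z - 1)) // !mul0r mulr0.
case: N cN => [|N] cN; first by rewrite big_nil.
rewrite big_split /= big_nat_recr //= [X in _ + X]big_nat_recl //= h0 add0r.
rewrite [X in _ + X](eq_bigr (fun k => - g k)) // sumrN addrAC subrr add0r.
by rewrite /g (@rfact_lt0 (c - N%:Z - 1)) ?(mul0r, mulr0) //; lia.
Qed.

(** The substitution [k] to [c - k]. Together with the evident permutations of the arguments it
    gives the symmetries of the 3j symbols, including their sign. *)
Lemma racah_rev N a b (c : nat) d e : (c < N)%N ->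
  racah N a b c d e = (-1) ^+ c * racah N (d - c%:Z) (e - c%:Z) c (a + c%:Z) (b + c%:Z).
Proof.
move=> cN; rewrite /racah.
have trunc (F : nat -> R) : (forall k, (c < k)%N -> F k = 0) ->
    \sum_(0 <= k < N) F k = \sum_(0 <= k < c.+1) F k.
  move=> F0; rewrite (big_cat_nat _ (n := c.+1)) //= [X in _ + X]big_nat [X in _ + X]big1 ?addr0 //.
  by move=> k /andP[ck _]; apply: F0.
rewrite !trunc; last 2 first.
- by move=> k ck; rewrite (@rfact_lt0 (c%:Z - k%:Z)) ?(mul0r, mulr0) //; lia.
- by move=> k ck; rewrite (@rfact_lt0 (c%:Z - k%:Z)) ?(mul0r, mulr0) //; lia.
rewrite big_nat_rev /= mulr_sumr big_nat [RHS]big_nat; apply: eq_bigr => k /andP[_ kc].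
rewrite add0n subSS.
have E : (c - k)%N%:Z = c%:Z - k%:Z by lia.
have -> : (-1) ^+ c * ((-1) ^+ k * (rfact k%:Z * rfact (d - c%:Z + k%:Z) * rfact (e - c%:Z + k%:Z) *
   rfact (c%:Z - k%:Z) * rfact (a + c%:Z - k%:Z) * rfact (b + c%:Z - k%:Z)))
   = ((-1) ^+ c * (-1) ^+ k) * (rfact k%:Z * rfact (d - c%:Z + k%:Z) * rfact (e - c%:Z + k%:Z) *
   rfact (c%:Z - k%:Z) * rfact (a + c%:Z - k%:Z) * rfact (b + c%:Z - k%:Z)) by rewrite mulrA.
have -> : (-1) ^+ c * (-1) ^+ k = (-1) ^+ (c - k) :> R.
  by rewrite -[in LHS](subnK (kc : (k <= c)%N)) exprD -mulrA -expr2 -exprM mulnC exprM sqrrN expr1n expr1n mulr1.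
rewrite E; congr (_ * _).
have -> : a + (c%:Z - k%:Z) = a + c%:Z - k%:Z by ring.
have -> : b + (c%:Z - k%:Z) = b + c%:Z - k%:Z by ring.
have -> : c%:Z - (c%:Z - k%:Z) = k%:Z by ring.
have -> : d - (c%:Z - k%:Z) = d - c%:Z + k%:Z by ring.
have -> : e - (c%:Z - k%:Z) = e - c%:Z + k%:Z by ring.
ring.
Qed.

(** The factors $1/(k-e)!$ and $1/(e-k)!$ leave only [k = e]. *)
Lemma racah_single N b c d (e : nat) : (e < N)%N ->
  racah N (- e%:Z) b c d e = (-1) ^+ e *
    (rfact e%:Z * rfact (b + e%:Z) * rfact (c - e%:Z) * rfact (d - e%:Z)).
Proof.
move=> eN; rewrite /racah (big_cat_nat _ (n := e)) //=; last exact: ltnW.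
rewrite [X in X + _]big_nat [X in X + _]big1 ?add0r; last first.
  by move=> k /andP[_ ke]; rewrite (@rfact_lt0 (- e%:Z + k%:Z)) ?(mul0r, mulr0) //; lia.
rewrite big_ltn // big_nat [X in _ + X]big1 ?addr0; last first.
  by move=> k /andP[ke _]; rewrite (@rfact_lt0 (e%:Z - k%:Z)) ?(mul0r, mulr0) //; lia.
rewrite addNr subrr; have -> : rfact 0 = 1 by rewrite /rfact /= invr1.
ring.
Qed.

End Racah.

(** * Binomial convolution and sums over magnetic numbers *)

Lemma hockey_stick b c : (\sum_(0 <= k < c.+1) 'C(b + k, b) = 'C(b + c + 1, c))%N.
Proof.
elim: c => [|c IH]; first by rewrite big_nat1 addn0 binn bin0.
have E : 'C(b + c.+1, b) = 'C(b + c.+1, c.+1) by rewrite -bin_sub ?leq_addr // addKn.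
by rewrite big_nat_recr //= IH E !addn1 addnS [RHS]binS addnC.
Qed.

(** The coefficient of $x^c$ in $(1-x)^{-(b+1)}(1-x)^{-(a+1)}=(1-x)^{-(a+b+2)}$, proved by Pascal's
    rule in a double induction. *)
Lemma bin_convolution a b c :
  (\sum_(0 <= k < c.+1) 'C(b + k, b) * 'C(a + (c - k), a) = 'C(a + b + c + 1, c))%N.
Proof.
elim: a c => [|a IHa] c.
  by rewrite add0n -hockey_stick; apply: eq_bigr => k _; rewrite bin0 muln1.
elim: c => [|c IHc]; first by rewrite big_nat1 !addn0 !binn !bin0.
rewrite big_nat_recr //= subnn addn0 binn muln1.
have -> : (\sum_(0 <= k < c.+1) 'C(b + k, b) * 'C(a.+1 + (c.+1 - k), a.+1) =
  \sum_(0 <= k < c.+1) 'C(b + k, b) * 'C(a.+1 + (c - k), a.+1) +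
  \sum_(0 <= k < c.+1) 'C(b + k, b) * 'C(a + (c.+1 - k), a))%N.
  rewrite -big_split /= big_nat [RHS]big_nat; apply: eq_bigr => k /andP[_ kc].
  by rewrite -mulnDr subSn // addnS binS addSn -addnS.
rewrite IHc -addnA.
have := IHa c.+1; rewrite big_nat_recr //= subnn addn0 binn muln1 => ->.
by rewrite !addSn !addnS [RHS]binS addnC.
Qed.

Definition mrange (l : nat) : seq int := [seq (k%:Z - l%:Z) | k <- iota 0 (l.*2.+1)].

Lemma mem_mrange l m : (m \in mrange l) = (`|m| <= l%:Z).
Proof.
apply/mapP/idP => [[k]|ml]; first by rewrite mem_iota => kl ->; lia.
by exists ((absz (m + l%:Z))); [rewrite mem_iota; lia|lia].
Qed.

Lemma mrange_uniq l : uniq (mrange l).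
Proof. by rewrite map_inj_uniq ?iota_uniq // => a b /addIr []. Qed.

Section MagneticSums.
Variable V : zmodType.
Implicit Types (l : nat) (F : int -> V).

Lemma big_mrange l F : \sum_(m <- mrange l) F m = \sum_(0 <= k < l.*2.+1) F (k%:Z - l%:Z).
Proof. by rewrite big_map /index_iota subn0. Qed.

(** The two points where $F$ must vanish are exactly the zeros of the ladder coefficient, which is
    how the hypotheses are met. *)
Lemma msum_shift l F : F (- l%:Z - 1) = 0 -> F l%:Z = 0 ->
  \sum_(m <- mrange l) F m = \sum_(m <- mrange l) F (m - 1).
Proof.
move=> F1 F2; rewrite !big_mrange big_nat_recr //= [RHS]big_nat_recl //=.
have -> : (l.*2)%:Z - l%:Z = l%:Z by lia.
have -> : 0%:Z - l%:Z - 1 = - l%:Z - 1 by lia.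
rewrite F1 F2 addr0 add0r; apply: eq_bigr => k _; congr F; lia.
Qed.

Lemma msum_opp l F : \sum_(m <- mrange l) F (- m) = \sum_(m <- mrange l) F m.
Proof.
rewrite !big_mrange big_nat_rev /= big_nat [RHS]big_nat.
by apply: eq_bigr => k kl; congr F; lia.
Qed.

Lemma msum_single l F m0 : (forall m, m != m0 -> F m = 0) -> (l%:Z < `|m0| -> F m0 = 0) ->
  \sum_(m <- mrange l) F m = F m0.
Proof.
move=> F0 Fout; have [lm|lm] := leP `|m0| l%:Z.
  rewrite (bigD1_seq m0) ?mem_mrange ?mrange_uniq //= big1 ?addr0 //.
rewrite Fout // big_seq big1 // => m; rewrite mem_mrange => ml.
by apply: F0; apply: contraTneq lm => <-; rewrite -leNgt.
Qed.

End MagneticSums.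

(** * Ladder relations and symmetries of the 3j symbols *)

Section Wigner.
Variable R : realType.
Notation w := (@wigner3j R).

Definition triangle (l1 l2 l3 : nat) :=
  [&& (l1 <= l2 + l3)%N, (l2 <= l1 + l3)%N & (l3 <= l1 + l2)%N].

Definition tri_coef (l1 l2 l3 : nat) : R :=
  Num.sqrt (ifact (l1%:Z + l2%:Z - l3%:Z) * ifact (l1%:Z - l2%:Z + l3%:Z) *
    ifact (- l1%:Z + l2%:Z + l3%:Z) / ifact (l1%:Z + l2%:Z + l3%:Z + 1)).

Definition mag_coef (l : nat) (m : int) : R :=
  Num.sqrt (ifact (l%:Z + m) * ifact (l%:Z - m)).

Definition racah3j (l1 l2 l3 : nat) (m1 m2 : int) : R :=
  racah R (l1 + l2 + l3).+1 (l3%:Z - l2%:Z + m1) (l3%:Z - l1%:Z - m2)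
    (l1%:Z + l2%:Z - l3%:Z) (l1%:Z - m1) (l2%:Z + m2).

Lemma ifact_ge0 z : 0 <= ifact z :> R.
Proof. by rewrite /ifact ler0n. Qed.

Lemma wigner3jE l1 l2 l3 m1 m2 m3 : triangle l1 l2 l3 ->
  m1 + m2 + m3 = 0 -> `|m1| <= l1%:Z -> `|m2| <= l2%:Z -> `|m3| <= l3%:Z ->
  w l1 l2 l3 m1 m2 m3 = sgnpow (l1%:Z - l2%:Z - m3) * tri_coef l1 l2 l3 *
    (mag_coef l1 m1 * mag_coef l2 m2 * mag_coef l3 m3) * racah3j l1 l2 l3 m1 m2.
Proof.
move=> /and3P[t1 t2 t3] /eqP m0 h1 h2 h3.
rewrite /wigner3j m0 h1 h2 h3 t1 t2 t3 /=.
rewrite -/(tri_coef l1 l2 l3); congr (_ * _ * _ * _).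
  rewrite /mag_coef -!sqrtrM ?mulr_ge0 ?ifact_ge0 //.
  by congr Num.sqrt; ring.
rewrite big_mkcond /racah3j /racah; apply: eq_bigr => k _.
case: ifPn => [/and5P[c1 c2 c3 c4 c5]|].
  have -> : l3%:Z - l2%:Z + m1 + k%:Z = l3%:Z - l2%:Z + k%:Z + m1 by ring.
  have -> : l3%:Z - l1%:Z - m2 + k%:Z = l3%:Z - l1%:Z + k%:Z - m2 by ring.
  have -> : l1%:Z - m1 - k%:Z = l1%:Z - k%:Z - m1 by ring.
  have -> : l2%:Z + m2 - k%:Z = l2%:Z - k%:Z + m2 by ring.
  by rewrite !rfactE // !invfM !mulrA.
rewrite !negb_and -!ltNge => /or4P[c|c|c|/orP[c|c]].
- by rewrite (@rfact_lt0 _ (l3%:Z - l2%:Z + m1 + k%:Z)) ?(mul0r, mulr0) //; lia.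
- by rewrite (@rfact_lt0 _ (l3%:Z - l1%:Z - m2 + k%:Z)) ?(mul0r, mulr0) //; lia.
- by rewrite (rfact_lt0 _ c) ?(mul0r, mulr0).
- by rewrite (@rfact_lt0 _ (l1%:Z - m1 - k%:Z)) ?(mul0r, mulr0) //; lia.
- by rewrite (@rfact_lt0 _ (l2%:Z + m2 - k%:Z)) ?(mul0r, mulr0) //; lia.
Qed.

Lemma wigner3j_out l1 l2 l3 m1 m2 m3 :
  ~~ [&& m1 + m2 + m3 == 0, `|m1| <= l1%:Z, `|m2| <= l2%:Z & `|m3| <= l3%:Z] ->
  w l1 l2 l3 m1 m2 m3 = 0.
Proof.
move=> h; rewrite /wigner3j ifF //; apply: contraNF h.
by move=> /and4P[-> -> -> /andP[-> _]].
Qed.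

(** The matrix coefficient of the raising operator $J_+$ from $m$ to $m+1$. *)
Definition ladder (l : nat) (m : int) : R := Num.sqrt ((l%:Z - m) * (l%:Z + m + 1))%:~R.

Lemma ladder_top l : ladder l l = 0.
Proof. by rewrite /ladder subrr mul0r sqrtr0. Qed.

Lemma ladder_bot l : ladder l (- l%:Z - 1) = 0.
Proof. by rewrite /ladder (_ : l%:Z + (- l%:Z - 1) + 1 = 0) ?mulr0 ?sqrtr0 //; ring. Qed.

Lemma ladder_opp l m : ladder l (- m) = ladder l (m - 1).
Proof. by rewrite /ladder; congr (Num.sqrt _%:~R); ring. Qed.

Lemma ladder_mag l m : - l%:Z <= m -> m < l%:Z ->
  ladder l m * mag_coef l (m + 1) = (l%:Z + m + 1)%:~R * mag_coef l m.
Proof.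
move=> m1 m2.
have [p pE] : exists p : nat, l%:Z + m = p%:Z by exists (absz (l%:Z + m)); lia.
have [q qE] : exists q : nat, l%:Z - m = q.+1%:Z by exists ((absz (l%:Z - m)).-1); lia.
rewrite /ladder /mag_coef.
have -> : l%:Z + (m + 1) = p.+1%:Z by lia.
have -> : l%:Z - (m + 1) = q%:Z by lia.
rewrite pE qE (_ : p%:Z + 1 = p.+1%:Z); last by lia.
have -> : (p.+1%:Z)%:~R = Num.sqrt ((p.+1%:R) ^+ 2) :> R by rewrite sqrtr_sqr normr_nat.
rewrite -!sqrtrM ?exprn_ge0 ?ler0z //.
congr Num.sqrt; rewrite /ifact /= !factS !natrM rmorphM /=; ring.
Qed.

Section Triple.
Variables l1 l2 l3 : nat.
Hypothesis tri : triangle l1 l2 l3.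
Notation N := (l1 + l2 + l3).+1.

(** Invariance of the 3j tensor under the total raising operator. By [ladder_mag] the square roots
    of the three terms reduce to one common factor [K]; what remains is [racah_ladder]. *)
Lemma wigner_ladder m1 m2 m3 : m1 + m2 + m3 = -1 ->
  `|m1| <= l1%:Z -> `|m2| <= l2%:Z -> `|m3| <= l3%:Z ->
  ladder l1 m1 * w l1 l2 l3 (m1 + 1) m2 m3 + ladder l2 m2 * w l1 l2 l3 m1 (m2 + 1) m3
    + ladder l3 m3 * w l1 l2 l3 m1 m2 (m3 + 1) = 0.
Proof.
move=> ms h1 h2 h3.
pose K := sgnpow (l1%:Z - l2%:Z - m3) * tri_coef l1 l2 l3 *
    (mag_coef l1 m1 * mag_coef l2 m2 * mag_coef l3 m3).
have E1 : ladder l1 m1 * w l1 l2 l3 (m1 + 1) m2 m3 =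
    K * ((l1%:Z + m1 + 1)%:~R * racah3j l1 l2 l3 (m1 + 1) m2).
  (* At the top weight the raised symbol is out of range. Both sides are 0: the left by the ladder
     coefficient, the right because an argument of the Racah sum becomes $-1$. *)
  have [m1l|m1l] := ltP m1 l1%:Z; last first.
    have -> : m1 = l1 by lia.
    by rewrite ladder_top mul0r /racah3j racah_d0 ?mulr0 //; lia.
  rewrite wigner3jE //; try lia.
  have := ladder_mag (ltac:(lia) : - l1%:Z <= m1) m1l => E.
  transitivity (sgnpow (l1%:Z - l2%:Z - m3) * tri_coef l1 l2 l3 *
     ((ladder l1 m1 * mag_coef l1 (m1 + 1)) * mag_coef l2 m2 * mag_coef l3 m3) * racah3j l1 l2 l3 (m1 + 1) m2); first by ring.
  by rewrite E /K; ring.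
have E2 : ladder l2 m2 * w l1 l2 l3 m1 (m2 + 1) m3 =
    K * ((l2%:Z + m2 + 1)%:~R * racah3j l1 l2 l3 m1 (m2 + 1)).
  have [m2l|m2l] := ltP m2 l2%:Z; last first.
    have -> : m2 = l2 by lia.
    by rewrite ladder_top mul0r /racah3j racah_swap_ab racah_swap_cd racah_ad0 ?mulr0 //; lia.
  rewrite wigner3jE //; try lia.
  have := ladder_mag (ltac:(lia) : - l2%:Z <= m2) m2l => E.
  transitivity (sgnpow (l1%:Z - l2%:Z - m3) * tri_coef l1 l2 l3 *
     (mag_coef l1 m1 * (ladder l2 m2 * mag_coef l2 (m2 + 1)) * mag_coef l3 m3) * racah3j l1 l2 l3 m1 (m2 + 1)); first by ring.
  by rewrite E /K; ring.
have E3 : ladder l3 m3 * w l1 l2 l3 m1 m2 (m3 + 1) =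
    - (K * ((l3%:Z + m3 + 1)%:~R * racah3j l1 l2 l3 m1 m2)).
  have [m3l|m3l] := ltP m3 l3%:Z; last first.
    have -> : m3 = l3 by lia.
    by rewrite ladder_top mul0r /racah3j racah_swap_de racah_ad0 ?mulr0 ?oppr0 //; lia.
  rewrite wigner3jE //; try lia.
  have := ladder_mag (ltac:(lia) : - l3%:Z <= m3) m3l => E.
  have sE : sgnpow (l1%:Z - l2%:Z - (m3 + 1)) = - sgnpow (l1%:Z - l2%:Z - m3) :> R.
    have -> : l1%:Z - l2%:Z - (m3 + 1) = (l1%:Z - l2%:Z - m3) + (- 1) by ring.
    by rewrite sgnpowD /sgnpow /= expr1 mulrN1.
  transitivity (sgnpow (l1%:Z - l2%:Z - (m3 + 1)) * tri_coef l1 l2 l3 *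
     (mag_coef l1 m1 * mag_coef l2 m2 * (ladder l3 m3 * mag_coef l3 (m3 + 1))) * racah3j l1 l2 l3 m1 m2); first by ring.
  by rewrite E sE /K; ring.
rewrite E1 E2 E3 -mulrDr -mulrBr.
move/and3P: tri => [t1 t2 t3].
have := @racah_ladder R N (l3%:Z - l2%:Z + m1) (l3%:Z - l1%:Z - m2)
    (l1%:Z + l2%:Z - l3%:Z) (l1%:Z - m1) (l2%:Z + m2) ltac:(lia).
rewrite /racah3j.
have -> : l3%:Z - l2%:Z + (m1 + 1) = l3%:Z - l2%:Z + m1 + 1 by ring.
have -> : l3%:Z - l1%:Z - (m2 + 1) = l3%:Z - l1%:Z - m2 - 1 by ring.
have -> : l1%:Z - (m1 + 1) = l1%:Z - m1 - 1 by ring.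
have -> : l2%:Z + (m2 + 1) = l2%:Z + m2 + 1 by ring.
have -> : l3%:Z - l2%:Z + m1 + (l1%:Z + l2%:Z - l3%:Z) + 1 = l1%:Z + m1 + 1 by ring.
have -> : l1%:Z - m1 + (l3%:Z - l1%:Z - m2) = l3%:Z + m3 + 1 by lia.
by move=> ->; rewrite mulr0.
Qed.

End Triple.

Lemma tri_swap12 l1 l2 l3 : triangle l1 l2 l3 -> triangle l2 l1 l3.
Proof. rewrite /triangle; lia. Qed.
Lemma tri_swap23 l1 l2 l3 : triangle l1 l2 l3 -> triangle l1 l3 l2.
Proof. rewrite /triangle; lia. Qed.

Lemma tri_coef_swap12 l1 l2 l3 : tri_coef l1 l2 l3 = tri_coef l2 l1 l3.
Proof.
rewrite /tri_coef.
have -> : l2%:Z + l1%:Z - l3%:Z = l1%:Z + l2%:Z - l3%:Z by ring.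
have -> : l2%:Z - l1%:Z + l3%:Z = - l1%:Z + l2%:Z + l3%:Z by ring.
have -> : - l2%:Z + l1%:Z + l3%:Z = l1%:Z - l2%:Z + l3%:Z by ring.
have -> : l2%:Z + l1%:Z + l3%:Z + 1 = l1%:Z + l2%:Z + l3%:Z + 1 by ring.
by congr Num.sqrt; ring.
Qed.

Lemma tri_coef_swap23 l1 l2 l3 : tri_coef l1 l2 l3 = tri_coef l1 l3 l2.
Proof.
rewrite /tri_coef.
have -> : l1%:Z + l3%:Z - l2%:Z = l1%:Z - l2%:Z + l3%:Z by ring.
have -> : l1%:Z - l3%:Z + l2%:Z = l1%:Z + l2%:Z - l3%:Z by ring.
have -> : - l1%:Z + l3%:Z + l2%:Z = - l1%:Z + l2%:Z + l3%:Z by ring.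
have -> : l1%:Z + l3%:Z + l2%:Z + 1 = l1%:Z + l2%:Z + l3%:Z + 1 by ring.
by congr Num.sqrt; ring.
Qed.

Section EvenTriple.
Variables l1 l2 l3 : nat.
Hypothesis tri : triangle l1 l2 l3.
Hypothesis even_sum : ~~ odd (l1 + l2 + l3).

(** In general the sign is $(-1)^{l_1+l_2+l_3}$; it is 1 for an even sum. The same holds for the two
    transpositions below. *)
Lemma wigner_opp m1 m2 m3 : w l1 l2 l3 (- m1) (- m2) (- m3) = w l1 l2 l3 m1 m2 m3.
Proof.
have [/and4P[/eqP m0 h1 h2 h3]|out] :=
    boolP [&& m1 + m2 + m3 == 0, `|m1| <= l1%:Z, `|m2| <= l2%:Z & `|m3| <= l3%:Z]; last first.
  rewrite !wigner3j_out // !normrN; apply: contra out; lia.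
rewrite !wigner3jE ?normrN //; try lia.
have mN l m : mag_coef l (- m) = mag_coef l m by rewrite /mag_coef opprK mulrC.
rewrite !mN -!mulrA mulrCA [in RHS]mulrCA; congr (_ * _).
rewrite mulrCA [in RHS]mulrCA; congr (_ * _).
rewrite mulrCA [in RHS]mulrCA; congr (_ * _).
rewrite mulrCA [in RHS]mulrCA; congr (_ * _).
move/and3P: tri => [t1 t2 t3].
have cE : (l1 + l2 - l3)%N%:Z = l1%:Z + l2%:Z - l3%:Z by lia.
rewrite /racah3j -cE [in RHS]racah_rev; last by lia.
rewrite cE mulrA; congr (_ * racah _ _ _ _ _ _ _); try lia.
rewrite -[(-1) ^+ _]/(sgnpow (l1 + l2 - l3)%N%:Z) -sgnpowD; apply: sgnpow_eq; lia.
Qed.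

Lemma wigner_swap12 m1 m2 m3 : w l2 l1 l3 m2 m1 m3 = w l1 l2 l3 m1 m2 m3.
Proof.
have [/and4P[/eqP m0 h1 h2 h3]|out] :=
    boolP [&& m1 + m2 + m3 == 0, `|m1| <= l1%:Z, `|m2| <= l2%:Z & `|m3| <= l3%:Z]; last first.
  rewrite !wigner3j_out //; apply: contra out; lia.
rewrite !wigner3jE //; try lia; last exact: tri_swap12.
rewrite tri_coef_swap12 [mag_coef l2 m2 * mag_coef l1 m1]mulrC.
rewrite -!mulrA mulrCA [in RHS]mulrCA; congr (_ * _).
rewrite mulrCA [in RHS]mulrCA; congr (_ * _).
rewrite mulrCA [in RHS]mulrCA; congr (_ * _).
rewrite mulrCA [in RHS]mulrCA; congr (_ * _).
move/and3P: tri => [t1 t2 t3].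
have cE : (l1 + l2 - l3)%N%:Z = l1%:Z + l2%:Z - l3%:Z by lia.
rewrite /racah3j -cE [in RHS]racah_rev; last by lia.
rewrite cE racah_swap_ab racah_swap_de mulrA.
congr (_ * racah _ _ _ _ _ _ _); try lia.
rewrite -[(-1) ^+ _]/(sgnpow (l1 + l2 - l3)%N%:Z) -sgnpowD; apply: sgnpow_eq; lia.
Qed.

Lemma wigner_swap23 m1 m2 m3 : w l1 l3 l2 m1 m3 m2 = w l1 l2 l3 m1 m2 m3.
Proof.
have [/and4P[/eqP m0 h1 h2 h3]|out] :=
    boolP [&& m1 + m2 + m3 == 0, `|m1| <= l1%:Z, `|m2| <= l2%:Z & `|m3| <= l3%:Z]; last first.
  rewrite !wigner3j_out //; apply: contra out; lia.
rewrite !wigner3jE //; try lia; last exact: tri_swap23.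
rewrite tri_coef_swap23 -[mag_coef l1 m1 * mag_coef l3 m3 * _]mulrA [mag_coef l3 m3 * _]mulrC.
rewrite -!mulrA mulrCA [in RHS]mulrCA; congr (_ * _).
rewrite mulrCA [in RHS]mulrCA; congr (_ * _).
rewrite mulrCA [in RHS]mulrCA; congr (_ * _).
rewrite mulrCA [in RHS]mulrCA; congr (_ * _).
move/and3P: tri => [t1 t2 t3].
(* For this transposition the sum is reversed about [l1 - m1] instead of [l1 + l2 - l3], so that
   argument is first moved into third place. *)
have aE : (absz (l1%:Z - m1))%:Z = l1%:Z - m1 by lia.
rewrite /racah3j -aE [in RHS]racah_swap_cd [in RHS]racah_rev; last by lia.
rewrite aE racah_swap_cd mulrA.
have -> : (l1 + l3 + l2 = l1 + l2 + l3)%N by lia.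
congr (_ * racah _ _ _ _ _ _ _); try lia.
rewrite -[(-1) ^+ _]/(sgnpow (absz (l1%:Z - m1))%:Z) -sgnpowD; apply: sgnpow_eq; lia.
Qed.

End EvenTriple.
End Wigner.

(** * Orthogonality and vanishing traces *)

Section Orthogonality.
Variable R : realType.
Notation w := (@wigner3j R).
Notation ladder := (@ladder R).

Section Column.
Variables l1 l2 l3 : nat.
Hypothesis tri : triangle l1 l2 l3.
Hypothesis even_sum : ~~ odd (l1 + l2 + l3).
Notation w3 := (w l1 l2 l3).

Definition colnorm (m3 : int) : R :=
  \sum_(m1 <- mrange l1) \sum_(m2 <- mrange l2) w3 m1 m2 m3 ^+ 2.

Lemma wigner3j_neq0_sum m1 m2 m3 : m1 + m2 + m3 != 0 -> w3 m1 m2 m3 = 0.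
Proof. by move=> /negPf h; rewrite wigner3j_out // h. Qed.

(* Pairing the raising relation with [w(.,.,m3+1)] and the lowering relation
   with [w(.,.,m3)] produces the same cross terms. *)
Lemma colnorm_step m3 : - l3%:Z <= m3 -> m3 < l3%:Z -> colnorm m3 = colnorm (m3 + 1).
Proof.
move=> ml mu.
pose G m1 := \sum_(m2 <- mrange l2) ladder l1 m1 * w3 (m1 + 1) m2 m3 * w3 m1 m2 (m3 + 1).
pose H m2 := \sum_(m1 <- mrange l1) ladder l2 m2 * w3 m1 (m2 + 1) m3 * w3 m1 m2 (m3 + 1).
have Lpos : 0 < ladder l3 m3.
  by rewrite /ladder sqrtr_gt0 ltr0z; apply: mulr_gt0; lia.
suff [E1 E2] : ladder l3 m3 * colnorm (m3 + 1) = - (\sum_(m1 <- mrange l1) G m1 + \sum_(m2 <- mrange l2) H m2)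
   /\ ladder l3 m3 * colnorm m3 = - (\sum_(m1 <- mrange l1) G m1 + \sum_(m2 <- mrange l2) H m2).
  by apply: (mulfI (lt0r_neq0 Lpos)); rewrite E1 E2.
split.
  rewrite /H [\sum_(m2 <- mrange l2) \sum_(m1 <- _) _]exchange_big /= -big_split -sumrN /colnorm mulr_sumr; apply: eq_big_seq => m1 h1 /=.
  rewrite -big_split -sumrN mulr_sumr; apply: eq_big_seq => m2 h2 /=.
  rewrite !mem_mrange in h1 h2.
  have [/eqP e|ne] := boolP (m1 + m2 + m3 == -1); last first.
    by rewrite (@wigner3j_neq0_sum m1 m2 (m3 + 1)) ?expr0n ?mulr0 ?addr0 ?oppr0 //; lia.
  have := wigner_ladder R tri e h1 h2 ltac:(lia).
  move=> h; apply/eqP; rewrite -addr_eq0; apply/eqP.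
  rewrite -[RHS](mul0r (w3 m1 m2 (m3 + 1))) -h; ring.
have GS : \sum_(m1 <- mrange l1) G m1 = \sum_(m1 <- mrange l1) G (m1 - 1).
  apply: msum_shift; rewrite /G big1 // => m _; first by rewrite ladder_bot !mul0r.
  by rewrite ladder_top !mul0r.
have HS : \sum_(m2 <- mrange l2) H m2 = \sum_(m2 <- mrange l2) H (m2 - 1).
  apply: msum_shift; rewrite /H big1 // => m _; first by rewrite ladder_bot !mul0r.
  by rewrite ladder_top !mul0r.
rewrite GS HS /H [\sum_(m2 <- mrange l2) \sum_(m1 <- _) _]exchange_big /= -big_split -sumrN /colnorm mulr_sumr; apply: eq_big_seq => m1 h1 /=.
rewrite -big_split -sumrN mulr_sumr; apply: eq_big_seq => m2 h2 /=.
rewrite !mem_mrange in h1 h2; rewrite !subrK.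
have [/eqP e|ne] := boolP (m1 + m2 + m3 == 0); last first.
  by rewrite (@wigner3j_neq0_sum m1 m2 m3) ?expr0n ?(mulr0, mul0r) ?addr0 ?oppr0 //; lia.
have e' : - m1 + - m2 + (- m3 - 1) = -1 by lia.
have := wigner_ladder R tri e' ltac:(lia) ltac:(lia) ltac:(lia).
rewrite !ladder_opp.
have -> : - m1 + 1 = - (m1 - 1) by ring.
have -> : - m2 + 1 = - (m2 - 1) by ring.
have E3 : - m3 - 1 = - (m3 + 1) by ring.
rewrite E3.
have -> : - (m3 + 1) + 1 = - m3 by ring.
rewrite !wigner_opp // ladder_opp addrK => h.
apply/eqP; rewrite -addr_eq0; apply/eqP.
rewrite -[RHS](mul0r (w3 m1 m2 m3)) -h; ring.
Qed.

Lemma colnorm_const m3 : `|m3| <= l3%:Z -> colnorm m3 = colnorm l3.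
Proof.
move=> h; have [n nE] : exists n : nat, l3%:Z - m3 = n%:Z by exists (absz (l3%:Z - m3)); lia.
elim: n m3 h nE => [|n IH] m3 h nE; first by congr colnorm; lia.
by rewrite colnorm_step; [apply: IH; lia|lia|lia].
Qed.

Lemma binE (n k : nat) : 'C(n + k, n)%:R = (n + k)`!%:R / (n`!%:R * k`!%:R) :> R.
Proof.
rewrite -(bin_fact (leq_addr k n)) addKn !natrM mulfK //.
Qed.

(** With $m_3=l_3$ and $k=m_2+l_2$ the first Racah argument is $-k$, so [racah_single] applies. The
    range of $m_1$ is what imposes $k\le c$. *)
Lemma wigner_top_sqr (a b c k : nat) : (l1 + l2 = l3 + c)%N -> (l2 + l3 = l1 + a)%N ->
  (l1 + l3 = l2 + b)%N -> (k <= c)%N ->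
  w3 (- l3%:Z - (k%:Z - l2%:Z)) (k%:Z - l2%:Z) l3 ^+ 2 =
  c`!%:R * (l3.*2)`!%:R / (l1 + l2 + l3).+1`!%:R * ('C(b + k, b) * 'C(a + (c - k), a))%:R.
Proof.
move=> cE aE bE kc.
rewrite wigner3jE //; try lia.
rewrite /racah3j.
have -> : l3%:Z - l2%:Z + (- l3%:Z - (k%:Z - l2%:Z)) = - k%:Z by lia.
have -> : l2%:Z + (k%:Z - l2%:Z) = k%:Z by lia.
rewrite racah_single; last by lia.
have -> : l3%:Z - l1%:Z - (k%:Z - l2%:Z) + k%:Z = a%:Z by lia.
have -> : l1%:Z + l2%:Z - l3%:Z - k%:Z = (c - k)%N%:Z by lia.
have -> : l1%:Z - (- l3%:Z - (k%:Z - l2%:Z)) - k%:Z = b%:Z by lia.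
rewrite !exprMn !sqr_sqrtr ?mulr_ge0 ?invr_ge0 ?ifact_ge0 //.
have -> : sgnpow (l1%:Z - l2%:Z - l3%:Z) ^+ 2 = 1 :> R by rewrite expr2 sgnpow_sqr.
have -> : ((-1) ^+ k) ^+ 2 = 1 :> R by rewrite -exprM mulnC exprM sqrrN expr1n expr1n.
have -> : l1%:Z + l2%:Z - l3%:Z = c%:Z by lia.
have -> : l1%:Z - l2%:Z + l3%:Z = b%:Z by lia.
have -> : - l1%:Z + l2%:Z + l3%:Z = a%:Z by lia.
have -> : l1%:Z + l2%:Z + l3%:Z + 1 = (l1 + l2 + l3).+1%:Z by lia.
have -> : l1%:Z + (- l3%:Z - (k%:Z - l2%:Z)) = (c - k)%N%:Z by lia.
have -> : l1%:Z - (- l3%:Z - (k%:Z - l2%:Z)) = (b + k)%N%:Z by lia.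
have -> : l2%:Z + (k%:Z - l2%:Z) = k%:Z by lia.
have -> : l2%:Z - (k%:Z - l2%:Z) = (a + (c - k))%N%:Z by lia.
have -> : l3%:Z + l3%:Z = l3.*2%:Z by lia.
rewrite subrr /rfact /ifact /= fact0 natrM !binE.
have f n : n`!%:R != 0 :> R by rewrite pnatr_eq0 -lt0n fact_gt0.
have := f k; have := f a; have := f b; have := f (c - k)%N; have := f (l1 + l2 + l3).+1.
move: (k`!%:R) (a`!%:R) (b`!%:R) ((c - k)`!%:R) ((l1 + l2 + l3).+1`!%:R)
  (c`!%:R) ((b + k)`!%:R) ((a + (c - k))`!%:R) (l3.*2`!%:R) => fk fa fb fck fL fc fbk fac f2.
move=> *; field; do !(apply/andP; split => //).
Qed.

(** Summing over $k\le c$ by [bin_convolution] gives a binomial coefficient whose factorials cancel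
    up to $(2l_3)!/(2l_3+1)!$. *)
Lemma colnorm_top : colnorm l3 = (l3.*2.+1%:R)^-1.
Proof.
move/and3P: tri => [t1 t2 t3].
have [c cE] : exists c, (l1 + l2 = l3 + c)%N by exists (l1 + l2 - l3)%N; lia.
have [a aE] : exists a, (l2 + l3 = l1 + a)%N by exists (l2 + l3 - l1)%N; lia.
have [b bE] : exists b, (l1 + l3 = l2 + b)%N by exists (l1 + l3 - l2)%N; lia.
rewrite /colnorm exchange_big /=.
under eq_bigr => m2 _.
  rewrite (@msum_single _ _ _ (- l3%:Z - m2)); last 2 first.
  - by move=> m ne; rewrite wigner3j_neq0_sum ?expr0n //; apply: contra ne => /eqP e; apply/eqP; lia.
  - by move=> h; rewrite wigner3j_out ?expr0n //; lia.
  over.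
rewrite big_mrange (big_cat_nat _ (n := c.+1)) //=; last by lia.
rewrite [X in _ + X]big_nat [X in _ + X]big1 ?addr0; last first.
  by move=> k hk; rewrite wigner3j_out ?expr0n //; lia.
rewrite big_nat.
under eq_bigr => k kc do rewrite (wigner_top_sqr cE aE bE) //.
rewrite -mulr_sumr -big_nat -natr_sum bin_convolution.
have LE : ((l1 + l2 + l3).+1 = l3.*2.+1 + c)%N by lia.
have -> : (a + b + c + 1 = l3.*2.+1 + c)%N by lia.
have := binE c l3.*2.+1; rewrite addnC => ->.
rewrite LE factS natrM.
have f n : n`!%:R != 0 :> R by rewrite pnatr_eq0 -lt0n fact_gt0.
have := f c; have := f l3.*2; have := f (l3.*2.+1 + c)%N.
have : l3.*2.+1%:R != 0 :> R by rewrite pnatr_eq0.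
move: (c`!%:R) (l3.*2`!%:R) ((l3.*2.+1 + c)`!%:R) (l3.*2.+1%:R) => fc f2 fL f1.
by move=> *; field; do !(apply/andP; split => //).
Qed.

Lemma wigner_orth3 m3 m3' : `|m3| <= l3%:Z ->
  \sum_(m1 <- mrange l1) \sum_(m2 <- mrange l2) w3 m1 m2 m3 * w3 m1 m2 m3' =
  (m3 == m3')%:R / l3.*2.+1%:R.
Proof.
move=> h; have [<-|ne] := eqVneq m3 m3'.
  by rewrite mul1r -colnorm_top -(colnorm_const h).
rewrite mul0r big1 // => m1 _; rewrite big1 // => m2 _.
have [/eqP e|e] := boolP (m1 + m2 + m3 == 0); last by rewrite (wigner3j_neq0_sum e) mul0r.
rewrite (@wigner3j_neq0_sum m1 m2 m3') ?mulr0 //; apply: contra ne => /eqP e'.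
by apply/eqP; lia.
Qed.

End Column.

Lemma wigner_orth1 l1 l2 l3 m1 m1' : triangle l1 l2 l3 -> ~~ odd (l1 + l2 + l3) ->
  `|m1| <= l1%:Z ->
  \sum_(m2 <- mrange l2) \sum_(m3 <- mrange l3) w l1 l2 l3 m1 m2 m3 * w l1 l2 l3 m1' m2 m3 =
  (m1 == m1')%:R / l1.*2.+1%:R.
Proof.
move=> tri ev h.
have tri' := tri_swap12 tri; have tri'' := tri_swap23 tri'.
have ev' : ~~ odd (l2 + l1 + l3) by lia.
have ev'' : ~~ odd (l2 + l3 + l1) by lia.
rewrite -(wigner_orth3 tri'' ev'' m1' h).
apply: eq_bigr => m2 _; apply: eq_bigr => m3 _.
by rewrite (wigner_swap23 R tri' ev') (wigner_swap23 R tri' ev') !(wigner_swap12 R tri ev).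
Qed.

(** $(-1)^m$ paired with $m,-m$ is the rotation-invariant contraction of two copies of degree $l$;
    it leaves an invariant of degree $L$, hence 0 for $L>0$. *)
Lemma wigner_trace l L : triangle l l L -> (0 < L)%N ->
  \sum_(m <- mrange l) sgnpow m * w l l L m (- m) 0 = 0.
Proof.
move=> tri L0.
(* Raising the third entry from $-1$ to 0 writes each summand, times a positive ladder coefficient,
   as a difference of consecutive values of [H]. *)
pose H m := sgnpow m * ladder l m * w l l L (m + 1) (- m) (-1).
have Lpos : 0 < ladder L (-1) by rewrite /ladder sqrtr_gt0 ltr0z; apply: mulr_gt0; lia.
apply: (mulfI (lt0r_neq0 Lpos)); rewrite mulr0 mulr_sumr.
transitivity (\sum_(m <- mrange l) (- H m + H (m - 1))).
  apply: eq_big_seq => m; rewrite mem_mrange => h.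
  have := wigner_ladder R tri (ltac:(lia) : m + - m + -1 = -1) h ltac:(lia) ltac:(lia).
  rewrite ladder_opp /H subrK addNr sgnpowD (_ : - (m - 1) = - m + 1); last by ring.
  have -> : sgnpow (-1) = -1 :> R by rewrite /sgnpow /= expr1.
  move=> e; apply/eqP; rewrite -subr_eq0; apply/eqP.
  by rewrite -[RHS](mulr0 (sgnpow m)) -e; ring.
rewrite big_split /= sumrN -msum_shift ?addNr //.
  by rewrite /H ladder_bot mulr0 mul0r.
by rewrite /H ladder_top mulr0 mul0r.
Qed.

End Orthogonality.

(** * Independence and normal moments *)

Section Density.
Local Open Scope classical_set_scope.
Local Open Scope ereal_scope.
Context d1 d2 (X : measurableType d1) (Y : measurableType d2) (R : realType).
Variables (mu : {measure set X -> \bar R}) (nu : {measure set Y -> \bar R}).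
Variables (phi : X -> Y) (G : X -> R) (c : R).
Hypothesis mphi : measurable_fun setT phi.
Hypothesis mG : measurable_fun setT G.
Hypothesis G0 : forall x, (0 <= G x)%R.
Hypothesis c0 : (0 <= c)%R.
Hypothesis muG : forall B, measurable B ->
  \int[mu]_x ((\1_B (phi x) * G x)%R)%:E = c%:E * nu B.

Import HBNNSimple.

(** [muG] says that the image of $G\,\mu$ under [phi] is $c\,\nu$ on sets; simple functions and
    monotone convergence extend this. It serves both to peel off one independent variable and to
    integrate against the normal density. *)
Lemma ge0_integral_density (f : Y -> R) : measurable_fun setT f -> (forall y, (0 <= f y)%R) ->
  \int[mu]_x ((f (phi x) * G x)%R)%:E = c%:E * \int[nu]_y (f y)%:E.
Proof.
move=> mf f0.
have mfE : measurable_fun setT (EFin \o f) by exact/measurable_EFinP.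
pose f_ := nnsfun_approx measurableT mfE.
have f_cvg y : (f_ n y)%:E @[n --> \oo] --> (f y)%:E.
  by apply: cvg_nnsfun_approx => // z _; rewrite lee_fin.
have mf_ n : measurable_fun setT (f_ n) by exact: measurable_funP.
transitivity (limn (fun n => \int[mu]_x ((f_ n (phi x) * G x)%R)%:E)).
  rewrite -monotone_convergence//.
  - apply: eq_integral => x _; apply/esym/cvg_lim => //.
    have -> : (fun n => ((f_ n (phi x) * G x)%R)%:E) = (fun n => (f_ n (phi x))%:E * (G x)%:E).
      by apply/funext => n; rewrite EFinM.
    by rewrite EFinM; apply: cvgeZr.
  - by move=> n; apply/measurable_EFinP/measurable_funM => //; exact: measurableT_comp.
  - by move=> n x _; rewrite lee_fin mulr_ge0.
  - move=> x _ m n mn; rewrite lee_fin ler_wpM2r //.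
    exact/lefP/nd_nnsfun_approx.
rewrite -ge0_integralZl_EFin//; last by move=> y _; rewrite lee_fin.
transitivity (limn (fun n => \int[nu]_y (c%:E * (f_ n y)%:E))); last first.
  rewrite -monotone_convergence//.
  - by apply: eq_integral => x _; apply/cvg_lim => //; apply: cvgeZl.
  - by move=> n; apply/measurable_EFinP/measurable_funM.
  - by move=> n x _; rewrite lee_fin mulr_ge0.
  - move=> x _ m n mn; rewrite lee_fin ler_wpM2l //.
    exact/lefP/nd_nnsfun_approx.
congr (limn _); apply/funext => n.
rewrite ge0_integralZl_EFin//; last 2 first.
  by move=> y _; rewrite lee_fin.
  exact/measurable_EFinP.
have mfr r : measurable (f_ n @^-1` [set r]) by [].
have term0 (r : R) x : (0 <= r * \1_(f_ n @^-1` [set r]) (phi x) * G x)%R.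
  by rewrite mulr_ge0 // -lee_fin nnfun_muleindic_ge0.
transitivity (\int[mu]_x \sum_(k \in range (f_ n))
    (k * \1_(f_ n @^-1` [set k]) (phi x) * G x)%:E).
  by apply: eq_integral => x _; rewrite fimfunE mulr_fsuml fsumEFin.
rewrite ge0_integral_fsum//; last 2 first.
- move=> r; apply/measurable_EFinP/measurable_funM => //; apply: measurable_funM => //.
  exact: measurableT_comp.
- by move=> r x _; rewrite lee_fin.
rewrite integralT_nnsfun sintegralE ge0_mule_fsumr; last exact: nnsfun_mulemu_ge0.
apply: eq_fsbigr => r; rewrite inE => -[y _ yr].
have r0 : (0 <= r)%R by rewrite -yr.
under eq_integral => x _ do rewrite -mulrA EFinM.
rewrite ge0_integralZl_EFin//; last 2 first.
- by move=> x _; rewrite lee_fin mulr_ge0.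
- by apply/measurable_EFinP/measurable_funM => //; exact: measurableT_comp.
by rewrite muG // muleCA.
Qed.

Lemma integral_density (f : Y -> R) : nu.-integrable setT (EFin \o f) ->
  \int[mu]_x ((f (phi x) * G x)%R)%:E = c%:E * \int[nu]_y (f y)%:E.
Proof.
move=> fi; have mf : measurable_fun setT f by apply/measurable_EFinP; exact: measurable_int fi.
pose g x := Num.max (f x) 0%R; pose h x := Num.max (- f x)%R 0%R.
have fgh x : f x = (g x - h x)%R.
  by rewrite /g /h; case: ltrP => ?; case: ltrP => ?; lra.
have gE : EFin \o g = (EFin \o f)^\+ by apply/funext => x; rewrite /g funeposE /= EFin_max.
have hE : EFin \o h = (EFin \o f)^\- by apply/funext => x; rewrite /h funenegE /= EFin_max EFinN.
have gi : nu.-integrable setT (EFin \o g) by rewrite gE; exact: (integrable_funepos measurableT fi).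
have hi : nu.-integrable setT (EFin \o h) by rewrite hE; exact: (integrable_funeneg measurableT fi).
have part u : nu.-integrable setT (EFin \o u) -> (forall y, (0 <= u y)%R) ->
    mu.-integrable setT (fun x => ((u (phi x) * G x)%R)%:E) /\
    \int[mu]_x ((u (phi x) * G x)%R)%:E = c%:E * \int[nu]_y (u y)%:E.
  move=> ui u0; have mu_ : measurable_fun setT u by apply/measurable_EFinP; exact: measurable_int ui.
  have E := ge0_integral_density mu_ u0; split => //.
  apply/integrableP; split.
    by apply/measurable_EFinP/measurable_funM => //; exact: measurableT_comp.
  under eq_integral => x _ do rewrite /= ger0_norm ?mulr_ge0 //.
  rewrite E -ge0_fin_numE; last first.
    by rewrite mule_ge0 ?lee_fin //; apply: integral_ge0 => y _; rewrite lee_fin.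
  by rewrite fin_numM //; exact: integrable_fin_num ui.
have [ig Eg] := part g gi (fun y => ltac:(by rewrite /g le_max lexx orbT)).
have [ih Eh] := part h hi (fun y => ltac:(by rewrite /h le_max lexx orbT)).
transitivity (\int[mu]_x (((g (phi x) * G x)%R)%:E - ((h (phi x) * G x)%R)%:E)).
  by apply: eq_integral => x _; rewrite -EFinB -mulrBl -fgh.
rewrite integralB // Eg Eh -muleBr //; last exact: fin_num_adde_defr (integrable_fin_num measurableT gi).
congr (_ * _); rewrite -integralB //.
by apply: eq_integral => x _ /=; rewrite fgh EFinB.
Qed.

End Density.

Section IndependentProducts.
Local Open Scope classical_set_scope.
Local Open Scope ereal_scope.
Context d (T : measurableType d) (R : realType) (P : probability T R).
Context (I : choiceType) (S : set I) (Y : I -> T -> R) (nu : I -> probability (measurableTypeR R) R).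
Hypothesis indep : mutually_independent P S Y.
Hypothesis mY : forall i, S i -> measurable_fun setT (Y i).
Hypothesis lawY : forall i B, S i -> measurable B -> P (Y i @^-1` B) = nu i B.

(** Independence is given on events. Keeping some factors as indicators ([J2]) lets induction on
    [J1] replace one indicator at a time by a function. *)
Lemma ge0_indep_expectation (f : I -> R -> R) (m : I -> R) (B : I -> set R) (J1 J2 : seq I) :
  (forall i, measurable_fun setT (f i)) -> (forall i x, (0 <= f i x)%R) ->
  (forall i, \int[nu i]_x (f i x)%:E = (m i)%:E) -> (forall i, measurable (B i)) ->
  uniq (J1 ++ J2) -> (forall i, i \in J1 ++ J2 -> S i) ->
  \int[P]_w ((\prod_(i <- J1) f i (Y i w) * \prod_(i <- J2) \1_(B i) (Y i w))%R)%:E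
  = (\prod_(i <- J1) m i)%:E * \prod_(i <- J2) nu i (B i).
Proof.
move=> mf f0 fm; elim: J1 J2 B => [|i J1 IH] J2 B mB.
  move=> /= uJ SJ; rewrite big_nil mul1e.
  transitivity (\int[P]_w (\1_(\bigcap_(i in [set i | i \in J2]) (Y i @^-1` B i)) w)%:E).
    apply: eq_integral => w _; rewrite big_nil mul1r; congr EFin.
    rewrite indicE; case: (boolP (w \in _)) => [|] /=.
      rewrite inE => h; apply: big1_seq => i /andP[_ iJ].
      by rewrite indicE mem_set //; apply: h.
    move=> h; apply/eqP; rewrite prodf_seq_eq0; apply: contraNT h => /hasPn h.
    rewrite inE => i iJ /=; have := h i iJ; rewrite indicE pnatr_eq0 eqb0 negbK.
    by rewrite inE.
  rewrite integral_indic ?setIT //; last first.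
    rewrite bigcap_seq big_seq.
    apply: (big_ind (fun A => measurable A)) => //; first by move=> A A'; apply: measurableI.
    by move=> i iJ; rewrite -[_ @^-1` _]setTI; apply: mY => //; apply: SJ.
  transitivity (\prod_(j <- J2) P (Y j @^-1` B j)).
    exact: (indep SJ uJ (fun j _ => mB j)).
  by rewrite big_seq [RHS]big_seq; apply: eq_bigr => i iJ; rewrite lawY //; apply: SJ.
move=> uJ SJ.
have iS : S i by apply: SJ; rewrite mem_head.
move: (uJ); rewrite /= mem_cat negb_or => /andP[/andP[iJ1 iJ2] uJ'].
have m0 j : (0 <= m j)%R.
  by rewrite -lee_fin -fm; apply: integral_ge0 => x _; rewrite lee_fin.
have nuE j A : measurable A -> nu j A = (fine (nu j A))%:E.
  by move=> mA; rewrite fineK // fin_num_measure.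
pose c : R := (\prod_(j <- J1) m j * \prod_(j <- J2) fine (nu j (B j)))%R.
have cE : c%:E = (\prod_(j <- J1) m j)%:E * \prod_(j <- J2) nu j (B j).
  by rewrite EFinM -[X in _ * X]prodEFin; congr (_ * _); apply: eq_bigr => j _; rewrite -nuE //; exact: mB.
pose G w : R := (\prod_(j <- J1) f j (Y j w) * \prod_(j <- J2) \1_(B j) (Y j w))%R.
have mprod (g : I -> R -> R) (J : seq I) : (forall j, measurable_fun setT (g j)) ->
    (forall j, j \in J -> S j) -> measurable_fun setT (fun w => \prod_(j <- J) g j (Y j w))%R.
  move=> mg SJ'; rewrite (_ : (fun w => _) = (fun w => \prod_(j <- J | j \in J) g j (Y j w))%R); last first.
    by apply/funext => w; rewrite big_seq.
  elim: {1}J => [|j J' IHJ]; first by under eq_fun do rewrite big_nil; exact: measurable_cst.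
  under eq_fun do rewrite big_cons.
  case jJ: (j \in J) => //; apply: measurable_funM => //.
  by apply: measurableT_comp => //; apply: mY; apply: SJ'.
have SJ1 j : j \in J1 -> S j by move=> h; apply: SJ; rewrite inE mem_cat h orbT.
have SJ2 j : j \in J2 -> S j by move=> h; apply: SJ; rewrite inE mem_cat h !orbT.
have main : \int[P]_w ((f i (Y i w) * G w)%R)%:E = c%:E * (m i)%:E; last first.
  rewrite big_cons EFinM -muleA [RHS]muleC -cE -main.
  by apply: eq_integral => w _; congr EFin; rewrite big_cons /G mulrA.
rewrite -fm; apply: (@ge0_integral_density _ _ T (measurableTypeR R) R P (nu i)) => //.
- exact: mY.
- apply: measurable_funM; first exact: mprod.
  by apply: (mprod (fun j => \1_(B j))).
- by move=> w; rewrite mulr_ge0 // prodr_ge0.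
- by rewrite mulr_ge0 // prodr_ge0 // => j _; apply: fine_ge0.
- move=> A mA; rewrite cE muleC.
  (* The hypothesis of the density lemma is tested on a set [A]: the induction hypothesis applies
     with [i] moved among the indicators, carrying [A]. *)
  pose B' j := if j == i then A else B j.
  have EB (F : I -> set R -> R) : (\prod_(j <- J2) F j (B' j) = \prod_(j <- J2) F j (B j))%R.
    rewrite big_seq [RHS]big_seq; apply: eq_bigr => j jJ.
    by rewrite /B' ifN //; apply: contraNneq iJ2 => <-.
  have EB' : \prod_(j <- J2) nu j (B' j) = \prod_(j <- J2) nu j (B j).
    rewrite big_seq [RHS]big_seq; apply: eq_bigr => j jJ.
    by rewrite /B' ifN //; apply: contraNneq iJ2 => <-.
  have Bi : B' i = A by rewrite /B' eqxx.
  have := IH (i :: J2) B' _ _ _.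
  rewrite big_cons EB' Bi muleCA => <-.
  + apply: eq_integral => w _; congr EFin; rewrite /G.
    by rewrite [in RHS]big_cons (EB (fun j C => \1_C (Y j w))) Bi; ring.
  + by move=> j; rewrite /B'; case: ifP.
  + by rewrite uniq_catC /= mem_cat negb_or iJ1 iJ2 uniq_catC.
  + move=> j; rewrite mem_cat inE => h; apply: SJ; rewrite inE mem_cat.
    by move: h => /or3P[->|->|->]; rewrite ?orbT.
- exact: mf.
Qed.

(** The same scheme for signed factors: those in [J1] are signed, those in [J2] nonnegative, and
    each step splits one factor into positive and negative parts. *)
Lemma indep_expectation_aux (f : I -> R -> R) (m : I -> R) (k : I -> R -> R) (n : I -> R)
    (J1 J2 : seq I) :
  (forall i, (nu i).-integrable setT (EFin \o f i)) ->
  (forall i, \int[nu i]_x (f i x)%:E = (m i)%:E) ->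
  (forall i, measurable_fun setT (k i)) -> (forall i x, (0 <= k i x)%R) ->
  (forall i, \int[nu i]_x (k i x)%:E = (n i)%:E) ->
  uniq (J1 ++ J2) -> (forall i, i \in J1 ++ J2 -> S i) ->
  let F w := (\prod_(i <- J1) f i (Y i w) * \prod_(i <- J2) k i (Y i w))%R in
  P.-integrable setT (EFin \o F) /\
  \int[P]_w (F w)%:E = (\prod_(i <- J1) m i * \prod_(i <- J2) n i)%:E.
Proof.
move=> fi fm; elim: J1 J2 k n => [|i J1 IH] J2 k n mk k0 kn uJ SJ F.
  have E : \int[P]_w (F w)%:E = (\prod_(i <- J2) n i)%:E.
    have := @ge0_indep_expectation k n (fun=> setT) J2 [::] mk k0 kn (fun=> measurableT).
    rewrite cats0 big_nil mule1 => <- //.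
    by apply: eq_integral => w _; rewrite /F !big_nil mul1r mulr1.
  rewrite E big_nil mul1r; split => //; apply/integrableP; split.
    apply/measurable_EFinP; rewrite /F.
    have mprod (J : seq I) : (forall j, j \in J -> S j) ->
        measurable_fun setT (fun w => \prod_(j <- J) k j (Y j w))%R.
      elim: J => [|j J IHJ] SJ'; first by under eq_fun do rewrite big_nil; exact: measurable_cst.
      under eq_fun do rewrite big_cons; apply: measurable_funM.
        by apply: measurableT_comp => //; apply: mY; apply: SJ'; rewrite mem_head.
      by apply: IHJ => l lJ; apply: SJ'; rewrite inE lJ orbT.
    by under eq_fun do rewrite big_nil mul1r; exact: mprod.
  under eq_integral => w _.
    rewrite /= ger0_norm; last by rewrite /F big_nil mul1r prodr_ge0.
    over.
  by rewrite E ltry.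
pose g x := Num.max (f i x) 0%R; pose h x := Num.max (- f i x)%R 0%R.
have fgh x : f i x = (g x - h x)%R.
  by rewrite /g /h; case: ltrP => ?; case: ltrP => ?; lra.
have gE : EFin \o g = (EFin \o f i)^\+ by apply/funext => x; rewrite /g funeposE /= EFin_max.
have hE : EFin \o h = (EFin \o f i)^\- by apply/funext => x; rewrite /h funenegE /= EFin_max EFinN.
have gi : (nu i).-integrable setT (EFin \o g) by rewrite gE; exact: (integrable_funepos measurableT (fi i)).
have hi : (nu i).-integrable setT (EFin \o h) by rewrite hE; exact: (integrable_funeneg measurableT (fi i)).
have gf := integrable_fin_num measurableT gi; have hf := integrable_fin_num measurableT hi.
pose mg := fine (\int[nu i]_x (g x)%:E); pose mh := fine (\int[nu i]_x (h x)%:E).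
have mE : m i = (mg - mh)%R.
  apply: EFin_inj; rewrite -fm integralE EFinB /mg /mh.
  rewrite (fineK gf) (fineK hf); congr (_ - _); apply: eq_integral => x _.
    by rewrite -[RHS]/((EFin \o g) x) gE.
  by rewrite -[RHS]/((EFin \o h) x) hE.
pose upd A (a : A) (b : I -> A) j := if j == i then a else b j.
move: (uJ); rewrite /= mem_cat negb_or => /andP[/andP[iJ1 iJ2] uJ'].
have updE A (a : A) b (G : I -> A -> R) :
    (\prod_(j <- i :: J2) G j (upd A a b j) = G i a * \prod_(j <- J2) G j (b j))%R.
  rewrite big_cons /upd eqxx; congr (_ * _)%R; rewrite big_seq [RHS]big_seq.
  by apply: eq_bigr => j jJ; rewrite ifN //; apply: contraNneq iJ2 => <-.
have main (u : R -> R) (mu : R) : measurable_fun setT u -> (forall x, (0 <= u x)%R) ->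
    \int[nu i]_x (u x)%:E = mu%:E ->
    let F' w := (\prod_(j <- J1) f j (Y j w) * (u (Y i w) * \prod_(j <- J2) k j (Y j w)))%R in
    P.-integrable setT (EFin \o F') /\
    \int[P]_w (F' w)%:E = (\prod_(j <- J1) m j * (mu * \prod_(j <- J2) n j))%:E.
  move=> mu_ u0 um F'.
  have := IH (i :: J2) (upd _ u k) (upd _ mu n) _ _ _ _ _.
  rewrite (updE _ _ _ (fun _ x => x)).
  rewrite (_ : (fun w => (\prod_(j <- J1) f j (Y j w) * \prod_(j <- i :: J2) upd _ u k j (Y j w))%R) = F'); last first.
    by apply/funext => w; rewrite (updE _ _ _ (fun j v => v (Y j w))).
  apply.
  - by move=> j; rewrite /upd; case: ifP.
  - by move=> j x; rewrite /upd; case: ifP.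
  - by move=> j; rewrite /upd; case: eqP => // ->.
  - by rewrite uniq_catC /= mem_cat negb_or iJ1 iJ2 uniq_catC.
  - move=> j; rewrite mem_cat inE => hj; apply: SJ; rewrite inE mem_cat.
    by move: hj => /or3P[->|->|->]; rewrite ?orbT.
have mg' : measurable_fun setT g by apply/measurable_EFinP; exact: measurable_int gi.
have mh' : measurable_fun setT h by apply/measurable_EFinP; exact: measurable_int hi.
have [] := main g mg mg' _ _; [by move=> x; rewrite /g le_max lexx orbT|by rewrite fineK|].
set Fg := fun w => _ => ig Eg.
have [] := main h mh mh' _ _; [by move=> x; rewrite /h le_max lexx orbT|by rewrite fineK|].
set Fh := fun w => _ => ih Eh.
have FE : F = (Fg \- Fh)%R.
  by apply/funext => w; rewrite /F /Fg /Fh /= big_cons fgh; ring.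
have FE' : EFin \o F = (EFin \o Fg) \- (EFin \o Fh).
  by apply/funext => w; rewrite FE /= EFinB.
split; first by rewrite FE'; exact: integrableB.
rewrite -[X in integral _ _ X]/(EFin \o F) FE' integralB // Eg Eh -EFinB.
by congr EFin; rewrite big_cons mE; ring.
Qed.

Lemma indep_expectation (f : I -> R -> R) (m : I -> R) (J : seq I) :
  (forall i, (nu i).-integrable setT (EFin \o f i)) ->
  (forall i, \int[nu i]_x (f i x)%:E = (m i)%:E) ->
  uniq J -> (forall i, i \in J -> S i) ->
  P.-integrable setT (fun w => (\prod_(i <- J) f i (Y i w))%R%:E) /\
  \int[P]_w (\prod_(i <- J) f i (Y i w))%R%:E = (\prod_(i <- J) m i)%R%:E.
Proof.
move=> fi fm uJ SJ.
have kn i : \int[nu i]_x (0 : R)%:E = (0 : R)%:E by rewrite integral0.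
have uJ' : uniq (J ++ [::]) by rewrite cats0.
have SJ' i : i \in J ++ [::] -> S i by rewrite cats0; apply: SJ.
have [ii ee] := indep_expectation_aux (k := fun _ _ => 0%R) fi fm
  (fun=> measurable_cst _) (fun _ _ => lexx _) kn uJ' SJ'.
split; first by apply: eq_integrable ii => // w _; rewrite /= big_nil mulr1.
rewrite big_nil mulr1 in ee; rewrite -ee.
by apply: eq_integral => w _ /=; rewrite mulr1.
Qed.

End IndependentProducts.

(** * Moments of the normal law *)

Section NormalMoments.
Local Open Scope classical_set_scope.
Import numFieldNormedType.Exports.
Variables (R : realType).
Notation leb := (@lebesgue_measure R).

Fixpoint gmom (n : nat) : R :=
  match n with 0 => 1 | 1 => 0 | n'.+2 => n'.+1%:R * gmom n' end.

Lemma expR_ge_pow (y : R) n : 0 <= y -> y ^+ n <= n`!%:R * expR y.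
Proof.
move=> y0; case: n => [|n].
  by rewrite expr0 fact0 mul1r -expR0 ler_expR.
have := expR_ge1Dxn n y0.
rewrite -(@ler_pM2l _ (n.+1`!%:R)) ?ltr0n ?fact_gt0 // => h; apply: le_trans h.
rewrite mulrDr mulr1 mulrCA divff ?mulr1 ?lerDr //.
Qed.

Section Fixed.
Variable c : R.
Hypothesis c0 : 0 < c.

Definition gfun (x : R) := expR (- x ^+ 2 * c).

Definition growth (n : nat) : R := 1 + (2 / c) ^+ n * n`!%:R.

(** Half of the Gaussian absorbs the power: $|x^n|\le1+x^{2n}$, and for $y=cx^2/2$ one has
    $x^{2n}=(2/c)^ny^n\le(2/c)^nn!\,e^y$. This is the origin of [growth]. *)
Lemma pow_gfun_le n x : `|x ^+ n| * gfun x <= growth n * expR (- x ^+ 2 * (c / 2)).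
Proof.
have yE : - x ^+ 2 * c = - (x ^+ 2 * (c / 2)) - x ^+ 2 * (c / 2) by field.
rewrite /gfun yE expRD mulrA mulNr ler_wpM2r ?expR_ge0 //.
set y := x ^+ 2 * (c / 2).
have y0 : 0 <= y by rewrite mulr_ge0 ?sqr_ge0 // divr_ge0 // ltW.
rewrite expRN ler_pdivrMr ?expR_gt0 //.
apply: (@le_trans _ _ (1 + x ^+ 2 ^+ n)).
  rewrite -exprM mulnC exprM -[x ^+ n ^+ 2]real_normK ?num_real //.
  have := sqr_ge0 (`|x ^+ n| - 1); have := normr_ge0 (x ^+ n); nra.
rewrite /growth mulrDl mul1r; apply: lerD.
  by rewrite -expR0 ler_expR.
have -> : x ^+ 2 = 2 / c * y by rewrite /y; field; rewrite gt_eqF.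
rewrite exprMn -mulrA ler_wpM2l ?exprn_ge0 ?divr_ge0 ?(ltW c0) //.
exact: expR_ge_pow.
Qed.

Lemma growth_ge0 n : 0 <= growth n.
Proof. by rewrite addr_ge0 // mulr_ge0 // exprn_ge0 // divr_ge0 // ltW. Qed.

Lemma measurable_gfun : measurable_fun setT gfun.
Proof.
apply: measurableT_comp => //; apply: measurable_funM => //.
by apply: measurableT_comp => //; exact: measurable_funX.
Qed.

Lemma continuous_gfun : continuous gfun.
Proof.
move=> x; apply: (cvg_comp _ expR); last exact: continuous_expR.
apply: cvgM; last exact: cvg_cst.
apply: (@cvgN _ R^o); exact: sqr_continuous.
Qed.

(** The bound for the power $n+1$ leaves a spare factor $1/|x|$, which is the harmonic sequence
    here; [e] selects the end of the line. *)
Lemma pow_gfun_cvg0 n (e : bool) : (((-1) ^+ e * k.+1%:R) ^+ n * gfun ((-1) ^+ e * k.+1%:R)) @[k --> \oo] --> (0 : R).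
Proof.
apply/norm_cvg0P => /=.
apply: (@squeeze_cvgr _ _ _ _ (fun=> 0) (fun k => growth n.+1 * harmonic k)); last 2 first.
- exact: cvg_cst.
- by rewrite -[X in _ --> X](mulr0 (growth n.+1)); apply: cvgM; [exact: cvg_cst|exact: cvg_harmonic].
apply: nearW => k; rewrite normr_ge0 /= /harmonic /=.
rewrite ler_pdivlMr ?ltr0n //.
set x := (-1) ^+ e * k.+1%:R.
have xE : k.+1%:R = `|x| by rewrite /x normrM normrX normrN1 expr1n mul1r normr_nat.
rewrite xE normrM [`|gfun x|]ger0_norm ?expR_ge0 //.
rewrite mulrAC -normrM -exprSr.
apply: le_trans (pow_gfun_le n.+1 x) _; rewrite -[leRHS]mulr1 ler_wpM2l ?growth_ge0 //.
by rewrite -expR0 ler_expR mulNr oppr_le0 mulr_ge0 ?sqr_ge0 // divr_ge0 // ltW.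
Qed.

Lemma is_derive_pow_gfun n (x : R) : is_derive x 1 (fun x : R => x ^+ n * gfun x)
  (n%:R * x ^+ n.-1 * gfun x - 2 * c * x ^+ n.+1 * gfun x).
Proof.
have h1 : is_derive x 1 (fun x : R => x ^+ n) (n%:R * x ^+ n.-1).
  rewrite (_ : (fun x : R => x ^+ n) = id ^+ n); last by apply/funext => y; rewrite exprfctE.
  have h := is_deriveX n (is_derive_id x (1 : R)).
  by apply: (is_derive_eq h); rewrite /GRing.scale /= mulr1.
have h3 : is_derive x 1 (fun x : R => - x ^+ 2 * c) (- (2 * c * x)).
  have h := is_deriveM (is_deriveN (is_deriveX 2 (is_derive_id x 1))) (is_derive_cst c x 1).
  by apply: (is_derive_eq h); rewrite /GRing.scale /= mulr0 add0r mulr1 expr1; ring.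
have h2 : is_derive x 1 gfun (- (2 * c * x) * gfun x).
  by apply: (is_derive_eq (is_derive1_comp (is_derive_expR _) h3)); rewrite mulrC.
apply: (is_derive_eq (is_deriveM h1 h2)); rewrite /GRing.scale /= exprS; ring.
Qed.

Lemma integrable_gfun : leb.-integrable setT (EFin \o gfun).
Proof.
(* Variance $1/(2c)$ makes the normal density proportional to $e^{-cx^2}$. *)
pose s := Num.sqrt (c *+ 2)^-1.
have c2 : 0 < (c *+ 2)^-1 by rewrite invr_gt0 mulrn_wgt0.
have s0 : s != 0 by rewrite gt_eqF // sqrtr_gt0.
have sE : s ^+ 2 = (c *+ 2)^-1 by rewrite sqr_sqrtr // ltW.
have h := integrableZl measurableT (normal_peak s)^-1 (integrable_normal_pdf 0 s).
apply: eq_integrable h => // x _ /=.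
rewrite normal_pdfE // -EFinM mulKf ?gt_eqF ?normal_peak_gt0 //.
rewrite /normal_fun /gfun subr0 sE; congr (expR _)%:E; field.
by rewrite gt_eqF.
Qed.

End Fixed.

Section Moments.
Variable c : R.
Hypothesis c0 : 0 < c.
Notation g := (gfun c).

Lemma integrable_pow_gfun n : leb.-integrable setT (fun x => (x ^+ n * g x)%:E).
Proof.
have c2 : 0 < c / 2 by rewrite divr_gt0.
have h := integrableZl measurableT (growth c n) (integrable_gfun c2).
apply: (le_integrable measurableT _ _ h).
  apply/measurable_EFinP; apply: measurable_funM; first exact: measurable_funX.
  exact: measurable_gfun.
move=> x _ /=; rewrite lee_fin normrM [`|g x|]ger0_norm ?expR_ge0 //.
by rewrite (le_trans (pow_gfun_le c0 n x)) // ler_norm.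
Qed.

Definition gint n : R := \int[leb]_x (x ^+ n * g x).

Lemma gintE n : (\int[leb]_x (x ^+ n * g x)%:E = (gint n)%:E)%E.
Proof. by rewrite /gint /Rintegral fineK //; exact: integrable_fin_num (integrable_pow_gfun n). Qed.

Lemma continuous_pow_gfun n : continuous (fun x : R => x ^+ n * g x).
Proof.
by move=> x; apply: cvgM; [exact: exprn_continuous|exact: continuous_gfun].
Qed.

(** The derivative of $x^ne^{-cx^2}$ has integral 0 over the line. At $n=0$ the truncated
    predecessor is harmless, being multiplied by 0. *)
Lemma gint_rec n : 2 * c * gint n.+1 = n%:R * gint n.-1.
Proof.
pose F (x : R) := x ^+ n * g x.
pose f (x : R) := n%:R * x ^+ n.-1 * g x - 2 * c * x ^+ n.+1 * g x.
have fE x : f x = n%:R * (x ^+ n.-1 * g x) - 2 * c * (x ^+ n.+1 * g x) by rewrite /f !mulrA.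
have dF (x : R) : is_derive x 1 F (f x) by exact: is_derive_pow_gfun.
have fi : leb.-integrable setT (EFin \o f).
  have h := integrableB measurableT (integrableZl measurableT n%:R (integrable_pow_gfun n.-1))
     (integrableZl measurableT (2 * c) (integrable_pow_gfun n.+1)).
  by apply: eq_integrable h => // x _; rewrite /= fE.
have fint : (\int[leb]_x (f x)%:E = (n%:R * gint n.-1 - 2 * c * gint n.+1)%:E)%E.
  rewrite EFinB !EFinM -!gintE -!integralZl //; try exact: integrable_pow_gfun.
  rewrite -integralB //; try (apply: integrableZl => //; exact: integrable_pow_gfun).
  by apply: eq_integral => x _; rewrite fE EFinB !EFinM.
suff : (\int[leb]_x (f x)%:E = 0)%E.
  by rewrite fint => -[] /eqP; rewrite subr_eq0 => /eqP.
(* Truncation to a bounded interval: the fundamental theorem evaluates these integrals by boundary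
   values tending to 0, and domination by $|f|$ passes to the limit. *)
pose f_ k x := f x * \1_(`[(- k.+1%:R), k.+1%:R]) x.
have mf : measurable_fun setT f.
  by have /integrableP[/measurable_EFinP] := fi.
have := @dominated_convergence _ _ R leb setT measurableT (fun k x => (f_ k x)%:E) (EFin \o f)
  (fun x => `|f x|%:E) _ _ _ _ _.
case.
- move=> k; apply/measurable_EFinP/measurable_funM => //.
- exact/measurable_EFinP.
- apply: aeW => x _ /=; apply: cvg_near_cst; near=> k.
  rewrite /f_ indicE mem_set ?mulr1 //=.
  rewrite in_itv /= -ler_norml; apply: (@le_trans _ _ k%:R); last by rewrite ler_nat.
  by near: k; exact: nbhs_infty_ger.
- by have := integrable_abse fi.
- apply: aeW => x k _ /=; rewrite lee_fin /f_ normrM ler_piMr //.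
  by rewrite indicE; case: (_ \in _); rewrite ?normr1 ?normr0.
move=> _ _ cv.
apply: (cvg_unique _ cv); first exact: ereal_hausdorff.
have FTC k : (\int[leb]_x (f_ k x)%:E = (F k.+1%:R)%:E - (F (- k.+1%:R))%:E)%E.
  rewrite -(@continuous_FTC2 _ f).
  - rewrite [RHS]integral_mkcond; apply: eq_integral => x _.
    by rewrite patchE /f_ indicE; case: (_ \in _); rewrite ?mulr1 ?mulr0.
  - by rewrite (@lt_trans _ _ 0) ?oppr_lt0 ?ltr0Sn.
  - apply: continuous_subspaceT => x.
    rewrite (_ : f = fun x => n%:R * (x ^+ n.-1 * g x) - 2 * c * (x ^+ n.+1 * g x)); last exact/funext.
    by apply: cvgB; apply: cvgM; (try exact: cvg_cst); exact: continuous_pow_gfun.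
  - split.
    + move=> x _; exact: ex_derive.
    + apply: cvg_at_right_filter; exact: continuous_pow_gfun.
    + apply: cvg_at_left_filter; exact: continuous_pow_gfun.
  - move=> x _; rewrite derive1E; exact: derive_val.
rewrite (_ : [sequence _]_k = (fun k => (F k.+1%:R - F (- k.+1%:R))%:E)); last first.
  by apply/funext => k /=; rewrite FTC EFinB.
apply: cvg_EFin; first exact: nearW.
rewrite (_ : _ \o _ = fun k => F k.+1%:R - F (- k.+1%:R)) // -(subr0 0).
apply: cvgB.
  have := @pow_gfun_cvg0 c c0 n false; rewrite expr0; under eq_fun do rewrite mul1r; exact.
have := @pow_gfun_cvg0 c c0 n true; rewrite expr1; under eq_fun do rewrite mulN1r; exact.
Unshelve. all: by end_near. Qed.

End Moments.

Lemma normal_moments (s : R) n : 0 < s ->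
  (normal_prob 0 s).-integrable setT (fun x => (x ^+ n)%:E) /\
  (\int[normal_prob 0 s]_x (x ^+ n)%:E = (s ^+ n * gmom n)%:E)%E.
Proof.
move=> s0; have sn0 : s != 0 by rewrite gt_eqF.
pose c := (s ^+ 2 *+ 2)^-1.
have c0 : 0 < c by rewrite invr_gt0 mulrn_wgt0 // exprn_gt0.
pose K := normal_peak s.
have pdfE x : normal_pdf 0 s x = K * gfun c x.
  by rewrite normal_pdfE // /normal_fun /gfun subr0.
have mpdf : measurable_fun setT (normal_pdf 0 s) by exact: measurable_normal_pdf.
have dens (B : set R) : measurable B ->
    (\int[leb]_x (\1_B x * normal_pdf 0 s x)%:E = 1%:E * normal_prob 0 s B)%E.
  move=> mB; rewrite mul1e /normal_prob [RHS]integral_mkcond; apply: eq_integral => x _.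
  by rewrite patchE indicE; case: (_ \in _); rewrite ?mul1r ?mul0r.
have pdf0 := normal_pdf_ge0 0 s.
have intE k : (\int[leb]_x (x ^+ k * normal_pdf 0 s x)%:E = (K * gint c k)%:E)%E.
  rewrite EFinM -gintE // -integralZl //; last exact: integrable_pow_gfun.
  by apply: eq_integral => x _; rewrite pdfE -EFinM mulrCA.
have xi k : (normal_prob 0 s).-integrable setT (fun x => (x ^+ k)%:E).
  apply/integrableP; split; first by apply/measurable_EFinP; exact: measurable_funX.
  have := @ge0_integral_density _ _ (measurableTypeR R) (measurableTypeR R) R leb (normal_prob 0 s) id (normal_pdf 0 s) 1
    (@measurable_id _ _ _) mpdf pdf0 ler01 dens (fun x => `|x ^+ k|) _ (fun x => normr_ge0 _).
  rewrite mul1e => <-; last by apply: measurableT_comp => //; exact: measurable_funX.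
  have := integrableZl measurableT K (integrable_pow_gfun c0 k).
  move=> /integrableP[_]; congr (_ < _)%E; apply: eq_integral => x _ /=.
  by rewrite pdfE mulrCA normrM (ger0_norm (mulr_ge0 (normal_peak_ge0 s) (expR_ge0 _))).
split; first exact: xi.
have := @integral_density _ _ (measurableTypeR R) (measurableTypeR R) R leb (normal_prob 0 s) id (normal_pdf 0 s) 1
    (@measurable_id _ _ _) mpdf pdf0 ler01 dens (fun x => x ^+ n) (xi n).
rewrite mul1e intE => <-; congr EFin.
have m0 : K * gint c 0 = 1.
  have := integral_normal_pdf 0 s; have := intE 0.
  under eq_integral do rewrite expr0 mul1r.
  by move=> -> [].
have step k : K * gint c k.+1 = s ^+ 2 * (k%:R * (K * gint c k.-1)).
  have := gint_rec c0 k; rewrite /c -mulr_natr => h.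
  rewrite [k%:R * _]mulrCA -h; field; by rewrite sn0.
have m1 : K * gint c 1 = 0 by rewrite step mul0r mulr0.
suff : K * gint c n = s ^+ n * gmom n /\ K * gint c n.+1 = s ^+ n.+1 * gmom n.+1 by case.
elim: n => [|n [IH1 IH2]]; first by rewrite m0 m1 expr0 mul1r mulr0.
by split => //; rewrite step IH1 /= !exprS; ring.
Qed.

End NormalMoments.

(** * Expectations of cubic forms in independent normal variables *)

Section CubicExpectation.
Local Open Scope classical_set_scope.
Context d (T : measurableType d) (R : realType) (P : probability T R).
Context (I : choiceType) (S : set I) (Y : I -> T -> R) (sd : I -> R).
Hypothesis indep : mutually_independent P S Y.
Hypothesis sd0 : forall i, 0 < sd i.
Hypothesis mY : forall i, S i -> measurable_fun setT (Y i).
Hypothesis lawY : forall i B, S i -> measurable B -> P (Y i @^-1` B) = normal_prob 0 (sd i) B.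
Context (J : finType) (emb : J -> I).
Hypothesis emb_inj : injective emb.
Hypothesis embS : forall j, S (emb j).

Let y j w := Y (emb j) w / sd (emb j).

Lemma monomial_expectation (m : J -> nat) :
  P.-integrable setT (fun w => (\prod_j y j w ^+ m j)%:E) /\
  (\int[P]_w (\prod_j y j w ^+ m j)%:E = (\prod_j gmom R (m j))%:E)%E.
Proof.
(* Exponents are indexed by [J], the independent family by [I]; outside the image of [emb] the
   exponent is 0, so [f] is the constant 1 there. *)
pose pw i := if [pick j | emb j == i] is Some j then m j else 0%N.
have pwE j : pw (emb j) = m j.
  rewrite /pw; case: pickP => [j' /eqP /emb_inj -> //|/(_ j)]; by rewrite eqxx.
pose f i x := (x / sd i) ^+ pw i.
have fE i x : f i x = (sd i)^-1 ^+ pw i * x ^+ pw i by rewrite /f exprMn mulrC.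
pose nu i : probability (measurableTypeR R) R := normal_prob 0 (sd i).
have fi i : (nu i).-integrable setT (EFin \o f i).
  have [h _] := normal_moments (pw i) (sd0 i).
  have := integrableZl measurableT ((sd i)^-1 ^+ pw i) h.
  by apply: eq_integrable => // x _; rewrite /= fE EFinM.
have fm i : (\int[nu i]_x (f i x)%:E = (gmom R (pw i))%:E)%E.
  have [h E] := normal_moments (pw i) (sd0 i).
  under eq_integral => x _ do rewrite fE EFinM.
  rewrite integralZl // E -EFinM mulrA -exprMn mulVf ?expr1n ?mul1r //.
  by rewrite gt_eqF.
have uJ : uniq (map emb (enum J)) by rewrite map_inj_uniq ?enum_uniq.
have SJ i : i \in map emb (enum J) -> S i by move=> /mapP[j _ ->].
have := indep_expectation (nu := nu) indep mY lawY fi fm uJ SJ.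
have E (F : I -> R) : \prod_(i <- map emb (enum J)) F i = \prod_j F (emb j).
  by rewrite big_map big_enum.
rewrite E; under [X in _ = X%:E]eq_bigr => j _ do rewrite pwE.
rewrite (_ : (fun w => _) = (fun w => (\prod_j y j w ^+ m j)%:E)) //.
by apply/funext => w; rewrite E; congr EFin; apply: eq_bigr => j _; rewrite /f pwE.
Qed.

Lemma cubic_expectation (W : J -> J -> J -> R) k :
  ('E_P[fun w => ((6^-1 * \sum_a \sum_b \sum_c W a b c * (y a w * y b w * y c w)) ^+ k)%R]
   = (cubic_moment (gmom R) W k)%:E)%E.
Proof.
have [s [sE ->]] := cubic_moments_expand (gmom R) W k.
rewrite unlock.
under eq_integral => w _ do rewrite sE -sumEFin.
rewrite integral_sum //; last first.
  move=> m; have [h _] := monomial_expectation m.2.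
  have := integrableZl measurableT m.1 h.
  by apply: eq_integrable => // w _; rewrite EFinM.
rewrite -sumEFin; apply: eq_bigr => m _.
have [h E] := monomial_expectation m.2.
rewrite EFinM -E -integralZl //.
Qed.

End CubicExpectation.

(** * Real components of the spherical harmonic coefficients *)

Section Components.
Variable n : nat.

(** The part of [coeff_index] of degree at most [n], cut out of a finite product so that finite sums
    apply. *)
Definition valid_comp (x : 'I_n.+1 * 'I_n.+1 * bool) : bool :=
  [&& (0 < x.1.1)%N, (x.1.2 <= x.1.1)%N & (x.1.2 == 0 :> nat) ==> ~~ x.2].

Record comp := Comp { comp_val : 'I_n.+1 * 'I_n.+1 * bool; comp_valP : valid_comp comp_val }.
HB.instance Definition _ := [isSub for comp_val].
HB.instance Definition _ := [Finite of comp by <:].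
Implicit Types j k : comp.

Definition deg j : nat := (comp_val j).1.1.
Definition ord j : nat := (comp_val j).1.2.
Definition im j : bool := (comp_val j).2.

Lemma deg_gt0 j : (0 < deg j)%N. Proof. by case/and3P: (comp_valP j). Qed.
Lemma ord_le j : (ord j <= deg j)%N. Proof. by case/and3P: (comp_valP j). Qed.
Lemma ord0_im j : ord j = 0%N -> im j = false.
Proof. by case/and3P: (comp_valP j) => _ _ /implyP h /eqP /h /negPf. Qed.

Lemma comp_eqP j k : deg j = deg k -> ord j = ord k -> im j = im k -> j = k.
Proof.
move=> e1 e2 e3; apply: val_inj => /=; rewrite [LHS]surjective_pairing [RHS]surjective_pairing.
congr (_, _) => //; rewrite [LHS]surjective_pairing [RHS]surjective_pairing.
by congr (_, _); apply: val_inj.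
Qed.

Lemma comp_ex (l m : nat) (b : bool) : (0 < l <= n)%N -> (m <= l)%N -> ((m == 0%N) ==> ~~ b) ->
  exists j, [/\ deg j = l, ord j = m & im j = b].
Proof.
move=> /andP[l0 ln] ml mb.
have ln' : (l < n.+1)%N by []. have mn' : (m < n.+1)%N by lia.
have v : valid_comp (Ordinal ln', Ordinal mn', b) by apply/and3P; split.
by exists (Comp v).
Qed.

(* The component with [im] set stands for the negative magnetic number. *)
Definition mag j : int := if im j then - (ord j)%:Z else (ord j)%:Z.

Lemma mag_le j : `|mag j| <= (deg j)%:Z.
Proof. by have := ord_le j; rewrite /mag; case: ifP; lia. Qed.

Lemma mag_inj j k : deg j = deg k -> mag j = mag k -> j = k.
Proof.
move=> e1 e2; have := @ord0_im j; have := @ord0_im k.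
by move: e2; rewrite /mag; case ij: (im j); case ik: (im k) => e h h';
  apply: comp_eqP; rewrite ?ij ?ik //; lia.
Qed.

Lemma mag_ex l (m : int) : (0 < l <= n)%N -> `|m| <= l%:Z -> exists j, deg j = l /\ mag j = m.
Proof.
move=> ln ml; have [m0|m0] := leP 0 m.
  have [|//|j [dj oj ij]] := @comp_ex l (absz m) false ln; first by lia.
    by rewrite implybT.
  by exists j; rewrite /mag ij oj; split => //; lia.
have [||j [dj oj ij]] := @comp_ex l (absz m) true ln; [by lia|by apply/implyP; lia|].
by exists j; rewrite /mag ij oj; split => //; lia.
Qed.

(** Components of degree [l] also label the magnetic numbers through [mag], so one finite type
    indexes both the complex and the real coordinates. *)
Lemma sum_mrange (V : zmodType) l (F : int -> V) : (0 < l <= n)%N ->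
  \sum_(m <- mrange l) F m = \sum_(j | deg j == l) F (mag j).
Proof.
move=> ln.
have -> : \sum_(j | deg j == l) F (mag j) = \sum_(m <- [seq mag j | j <- enum [pred j | deg j == l]]) F m.
  by rewrite big_map big_enum.
apply: perm_big; apply: uniq_perm; first exact: mrange_uniq.
  rewrite map_inj_in_uniq ?enum_uniq // => j k; rewrite !mem_enum !inE => /eqP dj /eqP dk.
  by apply: mag_inj; rewrite dj dk.
move=> m; rewrite mem_mrange; apply/idP/mapP => [h|[j]].
  by have [j [dj mj]] := mag_ex ln h; exists j => //; rewrite mem_enum inE dj.
by rewrite mem_enum inE => /eqP <- ->; exact: mag_le.
Qed.

Lemma flip_subproof j : valid_comp ((comp_val j).1, if ord j == 0%N then im j else ~~ im j).
Proof.
have := comp_valP j; rewrite /valid_comp /= -/(ord j) -/(im j) => /and3P[-> -> h] /=.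
by case: (ord j == 0%N) h.
Qed.

(** Exchanges real and imaginary part, which in the other reading is $m\mapsto-m$; it fixes
    $m=0$. *)
Definition flip j : comp := Comp (flip_subproof j).

Lemma deg_flip j : deg (flip j) = deg j. Proof. by []. Qed.
Lemma ord_flip j : ord (flip j) = ord j. Proof. by []. Qed.
Lemma im_flip j : im (flip j) = if ord j == 0%N then im j else ~~ im j. Proof. by []. Qed.

Lemma flipK : involutive flip.
Proof.
move=> j; apply: comp_eqP; first by []; first by [].
by rewrite !im_flip ord_flip; case: eqP => // _; rewrite negbK.
Qed.

Lemma mag_flip j : mag (flip j) = - mag j.
Proof.
rewrite /mag im_flip ord_flip; have := @ord0_im j; case: eqP => [-> ->|_ _] //.
by case: (im j); rewrite ?opprK.
Qed.

Lemma flip_fix j : ord j = 0%N -> flip j = j.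
Proof. by move=> h; apply: comp_eqP; rewrite ?deg_flip ?ord_flip ?im_flip // h eqxx. Qed.

Lemma flip_neq j : ord j != 0%N -> flip j != j.
Proof.
by move=> h; apply/eqP => /(congr1 im); rewrite im_flip (negPf h); case: (im j).
Qed.

Opaque flip.

Lemma sum_pair (V : zmodType) j (G : comp -> V) :
  (forall k, k != j -> k != flip j -> G k = 0) ->
  \sum_k G k = if ord j == 0%N then G j else G j + G (flip j).
Proof.
move=> G0; rewrite (bigD1 j) //=; case: eqP => [z0|/eqP z0].
  by rewrite big1 ?addr0 // => k kj; apply: G0 => //; rewrite flip_fix.
rewrite (bigD1 (flip j)) /= ?flip_neq // big1 ?addr0 // => k /andP[kj kf]; exact: G0.
Qed.

Section Unitary.
Variable R : realType.
Local Open Scope complex_scope.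

Definition rs2 : R := (Num.sqrt 2)^-1.

Lemma rs2_sqr : rs2 * rs2 = 2^-1.
Proof. by rewrite /rs2 -invfM -expr2 sqr_sqrtr. Qed.

Definition mag_sign j : R := (-1) ^+ ord j.

Lemma mag_sign_sqr j : mag_sign j * mag_sign j = 1.
Proof. by rewrite /mag_sign -expr2 -exprM mulnC exprM sqrrN expr1n expr1n. Qed.

(* [a_{lm} / sqrt C_l] in terms of the normalized real components. *)
Definition umx j k : R[i] :=
  if k == j then
    (if ord j == 0%N then 1 else if im j then Complex 0 (- (mag_sign j * rs2)) else Complex rs2 0)
  else if k == flip j then
    (if im j then Complex (mag_sign j * rs2) 0 else Complex 0 rs2)
  else 0.

Lemma umx_out j k : k != j -> k != flip j -> umx j k = 0.
Proof. by rewrite /umx => /negPf -> /negPf ->. Qed.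

Lemma umx_jj j : umx j j = if ord j == 0%N then 1 else
  if im j then Complex 0 (- (mag_sign j * rs2)) else Complex rs2 0.
Proof. by rewrite /umx eqxx. Qed.

Lemma umx_jf j : ord j != 0%N -> umx j (flip j) = if im j then Complex (mag_sign j * rs2) 0 else Complex 0 rs2.
Proof. by move=> h; rewrite /umx (negPf (flip_neq h)) eqxx. Qed.

Lemma umx_fj j : ord j != 0%N -> umx (flip j) j = if im j then Complex 0 rs2 else Complex (mag_sign j * rs2) 0.
Proof.
move=> h; rewrite /umx flipK eq_sym (negPf (flip_neq h)) eqxx im_flip (negPf h) /mag_sign ord_flip.
by case: (im j).
Qed.

Lemma umx_ff j : ord j != 0%N -> umx (flip j) (flip j) =
  if im j then Complex rs2 0 else Complex 0 (- (mag_sign j * rs2)).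
Proof.
by move=> h; rewrite umx_jj ord_flip im_flip (negPf h) /mag_sign ord_flip; case: (im j).
Qed.

(** The relation $a_{l,-m}=(-1)^m\overline{a_{lm}}$ in matrix form. *)
Lemma conjc_umx j k : (conjc (umx j k)) = (mag_sign j)%:C * umx (flip j) k.
Proof.
have [->|kj] := eqVneq k j.
  have [z0|z0] := eqVneq (ord j) 0%N.
    by rewrite flip_fix // umx_jj z0 eqxx /mag_sign z0 expr0 mul1r conjc1.
  rewrite umx_jj (negPf z0) umx_fj //; have := mag_sign_sqr j; move: (mag_sign j) => e h.
  by case: (im j); apply/eqP; rewrite eq_complex /=; apply/andP; split; apply/eqP; ring: h.
have [kf|kf] := eqVneq k (flip j).
  have z0 : ord j != 0%N by apply: contraNneq kj => z0; rewrite kf flip_fix.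
  rewrite kf.
  rewrite umx_jf // umx_ff //; have := mag_sign_sqr j; move: (mag_sign j) => e h.
  by case: (im j); apply/eqP; rewrite eq_complex /=; apply/andP; split; apply/eqP; ring: h.
by rewrite !umx_out ?flipK // conjc0 mulr0.
Qed.

(** A row is supported on [j] and [flip j], so unitarity is a check on blocks of size at most
    two. *)
Lemma umx_rows j j' : \sum_k umx j k * (conjc (umx j' k)) = (j == j')%:R.
Proof.
rewrite (sum_pair (j := j)); last by move=> k kj kf; rewrite umx_out ?mul0r.
have [<-|ne] := eqVneq j j'.
  case: (eqVneq (ord j) 0%N) => z0; rewrite umx_jj; first by rewrite z0; apply/eqP; rewrite eq_complex /=; apply/andP; split; apply/eqP; ring.
  rewrite (negPf z0) umx_jf //.
  have h1 := mag_sign_sqr j; have h2 := rs2_sqr; move: (mag_sign j) rs2 h1 h2 => e r h1 h2.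
  have h3 : e * r * (e * r) = 2^-1 by rewrite mulrACA h1 h2 mul1r.
  by case: (im j); apply/eqP; rewrite eq_complex /=; apply/andP; split; apply/eqP; lra.
have [ff|nf] := eqVneq j' (flip j); last first.
  have out k : k = j \/ k = flip j -> umx j' k = 0.
    case=> ->; apply: umx_out.
    - exact: ne.
    - by apply: contra nf => /eqP ->; rewrite flipK.
    - rewrite eq_sym; exact: nf.
    - rewrite (inj_eq (inv_inj flipK)); exact: ne.
  rewrite (out _ (or_introl erefl)) (out _ (or_intror erefl)) rmorph0 !mulr0 addr0.
  by case: ifP.
have z0 : ord j != 0%N by apply: contraNneq ne => z0; rewrite ff flip_fix.
rewrite (negPf z0) ff umx_jj (negPf z0) umx_jf // umx_fj // umx_ff //.
have h1 := mag_sign_sqr j; have h2 := rs2_sqr; move: (mag_sign j) rs2 h1 h2 => e r h1 h2.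
  have h3 : e * r * (e * r) = 2^-1 by rewrite mulrACA h1 h2 mul1r.
by case: (im j); apply/eqP; rewrite eq_complex /=; apply/andP; split; apply/eqP; lra.
Qed.

Lemma umx_cols k k' : \sum_j umx j k * (conjc (umx j k')) = (k == k')%:R.
Proof.
rewrite (sum_pair (j := k)); last first.
  move=> j jk jf; rewrite umx_out ?mul0r //; first by rewrite eq_sym.
  by apply: contraNneq jf => ->; rewrite flipK.
have [<-|ne] := eqVneq k k'.
  case: (eqVneq (ord k) 0%N) => z0; rewrite umx_jj; first by rewrite z0; apply/eqP; rewrite eq_complex /=; apply/andP; split; apply/eqP; ring.
  rewrite (negPf z0) umx_fj //.
  have h1 := mag_sign_sqr k; have h2 := rs2_sqr; move: (mag_sign k) rs2 h1 h2 => e r h1 h2.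
  have h3 : e * r * (e * r) = 2^-1 by rewrite mulrACA h1 h2 mul1r.
  by case: (im k); apply/eqP; rewrite eq_complex /=; apply/andP; split; apply/eqP; lra.
have [ff|nf] := eqVneq k' (flip k); last first.
  have out j : j = k \/ j = flip k -> umx j k' = 0.
    case=> ->; apply: umx_out.
    - by rewrite eq_sym.
    - exact: nf.
    - exact: nf.
    - by rewrite flipK eq_sym.
  rewrite (out _ (or_introl erefl)) (out _ (or_intror erefl)) rmorph0 !mulr0 addr0.
  by case: ifP.
have z0 : ord k != 0%N by apply: contraNneq ne => z0; rewrite ff flip_fix.
rewrite (negPf z0) ff umx_jj (negPf z0) umx_jf // umx_fj // umx_ff //.
have h1 := mag_sign_sqr k; have h2 := rs2_sqr; move: (mag_sign k) rs2 h1 h2 => e r h1 h2.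
  have h3 : e * r * (e * r) = 2^-1 by rewrite mulrACA h1 h2 mul1r.
by case: (im k); apply/eqP; rewrite eq_complex /=; apply/andP; split; apply/eqP; lra.
Qed.

End Unitary.
End Components.

(** * The coupling tensor in real coordinates *)

Section CouplingTensor.
Variables (n : nat) (R : realType).
Local Open Scope complex_scope.
Local Notation J := (comp n).
Local Notation U := (@umx n R).
Local Notation msign := (@mag_sign n R).
Implicit Types j k : J.

Definition nrm2 (z : R[i]) : R := complex.Re z ^+ 2 + complex.Im z ^+ 2.

Lemma nrm2E z : (nrm2 z)%:C = z * conjc z.
Proof.
by case: z => x y; apply/eqP; rewrite eq_complex /=; apply/andP; split; apply/eqP; rewrite /nrm2 /=; ring.
Qed.

Lemma nrm2_ge0 z : 0 <= nrm2 z.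
Proof. by rewrite addr_ge0 ?sqr_ge0. Qed.

Lemma nrm2_real (x : R) : nrm2 x%:C = x ^+ 2.
Proof. by rewrite /nrm2 /= expr0n addr0. Qed.

Lemma rcI : injective (fun x : R => x%:C).
Proof. by move=> x y []. Qed.

Lemma conjc_scale (x : R) z : (conjc (x%:C * z)) = x%:C * conjc z.
Proof. by case: z => a b; apply/eqP; rewrite eq_complex /=; apply/andP; split; apply/eqP; ring. Qed.

Lemma conjc_mul (z t : R[i]) : (conjc (z * t)) = conjc z * conjc t.
Proof. exact: rmorphM. Qed.

Lemma conjc_scaler (x : R) z : (conjc (z * x%:C)) = conjc z * x%:C.
Proof. by rewrite mulrC conjc_scale mulrC. Qed.

Lemma sum_kron j (F : J -> R[i]) : \sum_i (j == i)%:R * F i = F j.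
Proof.
rewrite (bigD1 j) //= eqxx mul1r big1 ?addr0 // => i /negPf.
by rewrite eq_sym => ->; rewrite mul0r.
Qed.

Lemma parseval_gen (M : J -> J -> R[i]) (phi : J -> R[i]) :
  (forall j j', \sum_k M j k * (conjc (M j' k)) = (j == j')%:R) ->
  \sum_k nrm2 (\sum_j phi j * M j k) = \sum_j nrm2 (phi j).
Proof.
move=> MM; apply: rcI; rewrite !rmorph_sum /=.
transitivity (\sum_k \sum_j \sum_j' phi j * (conjc (phi j')) * (M j k * (conjc (M j' k)))).
  apply: eq_bigr => k _; rewrite nrm2E rmorph_sum /= mulr_suml; apply: eq_bigr => j _.
  rewrite mulr_sumr; apply: eq_bigr => j' _; rewrite rmorphM /=; ring.
rewrite exchange_big; apply: eq_bigr => j _ /=; rewrite exchange_big /=.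
under eq_bigr => j' _ do rewrite -mulr_sumr MM mulrC.
by rewrite sum_kron nrm2E.
Qed.

Lemma parseval_row (phi : J -> R[i]) :
  \sum_k nrm2 (\sum_j phi j * U j k) = \sum_j nrm2 (phi j).
Proof. by apply: parseval_gen => j j'; exact: umx_rows. Qed.

Lemma parseval_col (phi : J -> R[i]) :
  \sum_j nrm2 (\sum_k phi k * U j k) = \sum_k nrm2 (phi k).
Proof. by apply: (@parseval_gen (fun k j => U j k)) => j j'; exact: umx_cols. Qed.

Definition wcomp (a b c : nat) j1 j2 j3 : R :=
  if [&& deg j1 == a, deg j2 == b & deg j3 == c]
  then wigner3j a b c (mag j1) (mag j2) (mag j3) else 0.

Definition coupling (a b c : nat) k1 k2 k3 : R[i] :=
  \sum_j1 \sum_j2 \sum_j3 (wcomp a b c j1 j2 j3)%:C * (U j1 k1 * U j2 k2 * U j3 k3).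

Lemma mag_sign_mag j : msign j = sgnpow (mag j).
Proof. by rewrite /mag_sign /mag; case: ifP => _; rewrite ?sgnpowN. Qed.

Section Fixed.
Variables a b c : nat.
Hypothesis tri : triangle a b c.
Hypothesis even_sum : ~~ odd (a + b + c).

Lemma wcomp_swap12 j1 j2 j3 : wcomp b a c j2 j1 j3 = wcomp a b c j1 j2 j3.
Proof. by rewrite /wcomp andbCA; case: ifP => // _; rewrite wigner_swap12. Qed.

Lemma wcomp_swap23 j1 j2 j3 : wcomp a c b j1 j3 j2 = wcomp a b c j1 j2 j3.
Proof.
rewrite /wcomp [(deg j3 == c) && _]andbC; case: ifP => // _.
by rewrite wigner_swap23.
Qed.

Lemma wcomp_flip j1 j2 j3 : wcomp a b c (flip j1) (flip j2) (flip j3) = wcomp a b c j1 j2 j3.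
Proof. by rewrite /wcomp !deg_flip !mag_flip wigner_opp. Qed.

(** On the support $m_1+m_2+m_3=0$, so the product of the signs is $(-1)^0$. *)
Lemma wcomp_sign j1 j2 j3 : wcomp a b c j1 j2 j3 * (msign j1 * msign j2 * msign j3) = wcomp a b c j1 j2 j3.
Proof.
rewrite /wcomp; case: ifP => _; last by rewrite mul0r.
have [/eqP e|ne] := boolP (mag j1 + mag j2 + mag j3 == 0).
  by rewrite !mag_sign_mag -!sgnpowD e /sgnpow /= expr0 mulr1.
by rewrite wigner3j_neq0_sum // mul0r.
Qed.

Lemma coupling_swap12 k1 k2 k3 : coupling b a c k2 k1 k3 = coupling a b c k1 k2 k3.
Proof.
rewrite /coupling exchange_big; apply: eq_bigr => j1 _; apply: eq_bigr => j2 _.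
by apply: eq_bigr => j3 _; rewrite wcomp_swap12 [U j2 k2 * _]mulrC.
Qed.

Lemma coupling_swap23 k1 k2 k3 : coupling a c b k1 k3 k2 = coupling a b c k1 k2 k3.
Proof.
rewrite /coupling; apply: eq_bigr => j1 _; rewrite exchange_big /=; apply: eq_bigr => j2 _.
by apply: eq_bigr => j3 _; rewrite wcomp_swap23 mulrAC.
Qed.

(** Conjugation flips the three summation indices at the cost of signs; [wigner_opp] absorbs the
    flips and [wcomp_sign] the signs. *)
Lemma coupling_real k1 k2 k3 : (conjc (coupling a b c k1 k2 k3)) = coupling a b c k1 k2 k3.
Proof.
rewrite /coupling rmorph_sum /= (reindex_inj (inv_inj (@flipK n))) /=; apply: eq_bigr => j1 _.
rewrite rmorph_sum /= (reindex_inj (inv_inj (@flipK n))) /=; apply: eq_bigr => j2 _.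
rewrite rmorph_sum /= (reindex_inj (inv_inj (@flipK n))) /=; apply: eq_bigr => j3 _.
rewrite conjc_scale !conjc_mul !conjc_umx !flipK wcomp_flip -[in RHS]wcomp_sign.
rewrite /mag_sign !ord_flip !rmorphM /=; ring.
Qed.

Definition rcoupling k1 k2 k3 : R := complex.Re (coupling a b c k1 k2 k3).

Lemma rcouplingE k1 k2 k3 : coupling a b c k1 k2 k3 = (rcoupling k1 k2 k3)%:C.
Proof.
have := coupling_real k1 k2 k3; rewrite /rcoupling; case: (coupling _ _ _ _ _ _) => x y [] /= h.
by congr Complex; lra.
Qed.

Lemma umx_deg j k : deg k != deg j -> U j k = 0.
Proof.
move=> h; apply: umx_out; first by apply: contraNneq h => ->.
by apply: contraNneq h => ->; rewrite deg_flip.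
Qed.

Lemma rcoupling_out k1 k2 k3 : ~~ [&& deg k1 == a, deg k2 == b & deg k3 == c] -> rcoupling k1 k2 k3 = 0.
Proof.
move=> h; rewrite /rcoupling /coupling big1 // => j1 _; rewrite big1 // => j2 _; rewrite big1 // => j3 _.
rewrite /wcomp; case: ifP => [/and3P[/eqP d1 /eqP d2 /eqP d3]|_]; last by rewrite mul0r.
move: h; rewrite !negb_and => /or3P[]; rewrite -?d1 -?d2 -?d3 => h.
- by rewrite (umx_deg h) !mul0r mulr0.
- by rewrite (umx_deg h) mulr0 mul0r mulr0.
- by rewrite (umx_deg h) !mulr0.
Qed.

Hypothesis an : (0 < a <= n)%N.
Hypothesis bn : (0 < b <= n)%N.
Hypothesis cn : (0 < c <= n)%N.

Lemma wcomp_orth j1 j1' :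
  \sum_j2 \sum_j3 wcomp a b c j1 j2 j3 * wcomp a b c j1' j2 j3 =
  if deg j1 == a then (j1 == j1')%:R / a.*2.+1%:R else 0.
Proof.
have [d1|d1] := eqVneq (deg j1) a; last first.
  by rewrite big1 // => j2 _; rewrite big1 // => j3 _; rewrite /wcomp (negPf d1) mul0r.
have [d1'|d1'] := eqVneq (deg j1') a; last first.
  rewrite big1; last by move=> j2 _; rewrite big1 // => j3 _; rewrite /wcomp (negPf d1') andFb mulr0.
  by case: eqVneq => [e|_]; rewrite ?mul0r //; rewrite -e d1 eqxx in d1'.
have m1 := mag_le j1; rewrite d1 in m1.
have := wigner_orth1 R (mag j1') tri even_sum m1.
rewrite (sum_mrange _ bn) => E.
have -> : (j1 == j1') = (mag j1 == mag j1').
  by apply/eqP/eqP => [->//|]; apply: mag_inj; rewrite d1 d1'.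
rewrite -E [RHS]big_mkcond; apply: eq_bigr => j2 _; rewrite (sum_mrange _ cn).
case: ifP => d2; last by rewrite big1 // => j3 _; rewrite /wcomp d2 andbF mul0r.
rewrite [RHS]big_mkcond; apply: eq_bigr => j3 _; rewrite /wcomp d1 d1' eqxx d2 /=.
by case: ifP => // _; rewrite mul0r.
Qed.

(** Unitarity removes the matrices in slots 2 and 3 (Parseval twice), and orthogonality of the 3j
    symbols makes the remaining quadratic form in slot 1 diagonal. *)
Lemma coupling_contract (y : J -> R) :
  \sum_k2 \sum_k3 (\sum_k1 y k1 * rcoupling k1 k2 k3) ^+ 2 =
  (\sum_(j1 | deg j1 == a) nrm2 (\sum_k1 (y k1)%:C * U j1 k1)) / a.*2.+1%:R.
Proof.
have [z zE] : exists z : J -> R[i], forall j1, z j1 = \sum_k1 (y k1)%:C * U j1 k1.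
  by exists (fun j1 => \sum_k1 (y k1)%:C * U j1 k1).
pose q j2 j3 := \sum_j1 z j1 * (wcomp a b c j1 j2 j3)%:C.
transitivity (\sum_k2 \sum_k3 nrm2 (\sum_j3 (\sum_j2 q j2 j3 * U j2 k2) * U j3 k3)).
  apply: eq_bigr => k2 _; apply: eq_bigr => k3 _; rewrite -nrm2_real; congr nrm2.
  rewrite rmorph_sum /=.
  transitivity (\sum_k1 \sum_j1 \sum_j2 \sum_j3 (y k1)%:C * U j1 k1 * (wcomp a b c j1 j2 j3)%:C * U j2 k2 * U j3 k3).
    apply: eq_bigr => k1 _; rewrite rmorphM /= -rcouplingE /coupling.
    rewrite mulr_sumr; apply: eq_bigr => j1 _; rewrite mulr_sumr; apply: eq_bigr => j2 _.
    by rewrite mulr_sumr; apply: eq_bigr => j3 _; ring.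
  rewrite exchange_big /=.
  transitivity (\sum_j1 \sum_j2 \sum_j3 z j1 * (wcomp a b c j1 j2 j3)%:C * U j2 k2 * U j3 k3).
    apply: eq_bigr => j1 _; rewrite exchange_big /=; apply: eq_bigr => j2 _.
    rewrite exchange_big /=; apply: eq_bigr => j3 _.
    by rewrite zE !mulr_suml.
  rewrite exchange_big /=.
  under eq_bigr => j2 _ do rewrite exchange_big /=.
  rewrite exchange_big /=; apply: eq_bigr => j3 _; rewrite mulr_suml; apply: eq_bigr => j2 _.
  by rewrite /q !mulr_suml.
under eq_bigr => k2 _ do rewrite parseval_row.
rewrite exchange_big /=.
under eq_bigr => j3 _ do rewrite parseval_row.
apply: rcI; rewrite rmorphM /= !rmorph_sum /=.
transitivity (\sum_j1 \sum_j1' z j1 * (conjc (z j1')) *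
   (\sum_j2 \sum_j3 wcomp a b c j1 j2 j3 * wcomp a b c j1' j2 j3)%:C).
  transitivity (\sum_j3 \sum_j2 \sum_j1 \sum_j1' z j1 * (conjc (z j1')) * (wcomp a b c j1 j2 j3 * wcomp a b c j1' j2 j3)%:C).
    apply: eq_bigr => j3 _; rewrite rmorph_sum /=; apply: eq_bigr => j2 _.
    rewrite nrm2E /q rmorph_sum /= mulr_suml; apply: eq_bigr => j1 _.
    rewrite mulr_sumr; apply: eq_bigr => j1' _; rewrite conjc_scaler rmorphM /=; ring.
  under eq_bigr => j3 _ do rewrite exchange_big /=.
  rewrite exchange_big /=; apply: eq_bigr => j1 _.
  under eq_bigr => j3 _ do rewrite exchange_big /=.
  rewrite exchange_big /=; apply: eq_bigr => j1' _.
  rewrite exchange_big rmorph_sum /= mulr_sumr; apply: eq_bigr => j2 _.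
  by rewrite rmorph_sum /= mulr_sumr.
rewrite mulr_suml [RHS]big_mkcond; apply: eq_bigr => j1 _.
transitivity (\sum_j1' z j1 * conjc (z j1') * (if deg j1 == a then (j1 == j1')%:R / a.*2.+1%:R else 0 : R)%:C).
  by apply: eq_bigr => j1' _; congr (_ * _%:C); exact: wcomp_orth.
case: ifP => d1; last by rewrite big1 // => j1' _; rewrite mulr0.
rewrite -zE nrm2E (bigD1 j1) //= big1 ?addr0; last first.
  by move=> i /negPf; rewrite eq_sym => ->; rewrite mul0r mulr0.
by rewrite eqxx mul1r fmorphV.
Qed.

Lemma coupling_op (y : J -> R) :
  \sum_k2 \sum_k3 (\sum_k1 y k1 * rcoupling k1 k2 k3) ^+ 2 <= a.*2.+1%:R^-1 * \sum_k y k ^+ 2.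
Proof.
rewrite coupling_contract mulrC ler_wpM2l ?invr_ge0 //.
have <- : \sum_j nrm2 (\sum_k (y k)%:C * U j k) = \sum_k y k ^+ 2.
  by rewrite parseval_col; apply: eq_bigr => k _; rewrite nrm2_real.
by rewrite [leRHS](bigID (fun j => deg j == a)) /= lerDl sumr_ge0 // => j _; exact: nrm2_ge0.
Qed.

(** [coupling_contract] at the coordinate vectors: there are $2a+1$ rows of degree $a$, each of unit
    norm, divided by $2a+1$. *)
Lemma coupling_norm2 : \sum_k1 \sum_k2 \sum_k3 rcoupling k1 k2 k3 ^+ 2 = 1.
Proof.
transitivity (\sum_k1 (\sum_(j1 | deg j1 == a) nrm2 (U j1 k1)) / a.*2.+1%:R).
  apply: eq_bigr => k1 _; have := coupling_contract (fun k => (k == k1)%:R).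
  have K (V : pzSemiRingType) (F : J -> V) : \sum_k (k == k1)%:R * F k = F k1.
    by rewrite (bigD1 k1) //= eqxx mul1r big1 ?addr0 // => i /negPf ->; rewrite mul0r.
  under eq_bigr => k2 _ do under eq_bigr => k3 _ do rewrite K.
  move=> E; rewrite [LHS]E; congr (_ / _); apply: eq_bigr => j1 _; congr nrm2.
  by rewrite -(K _ (fun k => U j1 k)); apply: eq_bigr => k _; rewrite rmorph_nat.
rewrite -mulr_suml exchange_big /=.
have E j1 : \sum_k nrm2 (U j1 k) = 1.
  apply: rcI; rewrite rmorph_sum /=.
  transitivity ((j1 == j1)%:R : R[i]); last by rewrite eqxx.
  rewrite -umx_rows.
  by apply: eq_bigr => k _; rewrite nrm2E.
under eq_bigr => j1 _ do rewrite E.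
rewrite -(sum_mrange (fun=> 1) an) big_const_seq count_predT size_map size_iota.
by rewrite iter_addr_0 divff // pnatr_eq0.
Qed.

End Fixed.

Lemma umx_pair_sum j1 j2 : \sum_k U j1 k * U j2 k = (msign j2)%:C * (j1 == flip j2)%:R.
Proof.
rewrite -umx_rows mulr_sumr; apply: eq_bigr => k _.
rewrite conjc_umx flipK (_ : mag_sign R (flip j2) = msign j2); last by rewrite /mag_sign ord_flip.
transitivity ((msign j2 * msign j2)%:C * (U j1 k * U j2 k)); first by rewrite mag_sign_sqr mul1r.
by rewrite rmorphM /=; ring.
Qed.

(** By [umx_pair_sum] the real diagonal becomes the pairing of $m$ with $-m$ weighted by $(-1)^m$.
    The selection rule disposes of $m_3\neq0$, and [wigner_trace] of $m_3=0$. *)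
Lemma coupling_trace a c k3 : triangle a a c -> (0 < a <= n)%N -> (0 < c)%N ->
  \sum_k rcoupling a a c k k k3 = 0.
Proof.
move=> tri an c0.
suff E : \sum_k coupling a a c k k k3 = 0.
  rewrite /rcoupling -(raddf_sum (complex.Re (R:=R))) E //.
transitivity (\sum_j3 (\sum_j2 (wcomp a a c (flip j2) j2 j3 * msign j2)%:C) * U j3 k3).
  rewrite /coupling exchange_big /=.
  under eq_bigr => j1 _ do rewrite exchange_big /=.
  rewrite exchange_big /=.
  transitivity (\sum_j2 \sum_j1 \sum_j3 (wcomp a a c j1 j2 j3)%:C * U j3 k3 * (\sum_k U j1 k * U j2 k)).
    apply: eq_bigr => j2 _; apply: eq_bigr => j1 _; rewrite exchange_big /=; apply: eq_bigr => j3 _.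
    by rewrite mulr_sumr; apply: eq_bigr => k _; ring.
  transitivity (\sum_j2 \sum_j3 (wcomp a a c (flip j2) j2 j3 * msign j2)%:C * U j3 k3).
    apply: eq_bigr => j2 _; rewrite exchange_big /=; apply: eq_bigr => j3 _.
    rewrite (bigD1 (flip j2)) //= umx_pair_sum eqxx mulr1 big1 ?addr0; last first.
      by move=> j1 /negPf h; rewrite umx_pair_sum h !mulr0.
    by rewrite rmorphM /= mulrAC.
  by rewrite exchange_big /=; apply: eq_bigr => j3 _; rewrite mulr_suml.
rewrite big1 // => j3 _; rewrite -rmorph_sum /= [X in X%:C * _](_ : _ = 0) ?mul0r //.
have [d3|d3] := eqVneq (deg j3) c; last first.
  by rewrite big1 // => j2 _; rewrite /wcomp (negPf d3) !andbF mul0r.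
have [m3|m3] := eqVneq (mag j3) 0; last first.
  rewrite big1 // => j2 _; rewrite /wcomp mag_flip; case: ifP => _; rewrite ?mul0r //.
  by rewrite wigner3j_neq0_sum ?mul0r // addNr add0r.
have := wigner_trace R tri c0.
rewrite -msum_opp (sum_mrange _ an) => E; rewrite -[RHS]E [RHS]big_mkcond.
apply: eq_bigr => j2 _; rewrite /wcomp deg_flip mag_flip d3 m3 eqxx andbT andbb.
by case: ifP => _; rewrite ?mul0r // opprK sgnpowN mag_sign_mag mulrC.
Qed.

End CouplingTensor.

(** * The statistic as a cubic form *)

Section CouplingSymmetries.
Variables (n : nat) (R : realType).
Notation J := (comp n).
Implicit Types i j k : J.

Lemma rcoupling_swap12 a b c i j k : triangle a b c -> ~~ odd (a + b + c) ->
  rcoupling R b a c j i k = rcoupling R a b c i j k.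
Proof. by move=> t e; rewrite /rcoupling coupling_swap12. Qed.

Lemma rcoupling_swap23 a b c i j k : triangle a b c -> ~~ odd (a + b + c) ->
  rcoupling R a c b i k j = rcoupling R a b c i j k.
Proof. by move=> t e; rewrite /rcoupling coupling_swap23. Qed.

(** If the first two degrees differ, the diagonal lies outside the support of the tensor. *)
Lemma rcoupling_trace a b c k : triangle a b c -> (0 < a <= n)%N -> (0 < c)%N ->
  \sum_i rcoupling R a b c i i k = 0.
Proof.
move=> t an c0; have [ab|ab] := eqVneq a b.
  by rewrite -ab; apply: coupling_trace => //; rewrite -ab in t.
rewrite big1 // => i _; rewrite rcoupling_out //.
by apply: contra ab => /and3P[/eqP <- /eqP <- _].
Qed.

End CouplingSymmetries.

(** * Norm, traces and operator bounds of the symmetrized tensor *)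

Section Bispectrum.
Variables (R : realType) (l1 l2 l3 : nat).
Hypothesis adm : admissible l1 l2 l3.
Notation n := l3.
Notation J := (comp n).

Definition bsign : R := (-1) ^+ ((l1 + l2 + l3) %/ 2).
Definition btensor (i j k : J) : R := bsign * rcoupling R l1 l2 l3 i j k.

Let tri : triangle l1 l2 l3. Proof. by case/and5P: adm => _ _ t1 t2 /andP[t3 _]; apply/and3P. Qed.
Let even_sum : ~~ odd (l1 + l2 + l3). Proof. by case/and5P: adm => _ _ _ _ /andP[]. Qed.
Let l1n : (0 < l1 <= n)%N. Proof. by case/and5P: adm => ? /andP[? ?] _ _ _; lia. Qed.
Let l2n : (0 < l2 <= n)%N. Proof. by case/and5P: adm => ? /andP[? ?] _ _ _; lia. Qed.
Let l3n : (0 < l3 <= n)%N. Proof. by case/and5P: adm => ? /andP[? ?] _ _ _; lia. Qed.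
Let l12 : (l1 <= l2)%N. Proof. by case/and5P: adm => _ /andP[]. Qed.
Let l23 : (l2 <= l3)%N. Proof. by case/and5P: adm => _ /andP[]. Qed.

Lemma bsign_sqr : bsign ^+ 2 = 1.
Proof. by rewrite /bsign -exprM mulnC exprM sqrrN expr1n expr1n. Qed.

(** Stated for an arbitrary order of the degrees, since every flattening is needed. A flattening
    along degree $a$ has squared norm at most $1/(2a+1)$; the smallest degree $l_1$ gives the common
    bound. *)
Lemma op_le (a b c : nat) (F : J -> J -> J -> R) : triangle a b c -> ~~ odd (a + b + c) ->
  (0 < b <= n)%N -> (0 < c <= n)%N -> (l1 <= a)%N ->
  (forall i j k, F i j k = bsign * rcoupling R a b c i j k) ->
  forall y : J -> R, \sum_j \sum_k (\sum_i y i * F i j k) ^+ 2 <= l1.*2.+1%:R^-1 * \sum_i y i ^+ 2.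
Proof.
move=> t e bn cn la FE y.
apply: (@le_trans _ _ (a.*2.+1%:R^-1 * \sum_i y i ^+ 2)); last first.
  rewrite ler_wpM2r ?sumr_ge0 // => [i _|]; first exact: sqr_ge0.
  by rewrite lef_pV2 ?posrE ?ltr0Sn // ler_nat ltnS leq_double.
apply: (le_trans _ (coupling_op t e bn cn y)).
apply: ler_sum => j _; apply: ler_sum => k _.
rewrite (eq_bigr (fun i => bsign * (y i * rcoupling R a b c i j k))); last first.
  by move=> i _; rewrite FE mulrCA.
by rewrite -mulr_sumr exprMn bsign_sqr mul1r.
Qed.

Let tri213 := tri_swap12 tri.
Let tri132 := tri_swap23 tri.
Let tri231 := tri_swap23 tri213.
Let tri312 := tri_swap12 tri132.
Let even213 : ~~ odd (l2 + l1 + l3). Proof. by move: even_sum; lia. Qed.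
Let even132 : ~~ odd (l1 + l3 + l2). Proof. by move: even_sum; lia. Qed.
Let even312 : ~~ odd (l3 + l1 + l2). Proof. by move: even_sum; lia. Qed.

Let even231 : ~~ odd (l2 + l3 + l1). Proof. by move: even_sum; lia. Qed.

Lemma btensor_213 i j k : btensor j i k = bsign * rcoupling R l2 l1 l3 i j k.
Proof. by rewrite /btensor (rcoupling_swap12 _ _ _ _ tri213 even213). Qed.

Lemma btensor_132 i j k : btensor i k j = bsign * rcoupling R l1 l3 l2 i j k.
Proof. by rewrite /btensor (rcoupling_swap23 _ _ _ _ tri132 even132). Qed.

Lemma btensor_312 i j k : btensor j k i = bsign * rcoupling R l3 l1 l2 i j k.
Proof. by rewrite btensor_132 (rcoupling_swap12 _ _ _ _ tri312 even312). Qed.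

Lemma btensor_231 i j k : btensor k i j = bsign * rcoupling R l2 l3 l1 i j k.
Proof. by rewrite btensor_213 (rcoupling_swap23 _ _ _ _ tri231 even231). Qed.

(** Each permuted copy of the tensor either coincides with it, when the permutation fixes
    $(l_1,l_2,l_3)$, or has disjoint support. The inner products thus count the stabilizer of the
    triple, which has order $\Delta$. *)
Lemma btensor_norm2 : \sum_i \sum_j \sum_k symmetrize btensor i j k ^+ 2 = Delta3 l1 l2 l3 / 6.
Proof.
have d1 : \sum_i \sum_j \sum_k btensor i j k * btensor i j k = 1.
  rewrite -(coupling_norm2 R tri even_sum l1n l2n l3n).
  apply: eq_bigr => i _; apply: eq_bigr => j _; apply: eq_bigr => k _.
  by rewrite -expr2 exprMn bsign_sqr mul1r.
have out i j k : ~~ [&& deg i == l1, deg j == l2 & deg k == l3] -> btensor i j k = 0.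
  by move=> h; rewrite /btensor rcoupling_out ?mulr0.
have dsum (F : J -> J -> J -> R) (b : bool) :
    (b -> forall i j k, F i j k = btensor i j k) ->
    (~~ b -> forall i j k, deg i = l1 -> deg j = l2 -> deg k = l3 -> F i j k = 0) ->
    \sum_i \sum_j \sum_k btensor i j k * F i j k = b%:R.
  case: b => [/(_ isT) h _|_ /(_ isT) h].
    rewrite -[RHS]d1; apply: eq_bigr => i _; apply: eq_bigr => j _; apply: eq_bigr => k _.
    by rewrite h.
  rewrite big1 // => i _; rewrite big1 // => j _; rewrite big1 // => k _.
  have [/and3P[/eqP ? /eqP ? /eqP ?]|h'] := boolP [&& deg i == l1, deg j == l2 & deg k == l3].
    by rewrite h ?mulr0.
  by rewrite out ?mul0r.
have e12 : l1 == l2 -> forall i j k, btensor j i k = btensor i j k.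
  by move=> /eqP e i j k; rewrite btensor_213 /btensor -e.
have e23 : l2 == l3 -> forall i j k, btensor i k j = btensor i j k.
  by move=> /eqP e i j k; rewrite btensor_132 /btensor e.
rewrite symmetrize_norm2 d1.
rewrite (@dsum (fun i j k => btensor j i k) (l1 == l2)); last 2 first.
- exact: e12.
- move=> ne i j k di dj dk; apply: out; apply: contra ne => /and3P[/eqP h _ _].
  by rewrite -h dj.
rewrite (@dsum (fun i j k => btensor i k j) (l2 == l3)); last 2 first.
- exact: e23.
- move=> ne i j k di dj dk; apply: out; apply: contra ne => /and3P[_ /eqP h _].
  by rewrite -h dk.
rewrite (@dsum (fun i j k => btensor k i j) ((l1 == l2) && (l2 == l3))); last 2 first.
- by move=> /andP[h h'] i j k; rewrite (e12 h) (e23 h').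
- move=> ne i j k di dj dk; apply: out; apply: contra ne => /and3P[/eqP h1 /eqP h2 /eqP h3].
  by apply/andP; split; apply/eqP; [rewrite -di|rewrite -dj].
rewrite (@dsum (fun i j k => btensor j k i) ((l1 == l2) && (l2 == l3))); last 2 first.
- by move=> /andP[h h'] i j k; rewrite (e23 h') (e12 h).
- move=> ne i j k di dj dk; apply: out; apply: contra ne => /and3P[/eqP h1 /eqP h2 /eqP h3].
  by apply/andP; split; apply/eqP; [rewrite -h1|rewrite -h2].
(* Exchanging the outer slots preserves the degrees only if $l_1=l_3$, and the ordering then makes
   all three equal. *)
rewrite (@dsum (fun i j k => btensor k j i) ((l1 == l2) && (l2 == l3))); last 2 first.
- by move=> /andP[h h'] i j k; rewrite (e12 h) (e23 h') (e12 h).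
- move=> ne i j k di dj dk; apply: out; apply: contra ne => /and3P[/eqP h1 /eqP h2 /eqP h3].
  have e13 : l1 = l3 by rewrite -dk -h1.
  by apply/andP; split; apply/eqP; lia.
rewrite mulrC /Delta3; congr (_ / _).
have [e|ne] := eqVneq l1 l2; have [e'|ne'] := eqVneq l2 l3; rewrite /= ?addr0.
- by rewrite e e' ltnn /=; ring.
- by rewrite e ltnn /=.
- by rewrite e' ltnn andbF /=.
- by rewrite ifT //; apply/andP; split; lia.
Qed.

(** The squared norm $\Delta/6$ gives variance $\Delta/36$, and $\Delta\le6$ allows [K = 1]. *)
Lemma btensor_moments : 
  cubic_moment (gmom R) (symmetrize btensor) 2 = Delta3 l1 l2 l3 / 36 /\
  forall p, `|cubic_moment (gmom R) (symmetrize btensor) p.*2 -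
     (odd_dfact p)%:R * (Delta3 l1 l2 l3 / 36) ^+ p| <= cM 1 p * l1.*2.+1%:R^-1.
Proof.
apply: cubic_moments => //.
- exact: symmetrizeC12.
- exact: symmetrizeC23.
- apply: symmetrize_trace => k.
  + by rewrite -mulr_sumr rcoupling_trace ?mulr0 //; case/andP: l3n.
  + transitivity (\sum_i bsign * rcoupling R l1 l3 l2 i i k).
      by apply: eq_bigr => i _; exact: btensor_132.
    by rewrite -mulr_sumr rcoupling_trace ?mulr0 //; case/andP: l2n.
  + transitivity (\sum_i bsign * rcoupling R l2 l3 l1 i i k).
      by apply: eq_bigr => i _; exact: btensor_231.
    by rewrite -mulr_sumr rcoupling_trace ?mulr0 //; case/andP: l1n.
- by rewrite invf_le1 ?ltr0Sn // ler1n.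
- rewrite btensor_norm2 ler_pdivrMr // mul1r /Delta3.
  by case: ifP => _; [lra|case: ifP => _; lra].
- apply: symmetrize_op.
  + exact: (op_le tri even_sum l2n l3n).
  + by apply: (op_le tri213 even213 l1n l3n l12) => i j k; rewrite btensor_213.
  + by apply: (op_le tri312 even312 l1n l2n (leq_trans l12 l23)) => i j k; rewrite btensor_312.
- by rewrite btensor_norm2; field.
Qed.

End Bispectrum.

(** * From the complex triple sum to real coordinates *)

Section IstatTensor.
Local Open Scope complex_scope.
Variables (T : Type) (R : realType) (C : nat -> R) (X : nat -> nat -> bool -> T -> R).
Hypothesis C_gt0 : forall l, (0 < l)%N -> 0 < C l.

(* Standard deviation of the component [(l, m, b)]; [C 0] is irrelevant and replaced by [1]. *)
Definition comp_sd (i : nat * nat * bool) : R :=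
  if i.1.1 == 0%N then 1 else
  if i.1.2 == 0%N then Num.sqrt (C i.1.1) else Num.sqrt (C i.1.1 / 2).

Lemma comp_sd_gt0 i : 0 < comp_sd i.
Proof.
rewrite /comp_sd; case: eqP => [//|/eqP l0].
have Cl : 0 < C i.1.1 by apply: C_gt0; lia.
by case: ifP => _; rewrite sqrtr_gt0 // divr_gt0.
Qed.

Definition comp_index n (j : comp n) : nat * nat * bool := (deg j, ord j, im j).

Lemma comp_index_inj n : injective (@comp_index n).
Proof. by move=> j k [] e1 e2 e3; exact: comp_eqP. Qed.

Lemma comp_index_coeff n (j : comp n) : coeff_index (comp_index j).
Proof.
apply/orP; have [m0|m0] := eqVneq (ord j) 0%N; last by right; rewrite lt0n m0 ord_le.
by left; rewrite deg_gt0 (ord0_im m0).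
Qed.

Definition ncomp n (j : comp n) (w : T) : R :=
  X (deg j) (ord j) (im j) w / comp_sd (comp_index j).

(** For $m\neq0$ the real components have standard deviation $\sqrt{C_l}/\sqrt2$; normalizing them
    produces the entries [rs2]. *)
Lemma alm_umx n (j : comp n) w :
  alm X (deg j) (mag j) w = (Num.sqrt (C (deg j)))%:C * \sum_k umx R j k * (ncomp k w)%:C.
Proof.
have l0 := deg_gt0 j.
have sC : 0 < Num.sqrt (C (deg j)) by rewrite sqrtr_gt0 C_gt0.
have d0 : (deg j == 0%N) = false by lia.
rewrite (sum_pair (j := j)); last by move=> k kj kf; rewrite umx_out ?mul0r.
rewrite /ncomp /comp_index /comp_sd /= !deg_flip !ord_flip d0 /=.
have [m0|m0] := eqVneq (ord j) 0%N.
  rewrite umx_jj /alm /mag (ord0_im m0) m0 /= mul1r.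
  by rewrite -rmorphM /= mulrCA divff ?mulr1 // gt_eqF.
have sd2 : Num.sqrt (C (deg j) / 2) = Num.sqrt (C (deg j)) * rs2 R.
  by rewrite sqrtrM ?(ltW (C_gt0 l0)) // /rs2 sqrtrV.
rewrite umx_jj (negPf m0) umx_jf // im_flip (negPf m0) sd2 /alm /mag.
have r0 : rs2 R != 0 by rewrite /rs2 invr_eq0 gt_eqF // sqrtr_gt0.
have s0 : Num.sqrt (C (deg j)) != 0 by rewrite gt_eqF.
move: (Num.sqrt _) (rs2 R) s0 r0 => s r s0 r0.
case: (im j).
  rewrite abszN absz_nat (negPf m0) /= ifF; last by lia.
  rewrite -[(-1) ^+ _]/((-1) ^+ ord j).
  have -> : (-1) ^+ ord j = (mag_sign R j)%:C by rewrite /mag_sign rmorphXn rmorphN1.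
  by apply/eqP; rewrite eq_complex /=; apply/andP; split; apply/eqP; field; rewrite s0 r0.
rewrite absz_nat (negPf m0) /=.
by apply/eqP; rewrite eq_complex /=; apply/andP; split; apply/eqP; field; rewrite s0 r0.
Qed.

Lemma exchange_sum_triple (V : nmodType) (J : finType) (G : J -> J -> J -> J -> V) :
  \sum_k \sum_a \sum_b \sum_c G k a b c = \sum_a \sum_b \sum_c \sum_k G k a b c.
Proof.
rewrite exchange_big; apply: eq_bigr => a _; rewrite exchange_big; apply: eq_bigr => b _.
by rewrite exchange_big.
Qed.

Lemma Istat_tensor l1 l2 l3 w : admissible l1 l2 l3 ->
  Istat C X l1 l2 l3 w = \sum_i \sum_j \sum_k
    btensor R l1 l2 i j k * (ncomp i w * ncomp j w * ncomp (n := l3) k w).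
Proof.
move=> adm.
have tri : triangle l1 l2 l3 by case/and5P: adm => _ _ t1 t2 /andP[t3 _]; apply/and3P.
have ev : ~~ odd (l1 + l2 + l3) by case/and5P: adm => _ _ _ _ /andP[].
have [l1n l2n l3n] : [/\ 0 < l1 <= l3, 0 < l2 <= l3 & 0 < l3 <= l3]%N.
  by case/and5P: adm => ? /andP[? ?] _ _ _; split; lia.
have s0 l : (0 < l <= l3)%N -> Num.sqrt (C l) != 0.
  by move=> /andP[h _]; rewrite gt_eqF // sqrtr_gt0 C_gt0.
pose Y (j : comp l3) := (ncomp j w)%:C.
have [Al AlE] : exists Al : comp l3 -> R[i], forall j, Al j = \sum_k umx R j k * Y k.
  by exists (fun j => \sum_k umx R j k * Y k).
have AE j l : deg j = l -> alm X l (mag j) w = (Num.sqrt (C l))%:C * Al j.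
  by move=> <-; rewrite AlE; exact: alm_umx.
rewrite /Istat -/(mrange l1) -/(mrange l2) -/(mrange l3).
set Z := (X in complex.Re X).
have ZE : Z = (Num.sqrt (C l1) * Num.sqrt (C l2) * Num.sqrt (C l3) *
   \sum_i \sum_j \sum_k rcoupling R l1 l2 l3 i j k * (ncomp i w * ncomp j w * ncomp (n := l3) k w))%:C.
  transitivity (\sum_j1 \sum_j2 \sum_j3 (Num.sqrt (C l1) * Num.sqrt (C l2) * Num.sqrt (C l3))%:C *
      ((wcomp R l1 l2 l3 j1 j2 j3)%:C * (Al j1 * Al j2 * Al j3))).
    rewrite /Z (sum_mrange _ l1n) big_mkcond; apply: eq_bigr => j1 _.
    case: eqP => [d1|/eqP d1]; last first.
      by rewrite big1 // => j2 _; rewrite big1 // => j3 _; rewrite /wcomp (negPf d1) mul0r mulr0.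
    rewrite (sum_mrange _ l2n) big_mkcond; apply: eq_bigr => j2 _.
    case: eqP => [d2|/eqP d2]; last first.
      by rewrite big1 // => j3 _; rewrite /wcomp (negPf d2) andbF mul0r mulr0.
    rewrite (sum_mrange _ l3n) big_mkcond; apply: eq_bigr => j3 _.
    case: eqP => [d3|/eqP d3]; last by rewrite /wcomp (negPf d3) !andbF mul0r mulr0.
    rewrite /wcomp d1 d2 d3 !eqxx /= (AE _ _ d1) (AE _ _ d2) (AE _ _ d3) !rmorphM /=.
    ring.
  rewrite [RHS]rmorphM /=.
  transitivity ((Num.sqrt (C l1) * Num.sqrt (C l2) * Num.sqrt (C l3))%:C *
     \sum_j1 \sum_j2 \sum_j3 (wcomp R l1 l2 l3 j1 j2 j3)%:C * (Al j1 * Al j2 * Al j3)).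
    rewrite mulr_sumr; apply: eq_bigr => j1 _; rewrite mulr_sumr; apply: eq_bigr => j2 _.
    by rewrite mulr_sumr.
  congr (_ * _).
  transitivity (\sum_k1 \sum_k2 \sum_k3 \sum_j1 \sum_j2 \sum_j3 (wcomp R l1 l2 l3 j1 j2 j3)%:C *
    (umx R j1 k1 * umx R j2 k2 * umx R j3 k3) * (Y k1 * Y k2 * Y k3)); last first.
    rewrite rmorph_sum /=; apply: eq_bigr => k1 _; rewrite rmorph_sum /=; apply: eq_bigr => k2 _.
    rewrite rmorph_sum /=; apply: eq_bigr => k3 _.
    rewrite rmorphM /= -rcouplingE // /coupling.
    have -> : (ncomp k1 w * ncomp k2 w * ncomp k3 w)%:C = Y k1 * Y k2 * Y k3 by rewrite /Y 2!rmorphM.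
    rewrite mulr_suml; apply: eq_bigr => j1 _; rewrite mulr_suml; apply: eq_bigr => j2 _.
    by rewrite mulr_suml.
  under [RHS]eq_bigr => k1 _ do under eq_bigr => k2 _ do rewrite exchange_sum_triple.
  under [RHS]eq_bigr => k1 _ do rewrite exchange_sum_triple.
  rewrite exchange_sum_triple.
  apply: eq_bigr => j1 _; apply: eq_bigr => j2 _; apply: eq_bigr => j3 _.
  rewrite !AlE !mulr_suml mulr_sumr; apply: eq_bigr => k1 _.
  rewrite [RHS]exchange_big /= 2!mulr_sumr; apply: eq_bigr => k3 _.
  rewrite mulr_sumr mulr_suml mulr_sumr; apply: eq_bigr => k2 _; ring.
rewrite ZE /= !sqrtrM ?mulr_ge0 ?(ltW (C_gt0 _)) //; try lia.
rewrite -/(bsign R l1 l2 l3) mulrA divfK ?mulf_neq0 ?s0 //.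
rewrite mulr_sumr; apply: eq_bigr => i _; rewrite mulr_sumr; apply: eq_bigr => j _.
by rewrite mulr_sumr; apply: eq_bigr => k _; rewrite /btensor; ring.
Qed.

End IstatTensor.

Section IstatMoments.
Local Open Scope classical_set_scope.
Context (R : realType) (d : measure_display) (T : measurableType d) (P : probability T R).
Variables (C : nat -> R) (X : nat -> nat -> bool -> T -> R).
Hypothesis gauss : isotropic_gaussian_coeffs P C X.

(** A symmetric product of variables sees only the symmetrized tensor; the factor $6^k$ undoes the
    $1/6$ built into [cubic]. *)
Lemma Istat_moment l1 l2 l3 k : admissible l1 l2 l3 ->
  ('E_P[fun w => (Istat C X l1 l2 l3 w ^+ k)%R] =
   (6 ^+ k * cubic_moment (gmom R) (symmetrize (btensor R l1 l2 (l3 := l3))) k)%:E)%E.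
Proof.
move=> adm; have [C0 law0 lawm ind] := gauss.
have law i : coeff_index i -> centered_gaussian P (comp_sd C i ^+ 2) (X i.1.1 i.1.2 i.2).
  case: i => [[l m] b] /=; rewrite /comp_sd /= => /orP[/and3P[l0 /eqP -> /negPf ->]|/[dup] h /andP[m0 ml]].
    by rewrite eqn0Ngt l0 eqxx sqr_sqrtr ?(ltW (C0 _ l0)) //; exact: law0.
  have l0 : (0 < l)%N := leq_trans m0 ml.
  by rewrite !eqn0Ngt l0 m0 /= sqr_sqrtr ?divr_ge0 ?(ltW (C0 _ l0)) //; exact: lawm.
rewrite -cubic_momentZ.
rewrite -(@cubic_expectation _ T R P _ coeff_index (fun i => X i.1.1 i.1.2 i.2) (comp_sd C)
  ind (comp_sd_gt0 C0) _ _ _ (@comp_index l3) (@comp_index_inj l3) (@comp_index_coeff l3)); last 2 first.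
- by move=> i /law[].
- by move=> i B /law[_ h] mB; rewrite h // sqrtr_sqr ger0_norm // ltW // comp_sd_gt0.
congr ('E_P[_])%E; apply/funext => w; congr (_ ^+ k).
rewrite (Istat_tensor X C0 w adm).
rewrite -(@sum_symmetrize _ _ (btensor R l1 l2 (l3 := l3))
  (fun i j k => ncomp C X i w * ncomp C X j w * ncomp C X k w)); last 2 first.
- by move=> i j m; rewrite [ncomp C X i w * _]mulrC.
- by move=> i j m; rewrite mulrAC.
rewrite [RHS]mulr_sumr; apply: eq_bigr => i _; rewrite [RHS]mulr_sumr; apply: eq_bigr => j _.
by rewrite [RHS]mulr_sumr; apply: eq_bigr => m _; rewrite [RHS]mulrA mulKf ?pnatr_eq0.
Qed.

End IstatMoments.

Theorem theorem3p1 (R : realType) (d : measure_display) (T : measurableType d)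
    (P : probability T R) (C : nat -> R) (X : nat -> nat -> bool -> T -> R) :
  isotropic_gaussian_coeffs P C X ->
  (forall l1 l2 l3 : nat, admissible l1 l2 l3 ->
     ('E_P[fun w => (Istat C X l1 l2 l3 w ^+ 2)%R] = (Delta3 l1 l2 l3 : R)%:E)%E) /\
  (forall p : nat, (2 <= p <= 4)%N ->
     exists c : R, forall l1 l2 l3 : nat, admissible l1 l2 l3 ->
       (`| 'E_P[fun w => (Istat C X l1 l2 l3 w ^+ p.*2)%R]
           - ((odd_dfact p)%:R * (Delta3 l1 l2 l3 : R) ^+ p)%R%:E |
        <= (c / l1%:R)%R%:E)%E).
Proof.
move=> gauss; split=> [l1 l2 l3 adm|p _].
  have [E _] := btensor_moments R adm.
  by rewrite (Istat_moment gauss 2 adm) E; congr EFin; field.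
(* The factor is $6^{2p}$ from the normalization of the tensor; the remaining $1/(2l_1+1)$ is at
   most $1/l_1$. *)
exists (36 ^+ p * cM 1 p) => l1 l2 l3 adm.
have [_ /(_ p) B] := btensor_moments R adm.
rewrite (Istat_moment gauss p.*2 adm) -EFinB abse_EFin lee_fin.
set m := cubic_moment _ _ _ in B *.
have -> : 6 ^+ p.*2 = 36 ^+ p :> R by rewrite -muln2 mulnC exprM; congr (_ ^+ p); ring.
have -> : 36 ^+ p * m - (odd_dfact p)%:R * Delta3 l1 l2 l3 ^+ p =
    36 ^+ p * (m - (odd_dfact p)%:R * (Delta3 l1 l2 l3 / 36) ^+ p) :> R.
  rewrite mulrBr mulrCA -exprMn; by congr (_ - _ * _ ^+ p); field.
rewrite normrM ger0_norm ?exprn_ge0 // -mulrA ler_wpM2l ?exprn_ge0 //.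
have l10 : (0 < l1)%N by case/and5P: adm.
(* Read off the estimate itself: a nonnegative quantity is bounded by [cM 1 p] times a positive
   number. *)
have cM0 : 0 <= cM (1 : R) p.
  have := le_trans (normr_ge0 _) B; rewrite pmulr_lge0 // invr_gt0 ltr0Sn.
apply: le_trans B _; rewrite ler_wpM2l // lef_pV2 ?posrE ?ltr0n // ler_nat; lia.
Qed.
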